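(* Fix $d \ge 2$ and a field $k$ with $\operatorname{char} k \nmid d$ and $\mu_d \subset k$. (a) Every dynatomic curve over $k$ is geometrically irreducible. (b) If the dynatomic curves over $k$ are listed in any order, their gonalities tend to $\infty$.
   Context: For $f = z^d+c \in k[c][z]$ with iterates $f^n$ ($f^0(z) := z$), a dynatomic curve over $k$ is the affine curve in $\mathbb{A}^2_k$ defined by an irreducible factor of $f^n(z)-f^m(z) \in k[z,c]$ for some integers $n>m\ge 0$ (or its smooth projective model); two are different if their closed subschemes of $\mathbb{A}^2_k$ differ. $\mu_d$ denotes the set of $d$th roots of unity in an algebraic closure of $k$. The gonality of an irreducible curve $X$ over $k$ is the least degree of a dominant rational map $X \dashrightarrow \mathbb{P}^1_k$. *)

(* Defs.v *)
From HB Require Import structures.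
From mathcomp Require Import all_boot all_order all_algebra.
From mathcomp Require Import ring_quotient fraction.

Set Implicit Arguments.
Unset Strict Implicit.
Unset Printing Implicit Defensive.

Import GRing.Theory.
Local Open Scope ring_scope.

(* The ring k[z, c] is encoded as {poly {poly k}}: the outer variable 'X is z
   and the inner variable ('X)%:P is c. *)

Definition in_principal_ideal (R : comNzRingType) (p q : R) : Prop :=
  exists r : R, q = r * p.

(* Irreducibility in the ring-theoretic sense; [irreducible_poly] is meant for
   coefficients in a field, and would ignore factors in k[c]. *)
Definition irreducible_elt (R : idomainType) (p : R) : Prop :=
  [/\ p != 0, p \isn't a GRing.unit &
      forall a b : R, p = a * b -> a \is a GRing.unit \/ b \is a GRing.unit].

Definition unicritical (k : fieldType) (d : nat) : {poly {poly k}} :=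
  'X^d + ('X)%:P.

Definition iterate (k : fieldType) (d n : nat) : {poly {poly k}} :=
  iter n (fun g => unicritical k d \Po g) 'X.

(* A dynatomic curve is represented by an equation p of it. *)
Definition dynatomic (k : fieldType) (d : nat) (p : {poly {poly k}}) : Prop :=
  irreducible_elt p /\
  exists n m : nat,
    (m < n)%N /\ in_principal_ideal p (iterate k d n - iterate k d m).

(* Closed subschemes of the affine plane correspond to ideals of k[z, c]. *)
Definition same_curve (k : fieldType) (p q : {poly {poly k}}) : Prop :=
  forall r, in_principal_ideal p r <-> in_principal_ideal q r.

Definition dynatomic_listing (k : fieldType) (d : nat)
    (P : nat -> {poly {poly k}}) : Prop :=
  [/\ forall i, dynatomic d (P i),
      forall i j, same_curve (P i) (P j) -> i = j &
      forall p, dynatomic d p -> exists i, same_curve p (P i)].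

(* The points of Spec R are the terms of type [prime_idealr R]. The closed
   subsets of Spec R are the zero loci of arbitrary subsets S of R. *)
Definition zero_locus (R : comNzRingType) (S : R -> Prop)
    (x : prime_idealr R) : Prop :=
  forall r, S r -> r \in (x : {pred R}).

Definition irreducible_subset (R : comNzRingType)
    (Z : prime_idealr R -> Prop) : Prop :=
  (exists x, Z x) /\
  forall S T : R -> Prop,
    (forall x, Z x -> zero_locus S x \/ zero_locus T x) ->
    (forall x, Z x -> zero_locus S x) \/ (forall x, Z x -> zero_locus T x).

Definition base_change (k L : fieldType) (iota : {rmorphism k -> L})
    (p : {poly {poly k}}) : {poly {poly L}} :=
  map_poly (map_poly iota) p.

Definition geometrically_irreducible (k : fieldType)
    (p : {poly {poly k}}) : Prop :=
  forall (L : fieldType) (iota : {rmorphism k -> L}),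
    irreducible_subset (zero_locus (in_principal_ideal (base_change iota p))).

(* pi presents K as the fraction field of k[z, c] / (p); K is viewed as an
   extension of k through pi. *)
Definition is_function_field (k : fieldType) (p : {poly {poly k}})
    (K : fieldType) (pi : {rmorphism {poly {poly k}} -> K}) : Prop :=
  (forall q, pi q = 0 <-> in_principal_ideal p q) /\
  (forall u : K, exists a b, pi b != 0 /\ u = pi a / pi b).

(* [K : h(F)] = n, by existence of a basis indexed by 'I_n. *)
Definition extension_degree (F K : fieldType) (h : {rmorphism F -> K})
    (n : nat) : Prop :=
  exists b : 'I_n -> K, forall u : K,
    exists! a : 'rV[F]_n, u = \sum_(i < n) h (a 0 i) * b i.

(* A dominant rational map from the curve p = 0 to P^1 is given by the
   k-embedding h of the function field k(t) of P^1 into the function field K of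
   the curve that it induces (t being sent to a rational function which is
   transcendental over k), and its degree is [K : h(k(t))]. *)
Definition has_dominant_map_to_P1 (k : fieldType) (p : {poly {poly k}})
    (n : nat) : Prop :=
  exists (K : fieldType) (pi : {rmorphism {poly {poly k}} -> K}),
    is_function_field p pi /\
    exists h : {rmorphism {fraction {poly k}} -> K},
      (forall a : k, h (tofrac a%:P) = pi a%:P%:P) /\ extension_degree h n.

Definition is_gonality (k : fieldType) (p : {poly {poly k}}) (g : nat) : Prop :=
  has_dominant_map_to_P1 p g /\
  forall n, has_dominant_map_to_P1 p n -> (g <= n)%N.

(* Main.v *)
(* Put c = - w ^ (- d). Over k((w)) the roots z of f^n(z) = f^m(z) are the v_s / w, where
   s runs through the sequences of dth roots of unity with shift^n s = shift^m s, and
   v_s = s_0 + O(w) is the power series over k such that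
   v_s ^ d = 1 + w ^ (d - 1) v_(shift s). So every dynatomic polynomial p has a root over
   k((w)), and it generates the kernel of the evaluation at this root. As polynomials
   whose values are linearly independent series over k stay so over an extension L of k,
   p also generates the kernel over L, which is prime: this is (a).

   For (b), a map of degree g to P^1 gives a nonconstant x in k(w, v_s) such that
   [k(w, v_s) : k(x)] <= n := d g, and we show that n leaves finitely many s.
   - In characteristic l > 0, let q be a power of l such that a ^ q = a for every dth root
     of unity a. The Frobenius sigma : a |-> a ^ q of the coefficients fixes v_s, hence x
     and sigma x satisfy an equation of bidegree at most (n, n), and sigma x <> x ^ q. So
     x has at most n q + n finite values at the points conjugate to s, and each value is
     taken at most n times. This bounds the degree of the monic generator P of the kernel
     of evaluation at (w, v_s). The coefficients of P are fixed by the Frobenius and its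
     total degree is bounded too, so P, and then v_s, lies in a finite set.
   - In characteristic 0, let l be a prime with l = 1 mod d and O a valuation ring of k in
     which l is not invertible. Reduction to the residue field is injective on the dth
     roots of unity, and it does not increase the degree of a suitable x - a, up to a
     scalar. The difficulty is that P may become reducible: the numerator of x can reduce
     to 0 at v_s although not all of its coefficients do. It is then multiplied by the
     complementary factor of P in the reduction of its multiple f^n - f^m, lifted to the
     integers, and divided by its content. This process ends since, as l = 1 mod d, the
     coefficients of v_s are integers modulo l. *)
Require Import Defs.
From HB Require Import structures.
From mathcomp Require Import all_boot all_order all_algebra.
From mathcomp Require Import generic_quotient ring_quotient fraction polyXY.
From mathcomp Require Import cyclic separable cyclotomic finfield.
From mathcomp Require Import boolp classical_sets.
From mathcomp Require Import ring zify.

Set Implicit Arguments.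
Unset Strict Implicit.
Unset Printing Implicit Defensive.

Import GRing.Theory.
Local Open Scope quotient_scope.
Local Open Scope ring_scope.

(** * Power series *)

(** The count in (b) is modelled on the inequality #C(F_q) <= (q + 1) g for a curve C over F_q with
    a map of degree g to P^1 over F_q. As mu_d lies in k, every place of the (w, v)-curve over w = 0
    is rational, and there are as many of them as the degree of this curve over the w-line. But x
    has coefficients in k, which may be infinite, so its values at these places need not lie in F_q.
    The relation R between x and sigma x makes up for this: at a place fixed by sigma, a finite
    value a of x satisfies R(a, a ^ q) = 0. The factor d in n = d g comes from adjoining w, with w ^
    d = - 1 / c, to the function field. In characteristic 0 the valuation ring comes from Zorn's
    lemma, as k is arbitrary: its valuation need not be discrete, nor l generate its maximal ideal.
    Powers of l bound a divisibility only for elements tied to the integers. This is why the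
    coefficients of v_s are shown to be integral over Z[1/d], and to be integers modulo l; the
    latter uses that the dth roots of unity of the residue field lie in F_l. *)

Section ClassicalUnits.
Variable T : comNzRingType.

(** Invertibility is decided classically, which gives a unit ring structure to power series, and
    later to subrings and quotients about which nothing is computable. *)
Definition classical_unit : pred T := fun x => `[< exists y, y * x = 1 >].
Definition classical_inv (x : T) : T :=
  if pselect (exists y, y * x = 1) is left e then projT1 (cid e) else x.

Lemma classical_mulVr : {in classical_unit, left_inverse 1 classical_inv *%R}.
Proof.
move=> x /asboolP e; rewrite /classical_inv.
by case: pselect => // e'; case: (cid e').
Qed.
Lemma classical_unitP (x y : T) : y * x = 1 -> classical_unit x.
Proof. by move=> e; apply/asboolP; exists y. Qed.
Lemma classical_inv_out :
  {in [predC classical_unit], classical_inv =1 id}.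
Proof.
move=> x; rewrite inE => /asboolPn ne; rewrite /classical_inv.
by case: pselect.
Qed.
End ClassicalUnits.

Record series (R : Type) := Series { coefs : nat -> R }.

Lemma seriesP (R : Type) (u v : series R) : coefs u =1 coefs v -> u = v.
Proof. by case: u v => [u] [v] /= /funext ->. Qed.

HB.instance Definition _ (R : Type) := gen_eqMixin (series R).
HB.instance Definition _ (R : Type) := gen_choiceMixin (series R).

Section SeriesRing.
Variable R : comNzRingType.
Implicit Types u v t : series R.

Definition series_const (a : R) := Series (fun n => a *+ (n == 0)%N).
Definition series_add u v := Series (fun n => coefs u n + coefs v n).
Definition series_opp u := Series (fun n => - coefs u n).
Definition series_mul u v :=
  Series (fun n => \sum_(i < n.+1) coefs u i * coefs v (n - i)%N).

Definition series_trunc n u : {poly R} := \poly_(i < n) coefs u i.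

(* The ring laws are inherited from polynomials, through truncations. *)
Lemma coef_series_mul n N u v : (n < N)%N ->
  coefs (series_mul u v) n = (series_trunc N u * series_trunc N v)`_n.
Proof.
move=> nN; rewrite coefM; apply: eq_bigr => i _; rewrite !coef_poly.
have -> : (i < N)%N by apply: leq_trans nN; apply: ltn_ord.
by have -> : (n - i < N)%N by apply: leq_ltn_trans nN; apply: leq_subr.
Qed.

Lemma coef_mul_eq n (p p' q q' : {poly R}) :
  (forall i, (i <= n)%N -> p`_i = p'`_i) ->
  (forall i, (i <= n)%N -> q`_i = q'`_i) -> (p * q)`_n = (p' * q')`_n.
Proof.
move=> hp hq; rewrite !coefM; apply: eq_bigr => i _.
by rewrite hp ?hq ?leq_subr // -ltnS ltn_ord.
Qed.

Lemma coef_series_trunc n N u : (n < N)%N -> (series_trunc N u)`_n = coefs u n.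
Proof. by move=> nN; rewrite coef_poly nN. Qed.

Lemma series_addA : associative series_add.
Proof. by move=> u v t; apply: seriesP => n /=; rewrite addrA. Qed.
Lemma series_addC : commutative series_add.
Proof. by move=> u v; apply: seriesP => n /=; rewrite addrC. Qed.
Lemma series_add0 : left_id (series_const 0) series_add.
Proof. by move=> u; apply: seriesP => n /=; rewrite mul0rn add0r. Qed.
Lemma series_addN : left_inverse (series_const 0) series_opp series_add.
Proof. by move=> u; apply: seriesP => n /=; rewrite mul0rn addNr. Qed.

Lemma series_mulA : associative series_mul.
Proof.
move=> u v t; apply: seriesP => n.
rewrite !(@coef_series_mul n n.+1) //.
transitivity ((series_trunc n.+1 u * (series_trunc n.+1 v * series_trunc n.+1 t))`_n).
  apply: coef_mul_eq => // i iN.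
  by rewrite coef_series_trunc // (@coef_series_mul _ n.+1).
rewrite mulrA; apply: coef_mul_eq => // i iN.
by rewrite coef_series_trunc // (@coef_series_mul _ n.+1).
Qed.

Lemma series_mulC : commutative series_mul.
Proof.
by move=> u v; apply: seriesP => n; rewrite !(@coef_series_mul n n.+1) // mulrC.
Qed.

Lemma series_mul1 : left_id (series_const 1) series_mul.
Proof.
move=> u; apply: seriesP => n /=.
rewrite big_ord_recl /= mul1r subn0 big1 ?addr0 // => i _.
by rewrite mul0r.
Qed.

Lemma series_mulDl : left_distributive series_mul series_add.
Proof.
move=> u v t; apply: seriesP => n /=.
by rewrite -big_split /=; apply: eq_bigr => i _; rewrite mulrDl.
Qed.

Lemma series_1neq0 : series_const 1 != series_const 0.
Proof.
by apply/eqP => /(congr1 (fun u => coefs u 0%N)) /= /eqP; rewrite oner_eq0.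
Qed.

HB.instance Definition _ := GRing.isZmodule.Build (series R)
  series_addA series_addC series_add0 series_addN.
HB.instance Definition _ := GRing.Zmodule_isComNzRing.Build (series R)
  series_mulA series_mulC series_mul1 series_mulDl series_1neq0.

Lemma coefs0 n : coefs (0 : series R) n = 0.
Proof. by rewrite /= mul0rn. Qed.
Lemma coefs1 n : coefs (1 : series R) n = (n == 0)%:R.
Proof. by []. Qed.
Lemma coefsD u v n : coefs (u + v) n = coefs u n + coefs v n. Proof. by []. Qed.
Lemma coefsB u v n : coefs (u - v) n = coefs u n - coefs v n. Proof. by []. Qed.
Lemma coefsM u v n :
  coefs (u * v) n = \sum_(i < n.+1) coefs u i * coefs v (n - i)%N.
Proof. by []. Qed.
Lemma coefs_sum I (r : seq I) (P : pred I) (F : I -> series R) n :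
  coefs (\sum_(i <- r | P i) F i) n = \sum_(i <- r | P i) coefs (F i) n.
Proof. by elim/big_rec2: _ => [|i x y _ <-]; rewrite ?coefs0 ?coefsD. Qed.

Definition poly_series (p : {poly R}) : series R := Series (fun n => p`_n).

Lemma poly_series_is_zmod_morphism : zmod_morphism poly_series.
Proof. by move=> p q; apply: seriesP => n; rewrite coefsB /= coefB. Qed.
Lemma poly_series_is_monoid_morphism : monoid_morphism poly_series.
Proof.
split; first by apply: seriesP => n /=; rewrite coef1; case: n.
by move=> p q; apply: seriesP => n; rewrite coefsM /= coefM.
Qed.
HB.instance Definition _ := GRing.isZmodMorphism.Build {poly R} (series R)
  poly_series poly_series_is_zmod_morphism.
HB.instance Definition _ := GRing.isMonoidMorphism.Build {poly R} (series R)
  poly_series poly_series_is_monoid_morphism.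

Lemma poly_series_inj : injective poly_series.
Proof.
by move=> p q e; apply/polyP => n; apply: (congr1 (fun u => coefs u n) e).
Qed.

Definition wvar : series R := poly_series 'X.
Definition cst (a : R) : series R := poly_series a%:P.

Lemma cst_is_zmod_morphism : zmod_morphism cst.
Proof. by move=> a b; rewrite /cst -!rmorphB. Qed.
Lemma cst_is_monoid_morphism : monoid_morphism cst.
Proof. by split=> [|a b]; rewrite /cst -?rmorphM ?rmorph1. Qed.
HB.instance Definition _ := GRing.isZmodMorphism.Build R (series R)
  cst cst_is_zmod_morphism.
HB.instance Definition _ := GRing.isMonoidMorphism.Build R (series R)
  cst cst_is_monoid_morphism.

Lemma coefs_cst a n : coefs (cst a) n = a *+ (n == 0)%N.
Proof. by rewrite /= coefC; case: n. Qed.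

Lemma coefs_wXM n u m :
  coefs (wvar ^+ n * u) m = if (m < n)%N then 0 else coefs u (m - n).
Proof.
rewrite /wvar -rmorphXn (@coef_series_mul m m.+1) //.
have -> : (series_trunc m.+1 (poly_series 'X^n) * series_trunc m.+1 u)`_m =
          ('X^n * series_trunc m.+1 u)`_m.
  by apply: coef_mul_eq => // i im; rewrite coef_series_trunc.
rewrite coefXnM; case: ifP => // _; rewrite coef_series_trunc //.
by rewrite ltnS leq_subr.
Qed.

Lemma coefs_wM u m : coefs (wvar * u) m = if m is m'.+1 then coefs u m' else 0.
Proof. by rewrite -[wvar]expr1 coefs_wXM; case: m => //= m; rewrite subn1. Qed.

Lemma coefs_cstM a u n : coefs (cst a * u) n = a * coefs u n.
Proof.
rewrite coefsM big_ord_recl /= coefC /= subn0 big1 ?addr0 // => i _.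
by rewrite coefC /= mul0r.
Qed.

Lemma series_wX_inj n : injective (fun u => wvar ^+ n * u).
Proof.
move=> u v e; apply: seriesP => m; have := congr1 (fun t => coefs t (m + n)%N) e.
by rewrite !coefs_wXM ltnNge leq_addl addnK.
Qed.

Lemma series_eqmod n u v : (forall i, (i < n)%N -> coefs u i = coefs v i) ->
  exists t, u = v + wvar ^+ n * t.
Proof.
move=> e; exists (Series (fun m => coefs u (m + n)%N - coefs v (m + n)%N)).
apply: seriesP => m; rewrite coefsD coefs_wXM; case: ltnP => [/e ->|nm] /=.
  by rewrite addr0.
by rewrite subnK // addrC subrK.
Qed.

Lemma coefsM0 u v : coefs (u * v) 0 = coefs u 0%N * coefs v 0%N.
Proof. by rewrite coefsM big_ord_recl big_ord0 /= subnn addr0. Qed.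

Definition coefs_at0 u := coefs u 0%N.
Lemma coefs_at0_is_zmod_morphism : zmod_morphism coefs_at0.
Proof. by []. Qed.
Lemma coefs_at0_is_monoid_morphism : monoid_morphism coefs_at0.
Proof. by split=> // u v; rewrite /coefs_at0 coefsM0. Qed.
HB.instance Definition _ := GRing.isZmodMorphism.Build (series R) R
  coefs_at0 coefs_at0_is_zmod_morphism.
HB.instance Definition _ := GRing.isMonoidMorphism.Build (series R) R
  coefs_at0 coefs_at0_is_monoid_morphism.

End SeriesRing.

HB.instance Definition _ (R : comNzRingType) :=
  GRing.ComNzRing_hasMulInverse.Build (series R)
    (@classical_mulVr (series R)) (@classical_unitP (series R))
    (@classical_inv_out (series R)).

Section SeriesDomain.
Variable R : idomainType.
Implicit Types u v t : series R.

Lemma series_neq0P u : u != 0 ->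
  exists n t, u = wvar R ^+ n * t /\ coefs t 0%N != 0.
Proof.
move=> u0; have ex : exists n, coefs u n != 0.
  apply: contrapT => /forallNP h; move/eqP: u0; apply; apply: seriesP => n.
  by rewrite coefs0; apply/eqP; rewrite -[_ == _]negbK; apply/negP/h.
have [n un minn] := ex_minnP ex.
have [i|t ut] := @series_eqmod R n u 0.
  rewrite coefs0 => ni; apply/eqP; rewrite -[_ == _]negbK; apply/negP => /minn.
  by rewrite leqNgt ni.
exists n, t; rewrite ut add0r; split=> //; move: un.
by rewrite ut add0r coefs_wXM ltnn subnn.
Qed.

Lemma series_mulf_eq0 u v : u * v = 0 -> (u == 0) || (v == 0).
Proof.
have [//|/series_neq0P [n [t [-> t0]]]] := eqVneq u 0.
have [//|/series_neq0P [m [s [-> s0]]]] := eqVneq v 0; rewrite ?orbT //.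
rewrite mulrACA -exprD => /(congr1 (fun u => coefs u (n + m)%N)).
rewrite coefs_wXM ltnn subnn coefsM0 coefs0 => /eqP.
by rewrite mulf_eq0 (negPf t0) (negPf s0).
Qed.

HB.instance Definition _ := GRing.ComUnitRing_isIntegral.Build (series R)
  series_mulf_eq0.
End SeriesDomain.

Lemma wvar_neq0 (R : comNzRingType) : wvar R != 0.
Proof.
by rewrite -(rmorph0 (@poly_series R)) (inj_eq (@poly_series_inj R)) polyX_eq0.
Qed.
Lemma cst_inj (R : comNzRingType) : injective (@cst R).
Proof. by move=> a b /(@poly_series_inj R) /polyC_inj. Qed.

(** Up to a constant factor u is 1 - w b, and its inverse is the geometric series in w b;
    coefficient n is read off the partial sum with n + 1 terms, as the later terms are divisible by
    w^(n+1). *)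
Lemma series_inv_exists (k : comUnitRingType) (u : series k) :
  coefs u 0%N \is a GRing.unit -> exists v, u * v = 1.
Proof.
move=> u0; pose a := coefs u 0%N.
have [i|t ut] := @series_eqmod k 1 u (cst a).
  by case: i => // _; rewrite coefs_cst.
rewrite expr1 in ut; pose b := - cst a^-1 * t.
have {}ut : u = cst a * (1 - wvar k * b).
  rewrite ut /b mulrBr mulr1 mulNr !mulrN opprK; congr (_ + _).
  by rewrite (mulrCA (cst a)) (mulrA (cst a)) -rmorphM divrr // rmorph1 mul1r.
pose S N := \sum_(i < N) (wvar k * b) ^+ i.
have ES N n : (n < N)%N -> coefs (S N) n = coefs (S n.+1) n.
  move=> nN; rewrite -(subnKC nN) /S big_split_ord coefsD.
  rewrite !coefs_sum [X in _ + X]big1 ?addr0 // => i _.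
  by rewrite exprMn coefs_wXM /= ltn_addr.
pose v := Series (fun n => coefs (S n.+1) n).
have e : (1 - wvar k * b) * v = 1.
  apply: seriesP => n.
  transitivity (coefs ((1 - wvar k * b) * S n.+1) n).
    rewrite !coefsM; apply: eq_bigr => i _; congr (_ * _) => /=.
    by rewrite -(ES n.+1) // ltnS leq_subr.
  rewrite -opprB mulNr -subrX1 opprB.
  by rewrite coefsB exprMn coefs_wXM ltnSn subr0.
exists (cst a^-1 * v).
by rewrite ut mulrACA -rmorphM divrr // rmorph1 mul1r.
Qed.

(** The second alternative is strict, hence the factor [wvar k]: if u / v has a pole, then v / u has
    the value 0. *)
Lemma series_valuation_ring (k : fieldType) (u v : series k) :
  v != 0 -> (exists t, u = t * v) \/ (exists t, v = wvar k * t * u).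
Proof.
move=> v0; have [->|u0] := eqVneq u 0; first by left; exists 0; rewrite mul0r.
have [n [a [-> a0]]] := series_neq0P u0.
have [m [b [-> b0]]] := series_neq0P v0.
rewrite -!unitfE in a0 b0.
have [a' aa'] := series_inv_exists a0; have [b' bb'] := series_inv_exists b0.
case: (leqP m n) => [mn|nm].
  left; exists (wvar k ^+ (n - m) * a * b').
  have -> : wvar k ^+ (n - m) * a * b' * (wvar k ^+ m * b) =
    (wvar k ^+ (n - m) * wvar k ^+ m) * a * (b * b') by ring.
  by rewrite bb' -exprD subnK // mulr1.
right; exists (wvar k ^+ (m - n.+1) * b * a').
have -> : wvar k * (wvar k ^+ (m - n.+1) * b * a') * (wvar k ^+ n * a) =
  (wvar k ^+ (m - n.+1) * (wvar k * wvar k ^+ n)) * b * (a * a') by ring.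
by rewrite aa' -exprS -exprD subnK // mulr1.
Qed.

Section SeriesMap.
Variables (R S : comNzRingType) (f : {rmorphism R -> S}).

Definition series_map (u : series R) : series S :=
  Series (fun n => f (coefs u n)).

Lemma series_map_is_zmod_morphism : zmod_morphism series_map.
Proof. by move=> u v; apply: seriesP => n; rewrite coefsB /= rmorphB. Qed.
Lemma series_map_is_monoid_morphism : monoid_morphism series_map.
Proof.
split=> [|u v]; apply: seriesP => n; first by rewrite /= rmorphMn rmorph1.
by rewrite coefsM /= rmorph_sum; apply: eq_bigr => i _; rewrite rmorphM.
Qed.
HB.instance Definition _ := GRing.isZmodMorphism.Build (series R) (series S)
  series_map series_map_is_zmod_morphism.
HB.instance Definition _ := GRing.isMonoidMorphism.Build (series R) (series S)
  series_map series_map_is_monoid_morphism.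

Lemma coefs_map u n : coefs (series_map u) n = f (coefs u n). Proof. by []. Qed.

Lemma series_map_poly p : series_map (poly_series p) = poly_series (map_poly f p).
Proof. by apply: seriesP => n; rewrite /= coef_map. Qed.
Lemma series_map_w : series_map (wvar R) = wvar S.
Proof. by rewrite /wvar series_map_poly map_polyX. Qed.
Lemma series_map_cst a : series_map (cst a) = cst (f a).
Proof. by rewrite /cst series_map_poly map_polyC. Qed.

Lemma series_map_inj : injective f -> injective series_map.
Proof.
move=> fI u v e; apply: seriesP => n; apply: fI.
exact: (congr1 (fun t => coefs t n) e).
Qed.
End SeriesMap.
Arguments coefs {R} _ _ : simpl never.

(** * Points of the dynatomic curves with values in power series *)

Definition shift (T : Type) (s : nat -> T) : nat -> T := fun i => s i.+1.
Definition itinerary (R : nzRingType) (d : nat) (s : nat -> R) : Prop :=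
  forall i, s i ^+ d = 1.

(* Writing c = - t^d and w = 1/t, the point of the itinerary s is v_s / w with
   v_s = s_0 + O(w); the equation f(v_s / w) = v_(shift s) / w is
   v_s ^ d = 1 + w ^ (d - 1) v_(shift s), and it is solved by iterating the
   simplified Newton step below. *)
Section PointSeries.
Variables (R : comUnitRingType) (d : nat).
Implicit Types (s : nat -> R) (V : (nat -> R) -> series R).

Definition newton V s : series R :=
  V s - cst (d%:R^-1 * s 0%N) *
        (V s ^+ d - 1 - wvar R ^+ d.-1 * V (shift s)).

Definition approx n s : series R := iter n newton (fun s => cst (s 0%N)) s.

Definition point_series s : series R := Series (fun n => coefs (approx n s) n).

Hypotheses (d_gt1 : (1 < d)%N) (dU : d%:R \is a @GRing.unit R).

Lemma itinerary_shift s : itinerary d s -> itinerary d (shift s).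
Proof. by move=> h i; apply: h. Qed.

Lemma itinerary_pred s i : itinerary d s -> s i ^+ d.-1 * s i = 1.
Proof. by move=> h; rewrite -exprSr prednK ?h // ltnW. Qed.

Lemma coefs_lowXM n m (t : series R) : (m < n)%N -> coefs (wvar R ^+ n * t) m = 0.
Proof. by rewrite coefs_wXM => ->. Qed.

(** The factor [d%:R^-1 * s 0%N] inverts the derivative d s_0^(d-1), because s_0^d = 1. So the
    linear part of the error cancels at the first coefficient where V and V' may differ, and one
    coefficient is gained; the error made at [shift s] is delayed by w^(d-1), and d > 1. *)
Lemma newton_contract V V' n :
  (forall s, itinerary d s -> coefs (V s) 0%N = s 0%N) ->
  (forall s, itinerary d s -> coefs (V' s) 0%N = s 0%N) ->
  (forall s, itinerary d s -> forall i, (i < n.+1)%N ->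
     coefs (V s) i = coefs (V' s) i) ->
  forall s, itinerary d s -> forall i, (i < n.+2)%N ->
     coefs (newton V s) i = coefs (newton V' s) i.
Proof.
move=> V0 V'0 eVV' s hs i iN.
have [t et] := series_eqmod (eVV' s hs).
have [t' et'] := series_eqmod (eVV' _ (itinerary_shift hs)).
apply/eqP; rewrite -subr_eq0 -coefsB; apply/eqP.
pose S := \sum_(j < d) V s ^+ (d.-1 - j) * V' s ^+ j.
have eS : V s ^+ d - V' s ^+ d = (V s - V' s) * S.
  by rewrite subrXX; congr (_ * _); apply: eq_bigr => j _; rewrite -subn1 subnAC subn1.
have -> : newton V s - newton V' s = wvar R ^+ n.+1 *
   (t * (1 - cst (d%:R^-1 * s 0%N) * S)
    + wvar R ^+ d.-1 * (cst (d%:R^-1 * s 0%N) * t')).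
  have e1 : V s - V' s = wvar R ^+ n.+1 * t by rewrite et addrC addKr.
  have e2 : V (shift s) - V' (shift s) = wvar R ^+ n.+1 * t'.
    by rewrite et' addrC addKr.
  rewrite /newton.
  transitivity ((V s - V' s) - cst (d%:R^-1 * s 0%N) * ((V s ^+ d - V' s ^+ d)
    - wvar R ^+ d.-1 * (V (shift s) - V' (shift s)))); first by ring.
  by rewrite eS e1 e2; ring.
rewrite coefs_wXM; case: ltnP => // ni; have -> : i = n.+1 by lia.
rewrite subnn coefsD coefsM0 coefsB coefs_cstM.
have -> : coefs S 0%N = d%:R * s 0%N ^+ d.-1.
  rewrite /S coefs_sum (eq_bigr (fun=> s 0%N ^+ d.-1)) ?sumr_const ?card_ord.
    by rewrite mulr_natl.
  move=> j _; rewrite -/(coefs_at0 _) rmorphM !rmorphXn /= /coefs_at0 V0 // V'0 //.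
  by rewrite -exprD subnK // -ltnS prednK // ltnW.
rewrite coefs_lowXM ?addr0; last by rewrite -subn1 subn_gt0.
have -> : d%:R^-1 * s 0%N * (d%:R * s 0%N ^+ d.-1) =
   (d%:R^-1 * d%:R) * (s 0%N ^+ d.-1 * s 0%N) by ring.
by rewrite mulVr // itinerary_pred // mulr1 subrr mulr0.
Qed.

Lemma newton_coefs0 V :
  (forall s, itinerary d s -> coefs (V s) 0%N = s 0%N) ->
  forall s, itinerary d s -> coefs (newton V s) 0%N = s 0%N.
Proof.
move=> V0 s hs; rewrite /newton coefsB coefs_cstM !coefsB.
rewrite -[coefs (V s ^+ d) _]/(coefs_at0 _) rmorphXn /= /coefs_at0 !V0 // hs.
rewrite coefs_lowXM; last by rewrite -subn1 subn_gt0.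
by rewrite coefs1 subrr subr0 mulr0 subr0.
Qed.

Lemma approx_coefs0 n s : itinerary d s -> coefs (approx n s) 0%N = s 0%N.
Proof.
elim: n s => [|n IH] s hs; first by rewrite /approx /= coefs_cst.
exact: newton_coefs0.
Qed.

Lemma approx_stable n m s i : itinerary d s -> (i <= n)%N -> (n <= m)%N ->
  coefs (approx m s) i = coefs (approx n s) i.
Proof.
move=> hs; elim: n m s hs i => [|n IH] m s hs i.
  by rewrite leqn0 => /eqP -> _; rewrite !approx_coefs0.
move=> iN; case: m => // m; rewrite ltnS => nm.
apply: (newton_contract (n := n)) => // s' hs'; rewrite -/(approx _ _).
- exact: approx_coefs0.
- exact: approx_coefs0.
by move=> j; rewrite ltnS => jn; apply: IH.
Qed.

Lemma point_series_approx n s i : itinerary d s -> (i <= n)%N ->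
  coefs (point_series s) i = coefs (approx n s) i.
Proof. by move=> hs iN; rewrite (approx_stable hs (leqnn i)). Qed.

Lemma point_series0 s : itinerary d s -> coefs (point_series s) 0%N = s 0%N.
Proof. by move=> hs; rewrite (@point_series_approx 0) // approx_coefs0. Qed.

Lemma point_seriesE s : itinerary d s ->
  point_series s ^+ d = 1 + wvar R ^+ d.-1 * point_series (shift s).
Proof.
move=> hs; have efix : newton point_series s = point_series s.
  apply: seriesP => i; rewrite (@point_series_approx i.+1) //.
  apply: (newton_contract (n := i)) => // [s' hs'|s' hs'|s' hs' j ji].
  - exact: point_series0.
  - exact: approx_coefs0.
  - exact: point_series_approx.
have : cst (d%:R^-1 * s 0%N) *
        (point_series s ^+ d - 1 - wvar R ^+ d.-1 * point_series (shift s)) = 0.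
  by rewrite -[RHS](subrr (point_series s)) -{3}efix /newton; ring.
move/(congr1 (fun u => cst (d%:R * s 0%N ^+ d.-1) * u)).
rewrite mulr0 mulrA -rmorphM.
have -> : d%:R * s 0%N ^+ d.-1 * (d%:R^-1 * s 0%N) =
   (d%:R * d%:R^-1) * (s 0%N ^+ d.-1 * s 0%N) by ring.
rewrite divrr // itinerary_pred // mulr1 rmorph1 mul1r => /eqP.
by rewrite -addrA -opprD subr_eq0 => /eqP.
Qed.

(** The equation of the point determines the series of [shift s] from that of [s], so the entries of
    [s] are read off one after the other as constant coefficients. *)
Lemma point_series_inj s s' : itinerary d s -> itinerary d s' ->
  point_series s = point_series s' -> s =1 s'.
Proof.
move=> + + + i; elim: i s s' => [|i IH] s s' hs hs' e.
  by rewrite -point_series0 // e point_series0.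
apply: (IH (shift s) (shift s')); try exact: itinerary_shift.
apply: (@series_wX_inj _ d.-1); apply: (addrI 1).
by rewrite -!point_seriesE // e.
Qed.

(** It serves for two subrings: the integers modulo l, and the elements that are integral over Z up
    to a power of d. *)
Lemma point_series_closed (P : R -> Prop) :
  P 1 -> (forall a b, P a -> P b -> P (a - b)) ->
  (forall a b, P a -> P b -> P (a * b)) -> P d%:R^-1 ->
  forall s, (forall i, P (s i)) -> forall n, P (coefs (point_series s) n).
Proof.
move=> P1 PB PM PV s Ps n; rewrite -[coefs _ n]/(coefs (approx n s) n).
have P0 : P 0 by rewrite -(subrr 1); apply: PB.
have PN a : P a -> P (- a) by rewrite -sub0r; apply: PB.
have PD a b : P a -> P b -> P (a + b) by move=> Pa Pb; rewrite -[b]opprK; apply/PB/PN.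
pose Q (u : series R) := forall n, P (coefs u n).
have QM u v : Q u -> Q v -> Q (u * v).
  move=> Qu Qv m; rewrite coefsM; elim/big_ind: _ => // i _.
  by apply: PM; [apply: Qu | apply: Qv].
have QB u v : Q u -> Q v -> Q (u - v) by move=> Qu Qv m; rewrite coefsB; apply: PB.
have Qc a : P a -> Q (cst a).
  by move=> Pa m; rewrite coefs_cst; case: (m == _); rewrite ?mulr0n ?mulr1n.
have Q1 : Q 1 by rewrite -(rmorph1 (@cst R)); apply: Qc.
have QX u m : Q u -> Q (u ^+ m).
  by move=> Qu; elim: m => [|m IH]; rewrite ?expr0 ?exprS //; apply: QM.
have Qw m : Q (wvar R ^+ m).
  apply: QX => i; have -> : coefs (wvar R) i = ('X : {poly R})`_i by [].
  by rewrite coefX; case: (_ == _).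
move: {1}n => N.
suff: Q (approx N s) by apply.
elim: N s Ps => [|N IH] s Ps; first exact/Qc/Ps.
rewrite /approx /= -/(approx N) /newton.
apply: (QB); first exact: IH.
apply: (QM); first exact/Qc/PM.
apply: (QB); last by apply: (QM) => //; apply: (IH (shift s)) => i; apply: Ps.
by apply: (QB) => //; apply/QX/IH.
Qed.
End PointSeries.

Lemma point_series_map (R S : comUnitRingType) (f : {rmorphism R -> S}) d s :
  d%:R \is a @GRing.unit R ->
  series_map f (point_series d s) = point_series d (f \o s).
Proof.
move=> dU; apply: seriesP => n; rewrite -[RHS]/(coefs (approx d n (f \o s)) n).
rewrite -[LHS]/(coefs (series_map f (approx d n s)) n); congr (coefs _ n).
move: n => N; elim: N s => [|N IH] s; first by rewrite /approx /= series_map_cst.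
rewrite /approx /= -!/(approx d N) /newton !(rmorphB, rmorphM, rmorphXn, rmorph1) /=.
by rewrite series_map_w !series_map_cst rmorphV // rmorph_nat !IH.
Qed.

Lemma coefs_poly (R : comNzRingType) (p : {poly R}) n :
  coefs (poly_series p) n = p`_n.
Proof. by []. Qed.

Definition ev (R : comNzRingType) (V : series R) :
  {rmorphism {poly {poly R}} -> series R} :=
  (horner_eval V \o map_poly (@poly_series R))%FUN.

Lemma evX (R : comNzRingType) (V : series R) : ev V 'X = V.
Proof. by rewrite /= map_polyX /horner_eval hornerX. Qed.
Lemma evC (R : comNzRingType) (V : series R) p : ev V p%:P = poly_series p.
Proof. by rewrite /= map_polyC /horner_eval hornerC. Qed.

Lemma ev_horner (R : comNzRingType) (V : series R) P :
  ev V P = (map_poly (@poly_series R) P).[V].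
Proof. by []. Qed.

Lemma ev_map (R S : comNzRingType) (f : {rmorphism R -> S}) (V : series R) P :
  series_map f (ev V P) = ev (series_map f V) (map_poly (map_poly f) P).
Proof.
rewrite /ev /= /horner_eval -horner_map -!map_poly_comp /=; congr (_.[_]).
by apply: eq_map_poly => p /=; rewrite series_map_poly.
Qed.

Opaque ev.
Arguments ev : simpl never.

Definition preperiodic (T : Type) (n m : nat) (s : nat -> T) : Prop :=
  forall i, s (i + n)%N = s (i + m)%N.

Lemma iter_shift (T : Type) n (s : nat -> T) : iter n (@shift T) s = fun i => s (i + n)%N.
Proof.
elim: n => [|n IH] /=; apply: funext => i; first by rewrite addn0.
by rewrite IH /shift addSnnS.
Qed.

Lemma size_monic_exp (R : nzRingType) (p : {poly R}) e :
  p \is monic -> size (p ^+ e) = ((size p).-1 * e).+1.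
Proof.
move=> mon; elim: e => [|e IH]; first by rewrite expr0 size_poly1 muln0.
rewrite exprS size_monicM // ?monic_neq0 ?monic_exp // IH.
have: (0 < size p)%N by rewrite size_poly_gt0 monic_neq0.
by lia.
Qed.

(* gpoly n is w ^ (d ^ n) f^n(v / w), and cycle_poly n m is
   w ^ (d ^ n) (f^n - f^m)(v / w), where w and v are the inner and the outer
   variables. *)
Section CyclePoly.
Variables (R : comNzRingType) (d : nat).

Fixpoint gpoly n : {poly {poly R}} :=
  if n is n'.+1 then gpoly n' ^+ d - ('X ^+ (d ^ n - d))%:P else 'X.

Definition cycle_poly n m : {poly {poly R}} :=
  gpoly n - ('X ^+ (d ^ n - d ^ m))%:P * gpoly m.

Hypothesis d_gt1 : (1 < d)%N.

Lemma monic_size_subl (S : nzRingType) (p q : {poly S}) :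
  p \is monic -> (size q < size p)%N -> p - q \is monic /\ size (p - q) = size p.
Proof.
move=> mon lt; have lt' : (size (- q) < size p)%N by rewrite size_polyN.
by rewrite monicE lead_coefDl // size_polyDl // -monicE.
Qed.

Lemma gpoly_monic_size n : gpoly n \is monic /\ size (gpoly n) = (d ^ n).+1.
Proof.
elim: n => [|n [mon sz]] /=; first by rewrite monicX size_polyX.
have sz' : size (gpoly n ^+ d) = (d ^ n.+1).+1 by rewrite size_monic_exp // sz expnSr.
rewrite -sz'; apply: monic_size_subl; first by rewrite monic_exp.
apply: leq_ltn_trans (size_polyC_leq1 _) _.
by rewrite sz' ltnS expn_gt0 ltnW.
Qed.

Lemma cycle_poly_monic_size n m : (m < n)%N ->
  cycle_poly n m \is monic /\ size (cycle_poly n m) = (d ^ n).+1.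
Proof.
move=> mn; have [mon sz] := gpoly_monic_size n.
rewrite -sz; apply: monic_size_subl => //.
rewrite mul_polyC; apply: leq_ltn_trans (size_scale_leq _ _) _.
by rewrite sz (gpoly_monic_size m).2 ltnS ltn_exp2l.
Qed.
End CyclePoly.

Lemma gpoly_map (R S : comNzRingType) (f : {rmorphism R -> S}) d n :
  map_poly (map_poly f) (gpoly R d n) = gpoly S d n.
Proof.
elim: n => [|n IH] /=; first by rewrite map_polyX.
by rewrite rmorphB rmorphXn /= IH map_polyC /= rmorphXn /= map_polyX.
Qed.

Lemma cycle_poly_map (R S : comNzRingType) (f : {rmorphism R -> S}) d n m :
  map_poly (map_poly f) (cycle_poly R d n m) = cycle_poly S d n m.
Proof.
rewrite /cycle_poly rmorphB rmorphM /= !gpoly_map map_polyC /= rmorphXn /=.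
by rewrite map_polyX.
Qed.

Section EvalCyclePoly.
Variables (R : comUnitRingType) (d : nat).
Hypotheses (d_gt1 : (1 < d)%N) (dU : d%:R \is a @GRing.unit R).
Notation point := (point_series d).

Lemma itinerary_iter (s : nat -> R) n : itinerary d s -> itinerary d (iter n (@shift R) s).
Proof. by rewrite iter_shift => h i; apply: h. Qed.

Lemma ev_gpoly (s : nat -> R) n : itinerary d s ->
  ev (point s) (gpoly R d n) = wvar R ^+ (d ^ n).-1 * point (iter n (@shift R) s).
Proof.
move=> hs; elim: n => [|n IH]; first by rewrite evX expr0 mul1r.
have dn : (0 < d ^ n)%N by rewrite expn_gt0 ltnW.
have e : (d * (d ^ n).-1 = d ^ n.+1 - d)%N by rewrite expnS -subn1 mulnBr muln1.
rewrite [gpoly _ _ _]/= rmorphB rmorphXn [X in X ^+ _]IH evC rmorphXn exprMn -exprM mulnC e.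
rewrite point_seriesE //; last exact: itinerary_iter.
rewrite mulrDr mulr1 addrAC subrr add0r mulrA -exprD; congr (_ ^+ _ * _).
have: (d <= d ^ n.+1)%N by rewrite expnS leq_pmulr.
by move: d_gt1; lia.
Qed.

Lemma ev_cycle_poly (s : nat -> R) n m : (m < n)%N -> itinerary d s ->
  preperiodic n m s -> ev (point s) (cycle_poly R d n m) = 0.
Proof.
move=> mn hs ps; rewrite /cycle_poly rmorphB rmorphM evC !ev_gpoly // rmorphXn mulrA -exprD.
have -> : iter n (@shift R) s = iter m (@shift R) s.
  by rewrite !iter_shift; apply: funext.
have : (0 < d ^ m)%N by rewrite expn_gt0 ltnW.
have : (d ^ m <= d ^ n)%N by rewrite leq_exp2l // ltnW.
move=> h1 h2; have -> : (d ^ n - d ^ m + (d ^ m).-1 = (d ^ n).-1)%N by lia.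
by rewrite subrr.
Qed.
End EvalCyclePoly.

(* In contrast with uniq_roots_prod_XsubC, the differences of the roots need not
   be invertible. *)
Lemma idomain_roots_factor (D : idomainType) (p : {poly D}) (rs : seq D) :
  all (root p) rs -> uniq rs -> exists q, p = q * \prod_(z <- rs) ('X - z%:P).
Proof.
elim: rs p => [|r rs IH] p /=; first by exists p; rewrite big_nil mulr1.
case/andP=> /factor_theorem [q ->] all_rs /andP [r_rs urs].
have [|q' ->] := IH q _ urs; last by exists q'; rewrite big_cons mulrAC mulrA.
apply/allP => z zrs; have := allP all_rs z zrs.
rewrite rootM root_XsubC => /orP [//|/eqP zr].
by rewrite -zr zrs in r_rs.
Qed.

Lemma idomain_roots_prod (D : idomainType) (p : {poly D}) (rs : seq D) :
  p \is monic -> size p = (size rs).+1 -> all (root p) rs -> uniq rs ->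
  p = \prod_(z <- rs) ('X - z%:P).
Proof.
move=> mon sz all_rs /(idomain_roots_factor all_rs) [q def_p].
have mon_prod := monic_prod_XsubC rs predT id.
have q0 : q != 0.
  by apply/eqP => q0; move: sz; rewrite def_p q0 mul0r size_poly0.
move: sz; rewrite def_p size_Mmonic // size_prod_XsubC addnS /= -add1n.
move=> /addIn /eqP /size_poly1P [c _ def_q].
move: mon; rewrite def_p monicE lead_coef_Mmonic // def_q lead_coefC => /eqP ->.
by rewrite mul1r.
Qed.

Section Itineraries.
Variables (R : idomainType) (d : nat) (U : seq R).
Hypotheses (d_gt1 : (1 < d)%N) (dU : d%:R \is a @GRing.unit R).
Hypotheses (U_uniq : uniq U) (U_size : size U = d) (U_root : forall a, a \in U -> a ^+ d = 1).

(** A sequence that is [preperiodic n m] is determined by its first n entries. This leaves d^n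
    choices, which is the degree of f^n - f^m in z. For m < n the default value 0 is never
    reached. *)
Definition extend_preperiodic n m (f : {ffun 'I_n -> 'I_d}) : nat -> R :=
  fun i => if (insub (if (i < n)%N then i else (m + (i - m) %% (n - m)))%N : option 'I_n)
             is Some j then U`_(f j) else 0.

Lemma extend_preperiodicP n m (f : {ffun 'I_n -> 'I_d}) : (m < n)%N ->
  itinerary d (extend_preperiodic m f) /\ preperiodic n m (extend_preperiodic m f).
Proof.
move=> mn; have lt i : ((if (i < n) then i else m + (i - m) %% (n - m)) < n)%N.
  case: ifP => // _; have : ((i - m) %% (n - m) < n - m)%N by rewrite ltn_mod subn_gt0.
  by lia.
split=> i; rewrite /extend_preperiodic;
  first by rewrite (insubT (fun i => i < n)%N (lt i)) U_root // mem_nth // U_size.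
congr (if insub _ is Some j then _ else _).
rewrite ltnNge leq_addl /=; have -> : (i + n - m = i + (n - m))%N by lia.
rewrite modnDr; case: ifP => [h|_]; last by rewrite addnK.
have im : (i < n - m)%N by move: h; lia.
by rewrite (modn_small im) addnC.
Qed.

Lemma extend_preperiodic_inj n m : (m < n)%N ->
  forall f g : {ffun 'I_n -> 'I_d}, extend_preperiodic m f =1 extend_preperiodic m g -> f = g.
Proof.
move=> mn f g e; apply/ffunP => i; have := e i; rewrite /extend_preperiodic ltn_ord valK.
move/eqP; rewrite nth_uniq ?U_size // => /eqP h; exact: val_inj.
Qed.

Definition cycle_roots n m : seq (series R) :=
  [seq point_series d (extend_preperiodic m f) | f <- enum {ffun 'I_n -> 'I_d}].

Lemma cycle_roots_uniq_size n m : (m < n)%N ->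
  uniq (cycle_roots n m) /\ size (cycle_roots n m) = (d ^ n)%N.
Proof.
move=> mn; split; last by rewrite size_map -cardE card_ffun !card_ord.
rewrite map_inj_uniq ?enum_uniq // => f g e; apply: (extend_preperiodic_inj mn).
by apply: point_series_inj e => //; apply: (extend_preperiodicP _ mn).1.
Qed.

Lemma cycle_rootsP n m v : (m < n)%N -> v \in cycle_roots n m ->
  exists s, [/\ v = point_series d s, itinerary d s & preperiodic n m s].
Proof.
move=> mn /mapP [f _ ->]; exists (extend_preperiodic m f).
by have [] := extend_preperiodicP f mn.
Qed.

(** The points of the itineraries are as many distinct roots as the degree allows; in particular all
    roots are simple. *)
Lemma cycle_poly_split n m : (m < n)%N ->
  map_poly (@poly_series R) (cycle_poly R d n m) =
  \prod_(v <- cycle_roots n m) ('X - v%:P).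
Proof.
move=> mn; have [mon sz] := cycle_poly_monic_size R d_gt1 mn.
have [un szr] := cycle_roots_uniq_size mn.
apply: idomain_roots_prod => //.
- exact: monic_map.
- by rewrite size_map_inj_poly ?rmorph0 ?sz ?szr //; apply: poly_series_inj.
- apply/allP => v /(cycle_rootsP mn) [s [-> hs ps]]; apply/eqP; rewrite -ev_horner.
  exact: (ev_cycle_poly d_gt1 dU mn hs ps).
Qed.
End Itineraries.

(** * Geometric irreducibility *)

Lemma ex_minimal (T : Type) (P : T -> Prop) (f : T -> nat) :
  (exists x, P x) -> exists x, P x /\ forall y, P y -> (f x <= f y)%N.
Proof.
move=> [x0 Px0]; have ex : exists n, `[< exists x, P x /\ f x = n >].
  by exists (f x0); apply/asboolP; exists x0.
have [n /asboolP [x [Px <-]] min_n] := ex_minnP ex.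
by exists x; split=> // y Py; apply: min_n; apply/asboolP; exists y.
Qed.

(** * Gauss's lemma and principal kernels in k[c][z] *)

Section Gauss.
Variable k : fieldType.
Implicit Types (b pi : {poly k}) (P Q M : {poly {poly k}}).

Lemma dvdp_coefs_factor pi P :
  (forall i, pi %| P`_i) -> exists P', P = pi%:P * P'.
Proof.
move=> dvd; exists (\poly_(i < size P) (P`_i %/ pi)); apply/polyP => i.
rewrite coefCM coef_poly; case: ltnP => [_|lt]; first by rewrite mulrC divpK.
by rewrite nth_default // mulr0.
Qed.

(** Let i and j be the least indices at which pi does not divide the coefficients of P and of Q. In
    the coefficient of index i + j of the product, all terms but one are divisible by pi. *)
Lemma irreducible_dvdp_coefs_mul pi P Q : irreducible_poly pi ->
  (forall i, pi %| (P * Q)`_i) ->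
  (forall i, pi %| P`_i) \/ (forall i, pi %| Q`_i).
Proof.
move=> irr dvd; apply: contrapT => /not_orP [/existsNP nP /existsNP nQ].
have [i [nPi min_i]] := ex_minimal id nP.
have [j [nQj min_j]] := ex_minimal id nQ.
have low n (S : {poly {poly k}}) m : (forall l, ~ pi %| S`_l -> (n <= l)%N) ->
    (m < n)%N -> pi %| S`_m.
  by move=> h mn; apply: contrapT => /h; rewrite leqNgt mn.
have := dvd (i + j)%N; rewrite coefM.
have li : (i < (i + j).+1)%N by rewrite ltnS leq_addr.
rewrite (bigD1 (Ordinal li)) //= addKn dvdp_addl; last first.
  apply: (big_ind (fun x => pi %| x)) => [|x y|l /eqP ne]; rewrite ?dvdp0 //.
    exact: dvdp_add.
  case: (ltnP l i) => [lt|le]; first by rewrite dvdp_mulr // (low i).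
  rewrite dvdp_mull // (low j) //; have := ltn_ord l.
  have : nat_of_ord l <> i by move=> e; apply: ne; apply: val_inj.
  by lia.
move=> dvd'; have: coprimep pi P`_i.
  rewrite /coprimep; case: eqVneq => // ne.
  case: nPi; have := irr.2 _ ne (dvdp_gcdl _ _).
  by move/eqp_dvdl => <-; apply: dvdp_gcdr.
by move=> cop; apply: nQj; move: dvd'; rewrite Gauss_dvdpr.
Qed.

Lemma irreducible_factor b : (1 < size b)%N ->
  exists pi, irreducible_poly pi /\ pi %| b.
Proof.
move=> b1; have [|pi [[pi1 pib] min_pi]] :=
    @ex_minimal _ (fun q : {poly k} => (1 < size q)%N /\ q %| b) (fun q => size q).
  by exists b.
exists pi; split=> //; split=> // q q1 qpi.
have pi0 : pi != 0 by apply/eqP => e; move: pi1; rewrite e size_poly0.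
have q0 : q != 0 by apply: contraNneq pi0 => q0; move: qpi; rewrite q0 dvd0p.
rewrite -dvdp_size_eqp // eqn_leq dvdp_leq //= min_pi //; split.
  by rewrite ltn_neqAle eq_sym q1 size_poly_gt0.
exact: dvdp_trans pib.
Qed.

(* The equation b P = Q M means that M divides P over the field of fractions of k[X]. *)
Lemma gauss_dvd M : M != 0 -> (forall pi M', M = pi%:P * M' -> size pi = 1%N) ->
  forall b P Q, b != 0 -> b%:P * P = Q * M -> exists Q', P = Q' * M.
Proof.
move=> M0 prim b; have [n] := ubnP (size b).
elim: n b => // n IH b bn P Q b0 e.
case: (ltnP 1 (size b)) => [b1|b1]; last first.
  have sb : size b == 1%N by rewrite eqn_leq b1 size_poly_gt0.
  have [c c0 def_b] := size_poly1P _ sb.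
  exists ((c^-1)%:P%:P * Q); rewrite -mulrA -e def_b mulrA -!polyCM mulVf // mul1r //.
have [pi [irr /dvdpP [b' def_b]]] := irreducible_factor b1.
have dvd i : pi %| (Q * M)`_i.
  by rewrite -e coefCM def_b -mulrA mulrC -mulrA dvdp_mulr.
have pi0 : pi != 0 := irredp_neq0 irr.
have b'0 : b' != 0 by apply: contraNneq b0 => b'0; rewrite def_b b'0 mul0r.
case: (irreducible_dvdp_coefs_mul irr dvd) => /dvdp_coefs_factor [S def_S].
  apply: (IH b' _ P S) => //.
    move: bn; rewrite def_b size_mul //; case: irr => pi1 _.
    have : (0 < size b')%N by rewrite size_poly_gt0.
    by move: (size b') (size pi) pi1 => x y; lia.
  have piC0 : pi%:P != 0 :> {poly {poly k}} by rewrite polyC_eq0.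
  by apply: (mulfI piC0); rewrite mulrA -polyCM mulrC [pi * b']mulrC -def_b mulrC e def_S mulrA.
by have [] := irr; rewrite (prim _ _ def_S).
Qed.

(** The kernel is a prime ideal that meets k[c] in 0. Among its nonzero elements of least degree in
    the outer variable take one whose leading coefficient has least degree, which makes it
    primitive. Pseudo-division by it leaves no remainder, and Gauss's lemma removes the power of the
    leading coefficient. *)
Lemma principal_kernel (D : idomainType) (psi : {rmorphism {poly {poly k}} -> D}) :
  (forall p : {poly k}, psi p%:P = 0 -> p = 0) ->
  exists M, forall P, psi P = 0 <-> exists Q, P = Q * M.
Proof.
move=> inj.
have [ker0|] := pselect (forall P, psi P = 0 -> P = 0).
  exists 0; split=> [/ker0 ->|[Q ->]]; first by exists 0; rewrite mulr0.
  by rewrite mulr0 rmorph0.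
move=> /existsNP [P0 /not_implyP [kerP0 /eqP P0n0]].
have [|M1 [[kerM1 M10] min_M1]] :=
  @ex_minimal _ (fun P => psi P = 0 /\ P != 0) (fun P => size P).
  by exists P0.
have [|M [[kerM M0 leM] min_M]] :=
  @ex_minimal _ (fun P => [/\ psi P = 0, P != 0 & (size P <= size M1)%N])
    (fun P => size (lead_coef P)).
  by exists M1.
exists M => P; split=> [kerP|[Q ->]]; last by rewrite rmorphM /= kerM mulr0.
have eqdiv := Pdiv.WeakIdomain.divp_eq P M.
have rem0 : (P %% M)%R = 0.
  apply: contrapT => /eqP r0.
  have := ltn_modp P M; rewrite M0 ltnNge => /negP; apply.
  apply: leq_trans leM _; apply: min_M1; split=> //.
  move/(congr1 psi): eqdiv; rewrite -mul_polyC !(rmorphM, rmorphD) /= kerP kerM !mulr0.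
  by rewrite add0r.
apply: (gauss_dvd M0 _ (b := lead_coef M ^+ scalp P M) (Q := P %/ M)).
- move=> pi M' def_M; apply/eqP; rewrite eqn_leq size_poly_gt0.
  have pi0 : pi != 0 by apply: contraNneq M0 => pi0; rewrite def_M pi0 mul0r.
  have M'0 : M' != 0 by apply: contraNneq M0 => M'0; rewrite def_M M'0 mulr0.
  rewrite pi0 andbT.
  have lc : lead_coef M = pi * lead_coef M' by rewrite def_M lead_coefM lead_coefC.
  have : (size (lead_coef M) <= size (lead_coef M'))%N.
    apply: min_M; split=> //; last first.
      by apply: leq_trans leM; rewrite def_M mul_polyC size_scale.
    have /eqP := kerM; rewrite def_M rmorphM mulf_eq0 => /orP [/eqP /inj e|/eqP //].
    by rewrite e eqxx in pi0.
  rewrite lc size_mul ?lead_coef_eq0 //.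
  have : (0 < size (lead_coef M'))%N by rewrite size_poly_gt0 lead_coef_eq0.
  by move: (size pi) (size _) => x y; lia.
- by rewrite expf_neq0 // lead_coef_eq0.
by rewrite mul_polyC eqdiv rem0 addr0.
Qed.
End Gauss.

(** * Linear independence of power series over a field and its extensions *)

Definition series_independent (R : comNzRingType) (J : finType) (psi : J -> series R) : Prop :=
  forall a : J -> R, \sum_j cst (a j) * psi j = 0 -> forall j, a j = 0.

(* The columns of a nonsingular minor are chosen one by one, expanding the
   determinant along the last one. *)
Lemma nonzero_minor_ord (R : idomainType) M (psi : 'I_M -> series R) :
  series_independent psi ->
  exists f : 'I_M -> nat, \det (\matrix_(i, j) coefs (psi i) (f j)) != 0.
Proof.
elim: M psi => [|M IH] psi ind.
  by exists (fun=> 0%N); rewrite det_mx00 oner_eq0.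
have [a e|f detf] := IH (fun i => psi (lift ord_max i)).
  move=> j; pose b i := if unlift ord_max i is Some i' then a i' else 0.
  have := ind b; rewrite (bigD1 ord_max) //= {1}/b unlift_none rmorph0 mul0r add0r.
  have -> : \sum_(i < M.+1 | i != ord_max) cst (b i) * psi i =
            \sum_i cst (a i) * psi (lift ord_max i).
    rewrite (reindex_onto (lift ord_max) (fun i => odflt j (unlift ord_max i))) /=.
      apply: eq_big => [i|i _]; last by rewrite /b liftK.
      by rewrite liftK eqxx andbT eq_sym neq_lift.
    by move=> i; case: unliftP => [i' ->|-> /eqP].
  by move=> /(_ e (lift ord_max j)); rewrite /b liftK.
pose g n j := if unlift ord_max j is Some j' then f j' else n.
pose A n := \matrix_(i, j) coefs (psi i) (g n j).
pose c i := cofactor (A 0%N) i ord_max.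
have cE n i : cofactor (A n) i ord_max = c i.
  rewrite /c /cofactor; congr (_ * \det _); apply/matrixP => x y.
  by rewrite !mxE /g liftK.
have c_max : c ord_max != 0.
  rewrite /c /cofactor mulf_neq0 ?signr_eq0 //.
  suff -> : row' ord_max (col' ord_max (A 0%N)) =
     \matrix_(i, j) coefs (psi (lift ord_max i)) (f j) by [].
  by apply/matrixP => x y; rewrite !mxE /g liftK.
have [n nz] : exists n, coefs (\sum_i cst (c i) * psi i) n != 0.
  apply: contrapT => /forallNP h; move/eqP: c_max; apply; apply: ind.
  apply: seriesP => n; rewrite coefs0; apply/eqP/negPn/negP; exact: h.
exists (g n); rewrite (expand_det_col _ ord_max).
suff -> : \sum_i A n i ord_max * cofactor (A n) i ord_max =
          coefs (\sum_i cst (c i) * psi i) n by [].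
rewrite coefs_sum; apply: eq_bigr => i _.
by rewrite cE coefs_cstM mulrC mxE /g unlift_none.
Qed.

Lemma nonzero_minor (R : idomainType) (J : finType) (psi : J -> series R) :
  series_independent psi ->
  exists f : 'I_#|J| -> nat,
    \det (\matrix_(i, j) coefs (psi (enum_val i)) (f j)) != 0.
Proof.
move=> ind; apply: nonzero_minor_ord => a e i.
have := ind (fun j => a (enum_rank j)).
rewrite (reindex (@enum_val J predT)); last by apply/onW_bij/enum_val_bij.
under eq_bigr do rewrite enum_valK.
by move=> /(_ e (enum_val i)); rewrite enum_valK.
Qed.

(** A nonzero minor of the matrix of coefficients stays nonzero in the larger field, and it forces
    any relation over that field to be trivial. *)
Lemma series_independent_map (k L : fieldType) (f : {rmorphism k -> L})
    (J : finType) (psi : J -> series k) :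
  series_independent psi -> series_independent (fun j => series_map f (psi j)).
Proof.
move=> /nonzero_minor [g det_g] a e j.
pose T : 'M[k]_#|J| := \matrix_(i, l) coefs (psi (enum_val i)) (g l).
have UT : map_mx f T \in unitmx.
  by rewrite unitmxE det_map_mx unitfE fmorph_eq0.
pose r : 'rV[L]_#|J| := \row_i a (enum_val i).
have : r *m map_mx f T = 0.
  apply/rowP => l; rewrite !mxE.
  transitivity (coefs (\sum_j cst (a j) * series_map f (psi j)) (g l)); last first.
    by rewrite e coefs0.
  rewrite coefs_sum [RHS](reindex (@enum_val J predT)); last by apply/onW_bij/enum_val_bij.
  by apply: eq_bigr => i _; rewrite !mxE coefs_cstM coefs_map.
move/(congr1 (mulmx^~ (invmx (map_mx f T)))); rewrite mulmxK // mul0mx.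
by move=> /rowP /(_ (enum_rank j)); rewrite !mxE enum_rankK.
Qed.

Lemma poly2_ind (R : comNzRingType) (Q : {poly {poly R}} -> Prop) :
  (forall a, Q a%:P%:P) -> Q ('X)%:P -> Q 'X ->
  (forall A B, Q A -> Q B -> Q (A + B)) -> (forall A B, Q A -> Q B -> Q (A * B)) ->
  forall P, Q P.
Proof.
move=> Qc QC QZ QD QM P; elim/poly_ind: P => [|P p QP]; first exact: (Qc 0).
apply: (QD); first exact: QM.
elim/poly_ind: p => [|p a Qp]; first exact: (Qc 0).
by rewrite polyCD polyCM; apply: (QD) => //; apply: QM.
Qed.

Lemma poly2_morph_eq (R S : comNzRingType) (f g : {rmorphism {poly {poly R}} -> S}) :
  (forall a, f a%:P%:P = g a%:P%:P) -> f ('X)%:P = g ('X)%:P -> f 'X = g 'X ->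
  forall P, f P = g P.
Proof.
move=> ea eC eZ; apply: poly2_ind => // A B; first by rewrite !rmorphD => -> ->.
by rewrite !rmorphM => -> ->.
Qed.

Definition eval2 (R S : comNzRingType) (f : {rmorphism R -> S}) (C Z : S) :
  {rmorphism {poly {poly R}} -> S} :=
  (horner_eval Z \o map_poly (horner_eval C \o map_poly f))%FUN.

Section Eval2.
Variables (R S : comNzRingType) (f : {rmorphism R -> S}) (C Z : S).
Lemma eval2Z : eval2 f C Z 'X = Z.
Proof. by rewrite /= map_polyX /horner_eval hornerX. Qed.
Lemma eval2P p : eval2 f C Z p%:P = (map_poly f p).[C].
Proof. by rewrite /= map_polyC /horner_eval hornerC. Qed.
Lemma eval2C : eval2 f C Z ('X)%:P = C.
Proof. by rewrite eval2P map_polyX hornerX. Qed.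
Lemma eval2c a : eval2 f C Z a%:P%:P = f a.
Proof. by rewrite eval2P map_polyC hornerC. Qed.
End Eval2.
Opaque eval2.
Arguments eval2 : simpl never.

(** * Evaluation of k[c][z] at the point of an itinerary *)

Section Phi.
Variables (k : fieldType) (d : nat).
Hypotheses (d_gt1 : (1 < d)%N) (dU : d%:R \is a @GRing.unit k).
Implicit Types (s : nat -> k).
Local Notation Om := {fraction series k}.
Local Notation fr := (@tofrac (series k)).
Local Notation w := (fr (wvar k)).

Definition const_Om : {rmorphism k -> Om} := (fr \o @cst k)%FUN.
Definition cval : Om := - (w ^+ d)^-1.
Definition zval s : Om := fr (point_series d s) / w.
Definition phi s : {rmorphism {poly {poly k}} -> Om} := eval2 const_Om cval (zval s).

Lemma w_neq0 : w != 0. Proof. by rewrite tofrac_eq0 wvar_neq0. Qed.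

Lemma zval_step s : itinerary d s -> zval s ^+ d + cval = zval (shift s).
Proof.
move=> hs; rewrite /zval expr_div_n -rmorphXn point_seriesE // rmorphD rmorph1.
rewrite mulrDl mul1r /cval addrAC subrr add0r rmorphM rmorphXn.
have wd : w ^+ d = w ^+ d.-1 * w by rewrite -exprSr prednK // ltnW.
by rewrite wd invfM mulrACA divff ?mul1r // expf_neq0 // w_neq0.
Qed.

Lemma phi_iterate s n : itinerary d s ->
  phi s (iterate k d n) = zval (iter n (@shift k) s).
Proof.
move=> hs; elim: n => [|n IH]; first by rewrite eval2Z.
rewrite /iterate iterS -/(iterate k d n) /unicritical comp_polyD rmorphXn /= comp_polyX
  comp_polyC.
rewrite rmorphD rmorphXn [X in X ^+ _]IH [X in _ + X]eval2C zval_step //.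
exact: itinerary_iter.
Qed.

(** For p of degree n, w^(d n) p(c) is a power series whose constant coefficient is the leading
    coefficient of p up to sign. So c is transcendental over k. *)
Lemma phi_inj_coef s p : phi s p%:P = 0 -> p = 0.
Proof.
rewrite eval2P => e; apply: contrapT => /eqP p0.
pose n := (size p).-1.
have szp : size p = n.+1 by rewrite prednK // size_poly_gt0.
pose q := \sum_(i < n.+1) (p`_i * (-1) ^+ i) *: 'X^(d * (n - i)).
have : fr (poly_series q) = 0.
  rewrite -[RHS](mulr0 (w ^+ (d * n))) -e horner_coef size_map_poly szp mulr_sumr.
  rewrite !rmorph_sum; apply: eq_bigr => i _.
  rewrite coef_map /= -mul_polyC !rmorphM /= !rmorphXn /= -/w.
  have -> : (d * n = d * (n - i) + d * i)%N.
    by rewrite -mulnDr subnK // -ltnS.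
  rewrite /cval exprD exprNn exprVn -exprM rmorphN1.
  rewrite -[poly_series (p`_i)%:P]/(cst p`_i).
  have : w ^+ (d * i) != 0 by rewrite expf_neq0 // w_neq0.
  rewrite -[poly_series 'X]/(wvar k).
  have -> : fr (poly_series (-1)) = -1 by rewrite !rmorphN1.
  move: (w ^+ (d * i)) (w ^+ (d * (n - i))) (fr (cst p`_i)) => x y z x0.
  have -> : y * x * (z * ((-1) ^+ i * x^-1)) = y * z * (-1) ^+ i * (x * x^-1) by ring.
  by rewrite divff // mulr1; ring.
move/eqP; rewrite tofrac_eq0 => /eqP /(congr1 (fun u => coefs u 0%N)).
rewrite coefs0 coefs_poly /q coef_sum (bigD1 ord_max) //= subnn muln0 big1 ?addr0.
  rewrite coefZ expr0 coef1 mulr1 => /eqP; rewrite mulf_eq0 signr_eq0 orbF.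
  by rewrite -/(lead_coef p) lead_coef_eq0 (negPf p0).
move=> i /eqP ne; rewrite coefZ coefXn.
have : (0 < n - i)%N.
  rewrite subn_gt0 ltn_neqAle -ltnS ltn_ord andbT; apply/eqP => e'.
  by apply: ne; apply: val_inj.
move=> ni; have : (0 < d * (n - i))%N by rewrite muln_gt0 ni andbT ltnW.
by case: (d * (n - i))%N => // x _; rewrite mulr0.
Qed.
End Phi.

Lemma monic_division (R : nzRingType) (q : {poly R}) : q \is monic ->
  forall p, exists a r, p = a * q + r /\ (size r < size q)%N.
Proof.
move=> mon p; exists (Pdiv.Ring.rdivp p q), (Pdiv.Ring.rmodp p q); split.
  exact: Pdiv.RingMonic.rdivp_eq.
by rewrite Pdiv.Ring.ltn_rmodp monic_neq0.
Qed.

Section KernelIdeal.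
Variables (R : comNzRingType) (D : idomainType) (psi : {rmorphism R -> D}).

Definition kernel_ideal : {pred R} := fun a => psi a == 0.

Lemma kernel_ideal_zmod_closed : zmod_closed kernel_ideal.
Proof.
split=> [|a b]; rewrite !unfold_in ?rmorph0 // => /eqP ea /eqP eb.
by rewrite rmorphB ea eb subrr.
Qed.
Lemma kernel_ideal_proper : 1 \notin kernel_ideal /\
  forall a, {in kernel_ideal, forall u, a * u \in kernel_ideal}.
Proof.
split=> [|a b]; rewrite !unfold_in ?rmorph1 ?oner_eq0 // => /eqP e.
by rewrite rmorphM e mulr0.
Qed.
Lemma kernel_ideal_prime : prime_idealr_closed kernel_ideal.
Proof. by move=> a b; rewrite !unfold_in rmorphM mulf_eq0. Qed.

HB.instance Definition _ := GRing.isZmodClosed.Build R kernel_ideal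
  kernel_ideal_zmod_closed.
HB.instance Definition _ := isProperIdeal.Build R kernel_ideal kernel_ideal_proper.
HB.instance Definition _ := isPrimeIdealrClosed.Build R kernel_ideal
  kernel_ideal_prime.

(** The kernel of psi is a prime ideal, and as a point [x0] of the spectrum it is generic: a zero
    locus that contains [x0] contains the whole closed set. *)
Lemma kernel_irreducible (p : R) :
  (forall a, psi a = 0 <-> in_principal_ideal p a) ->
  irreducible_subset (zero_locus (in_principal_ideal p)).
Proof.
move=> kerE; pose x0 : prime_idealr R := kernel_ideal.
have x0P a : in_principal_ideal p a <-> a \in (x0 : {pred R}).
  by rewrite -kerE unfold_in; split => /eqP.
split; first by exists x0 => a /x0P.
move=> S T cover.
have sub V : zero_locus V x0 ->
    forall x, zero_locus (in_principal_ideal p) x -> zero_locus V x.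
  by move=> hV x hx a Va; apply: hx; apply/x0P; apply: hV.
have [/sub|/sub] := cover x0 (fun a => iffLR (x0P a)); first by left.
by right.
Qed.
End KernelIdeal.

Section DynatomicRoot.
Variables (k : fieldType) (d : nat) (U : seq k).
Hypotheses (d_gt1 : (1 < d)%N) (dU : d%:R \is a @GRing.unit k).
Hypotheses (U_uniq : uniq U) (U_size : size U = d) (U_root : forall a, a \in U -> a ^+ d = 1).
Local Notation Om := {fraction series k}.
Local Notation fr := (@tofrac (series k)).
Local Notation w := (fr (wvar k)).

Lemma iterate_monic_size n :
  iterate k d n \is monic /\ size (iterate k d n) = (d ^ n).+1.
Proof.
elim: n => [|n [mon sz]]; first by rewrite monicX size_polyX.
have -> : iterate k d n.+1 = iterate k d n ^+ d + ('X)%:P.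
  rewrite /iterate iterS -/(iterate k d n) /unicritical comp_polyD rmorphXn /=.
  by rewrite comp_polyX comp_polyC.
have sz' : size (iterate k d n ^+ d) = (d ^ n.+1).+1.
  by rewrite size_monic_exp // sz expnSr.
rewrite -[('X)%:P]opprK -sz'; apply: monic_size_subl; first by rewrite monic_exp.
rewrite -polyCN; apply: leq_ltn_trans (size_polyC_leq1 _) _.
by rewrite sz' ltnS expn_gt0 ltnW.
Qed.

Lemma cycle_monic_size n m : (m < n)%N ->
  iterate k d n - iterate k d m \is monic /\
  size (iterate k d n - iterate k d m) = (d ^ n).+1.
Proof.
move=> mn; have [mon sz] := iterate_monic_size n.
rewrite -sz; apply: monic_size_subl => //.
by rewrite sz (iterate_monic_size m).2 ltnS ltn_exp2l.
Qed.

Lemma polyC_unit (R : idomainType) (u : {poly R}) :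
  u \is a GRing.unit -> exists2 c, c \is a GRing.unit & u = c%:P.
Proof.
by rewrite poly_unitE => /andP [/eqP sz h]; exists u`_0; rewrite // -size1_polyC // sz.
Qed.

Lemma dynatomic_monic (p : {poly {poly k}}) : dynatomic d p ->
  exists (c : k) p0, [/\ c != 0, p0 \is monic & p = c%:P%:P * p0].
Proof.
move=> [_ [n [m [mn [r def_F]]]]].
have [mon _] := cycle_monic_size mn.
have lcU : lead_coef p \is a GRing.unit.
  apply/unitrPr; exists (lead_coef r).
  by apply/eqP; rewrite mulrC -lead_coefM -def_F -monicE.
have [c cU lc] := polyC_unit lcU.
have c0 : c != 0 by rewrite unitfE in cU.
exists c, (c^-1%:P%:P * p); split=> //.
  by rewrite monicE lead_coefM lead_coefC lc -polyCM mulVf.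
by rewrite mulrA -!polyCM divff // mul1r.
Qed.

(** Let f^n - f^m = r p. If p vanished at none of the d^n roots, all of them would be roots of r,
    and p would have degree 0 in z. As its leading coefficient divides 1, p would be a unit. *)
Lemma dynatomic_root (p : {poly {poly k}}) : dynatomic d p ->
  exists s, [/\ itinerary d s, exists n m, (m < n)%N /\ preperiodic n m s &
               phi d s p = 0].
Proof.
move=> [[_ p_nonunit _] [n [m [mn [r def_F]]]]].
pose fc : {rmorphism {poly k} -> Om} :=
  (horner_eval (cval k d) \o map_poly (const_Om k))%FUN.
have rootE s P : root (map_poly fc P) (zval d s) = (phi d s P == 0) by [].
have [mon szF] := cycle_monic_size mn.
have [un szr] := cycle_roots_uniq_size d_gt1 dU U_uniq U_size U_root mn.
pose zs := [seq fr v / w | v <- cycle_roots d U n m].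
have zs_uniq : uniq zs.
  rewrite map_inj_uniq // => u v /(mulIf (invr_neq0 (w_neq0 k))) /eqP.
  by rewrite tofrac_eq => /eqP.
have zsP z : z \in zs -> exists s,
    [/\ z = zval d s, itinerary d s & preperiodic n m s].
  by move=> /mapP [v /(cycle_rootsP d_gt1 dU U_uniq U_size U_root mn) [s [-> hs ps]] ->];
    exists s.
have [[z zin pz]|no_root] := pselect (exists2 z, z \in zs & root (map_poly fc p) z).
  have [s [def_z hs ps]] := zsP z zin.
  by exists s; split=> //; [exists n, m|apply/eqP; rewrite -rootE -def_z].
case/negP: p_nonunit.
have F_roots z : z \in zs -> root (map_poly fc r) z.
  move=> zin; have [s [def_z hs ps]] := zsP z zin.
  have : phi d s (iterate k d n - iterate k d m) = 0.
    rewrite rmorphB !phi_iterate //; apply/eqP; rewrite subr_eq0 !iter_shift.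
    by apply/eqP; congr zval; apply: funext.
  rewrite def_F (rmorphM (phi d s)) => /eqP; rewrite mulf_eq0 -!rootE -def_z.
  case/orP => [|pz]; first exact.
  by case: no_root; exists z.
have [r0|r0] := eqVneq (map_poly fc r) 0.
  have e : map_poly fc (r * p) = map_poly fc r * map_poly fc p by exact: rmorphM.
  by have := monic_map fc mon; rewrite def_F e r0 mul0r monicE lead_coef0 eq_sym oner_eq0.
have := max_poly_roots r0 (introT allP F_roots) zs_uniq.
rewrite size_map szr => /leq_trans /(_ (size_poly _ _)) szr'.
have Fn0 := monic_neq0 mon.
have pn0 : p != 0 by apply: contraNneq Fn0 => p0; rewrite def_F p0 mulr0.
have rn0 : r != 0 by apply: contraNneq Fn0 => r0'; rewrite def_F r0' mul0r.
have szp : size p = 1%N.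
  move: szF; rewrite def_F size_mul //.
  have : (0 < size p)%N by rewrite size_poly_gt0.
  by move: szr'; move: (size r) (size p) => x y; lia.
rewrite poly_unitE szp eqxx /=.
apply/unitrPr; exists (lead_coef r).
have -> : p`_0 = lead_coef p by rewrite lead_coefE szp.
by apply/eqP; rewrite mulrC -lead_coefM -def_F -monicE.
Qed.

(** The generator M of the kernel divides the irreducible p and is no unit, so M and p are
    associated. *)
Lemma phi_kernel s (p : {poly {poly k}}) : irreducible_elt p -> phi d s p = 0 ->
  forall a, phi d s a = 0 <-> in_principal_ideal p a.
Proof.
move=> [p0 pU irr] ps.
have [M kerM] := principal_kernel (phi_inj_coef d_gt1 (s := s)).
have [Q def_p] := (kerM p).1 ps.
have [QU|MU] := irr _ _ def_p.
  move=> a; rewrite kerM; split=> [[r ->]|[r ->]].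
    by exists (r * Q^-1); rewrite def_p -mulrA mulKr.
  by exists (r * Q); rewrite def_p mulrA.
have : phi d s M = 0 by apply/kerM; exists 1; rewrite mul1r.
by move/eqP; rewrite -[_ == 0]negbK -unitfE rmorph_unit.
Qed.
End DynatomicRoot.

(* w ^ (d I + J) c^i z^j as a power series, for i < I and j < J. *)
Definition mono_series (R : comUnitRingType) d I J (s : nat -> R) (i j : nat) : series R :=
  (-1) ^+ i * wvar R ^+ (d * (I - i) + (J - j)) * point_series d s ^+ j.

Lemma mono_series_map (R S : comUnitRingType) (f : {rmorphism R -> S}) d I J s i j :
  d%:R \is a @GRing.unit R ->
  series_map f (mono_series d I J s i j) = mono_series d I J (f \o s) i j.
Proof.
move=> dU; rewrite /mono_series !rmorphM !rmorphXn /= rmorphN1 series_map_w.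
by rewrite point_series_map.
Qed.

Lemma phi_mono_series (k : fieldType) d I J (s : nat -> k) (P : {poly {poly k}}) :
  (1 < d)%N -> (size P <= J)%N -> (forall j, (size (P`_j)%R <= I)%N) ->
  tofrac (wvar k) ^+ (d * I + J) * phi d s P =
  tofrac (\sum_(ij : 'I_I * 'I_J) cst P`_(ij.2)`_(ij.1) * mono_series d I J s ij.1 ij.2).
Proof.
move=> d_gt1 szJ szI; set w := tofrac _.
have w0 : w != 0 := w_neq0 k.
pose fc : {rmorphism {poly k} -> {fraction series k}} :=
  (horner_eval (cval k d) \o map_poly (const_Om k))%FUN.
have -> : phi d s P = (map_poly fc P).[zval d s] by [].
have fcE (q : {poly k}) : (size q <= I)%N -> fc q = \sum_(i < I) const_Om k q`_i * cval k d ^+ i.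
  move=> szq; rewrite -[LHS]/((map_poly (const_Om k) q).[cval k d]).
  rewrite (@horner_coef_wide _ I) ?(leq_trans (size_poly _ _)) //.
  by apply: eq_bigr => i _; rewrite coef_map.
rewrite (@horner_coef_wide _ J); last by rewrite (leq_trans (size_poly _ _)).
have cE j : (map_poly fc P)`_j = \sum_(i < I) const_Om k P`_j`_i * cval k d ^+ i.
  by rewrite coef_map; apply: fcE.
under eq_bigr => j _ do rewrite cE mulr_suml.
rewrite exchange_big pair_big /= mulr_sumr rmorph_sum; apply: eq_bigr => -[i j] _ /=.
rewrite /mono_series !rmorphM !rmorphXn /= -/w rmorphN1.
have -> : (d * I + J = (d * (I - i) + (J - j)) + (d * i + j))%N.
  rewrite addnACA -mulnDr !subnK // ltnW //; exact: ltn_ord.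
rewrite (exprD w (d * (I - i) + (J - j))) (exprD w (d * i)) /cval /zval exprNn exprVn.
rewrite -exprM expr_div_n -/w.
have : w ^+ (d * i) != 0 by rewrite expf_neq0.
have : w ^+ j != 0 by rewrite expf_neq0.
have key (F : fieldType) (x y z a b e : F) : z != 0 -> x != 0 ->
    y * (x * z) * (a * (e / x) * (b / z)) = a * (e * y * b).
  by move=> z0 x0; field; rewrite z0.
exact: key.
Qed.

Lemma coef_size_bound (R : nzRingType) (P : {poly {poly R}}) :
  exists I, forall j, (size (P`_j)%R <= I)%N.
Proof.
exists (\max_(j < size P) size (P`_j)%R) => j.
case: (ltnP j (size P)) => [lt|le]; last by rewrite nth_default // size_poly0.
exact: (leq_bigmax (F := fun i : 'I_(size P) => size (P`_i)%R) (Ordinal lt)).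
Qed.

Section BaseChange.
Variables (k L : fieldType) (f : {rmorphism k -> L}) (d : nat) (s : nat -> k).
Hypotheses (d_gt1 : (1 < d)%N) (dU : d%:R \is a @GRing.unit k).

Lemma phi_base_change_eq0 P :
  phi d s P = 0 -> phi d (f \o s) (map_poly (map_poly f) P) = 0.
Proof.
pose J := size P; have [I szI] := coef_size_bound P.
have e1 := @phi_mono_series k d I J s P d_gt1 (leqnn _) szI.
have szI2 j : (size ((map_poly (map_poly f) P)`_j)%R <= I)%N.
  by rewrite coef_map; apply: leq_trans (size_poly _ _) _.
have e2 := @phi_mono_series L d I J (f \o s) _ d_gt1 (size_poly _ _) szI2.
move=> eP; move: e1; rewrite eP mulr0 => /esym /eqP.
rewrite tofrac_eq0 => /eqP e0.
have w0 : tofrac (wvar L) ^+ (d * I + J) != 0 by rewrite expf_neq0 // w_neq0.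
apply: (mulfI w0); rewrite mulr0 e2.
set u := \sum_ij _ in e0; set v := \sum_ij _.
have -> : v = series_map f u; last by rewrite e0 !rmorph0.
rewrite rmorph_sum; apply: eq_bigr => ij _.
by rewrite rmorphM /= mono_series_map // series_map_cst !coef_map.
Qed.

(** Division by the monic p0 leaves a remainder of smaller degree in z, whose vanishing at the point
    is a relation over L between the series of the monomials of these degrees. They are independent
    over k, since the kernel over k contains no nonzero polynomial of such a degree, and so they are
    over L. *)
Lemma phi_base_change_kernel p0 : p0 \is monic ->
  (forall a, phi d s a = 0 <-> in_principal_ideal p0 a) ->
  forall a, phi d (f \o s) a = 0 <-> in_principal_ideal (base_change f p0) a.
Proof.
move=> mon kerE a; have p0s : phi d s p0 = 0 by apply/kerE; exists 1; rewrite mul1r.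
split=> [|[r ->]]; last by rewrite rmorphM phi_base_change_eq0 ?mulr0.
have monL : base_change f p0 \is monic by rewrite /base_change monic_map // monic_map.
have [q [r [def_a sz_r]]] := monic_division monL a.
rewrite def_a rmorphD rmorphM phi_base_change_eq0 // mulr0 add0r => er.
exists q; suff -> : r = 0 by rewrite addr0.
pose J := size r; have [I szI] := coef_size_bound r.
have ind : series_independent
    (fun ij : 'I_I * 'I_J => mono_series d I J s ij.1 ij.2).
  move=> b eb.
  pose P : {poly {poly k}} := \poly_(j < J) \poly_(i < I)
    (if insub i is Some i' then if insub j is Some j' then b (i', j') else 0 else 0).
  have coefP (ij : 'I_I * 'I_J) : P`_(ij.2)`_(ij.1) = b ij.
    by case: ij => i j; rewrite coef_poly ltn_ord coef_poly ltn_ord !valK.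
  have szPJ : (size P <= J)%N by apply: size_poly.
  have szPI j : (size (P`_j)%R <= I)%N.
    by rewrite coef_poly; case: ifP => _; rewrite ?size_poly0 // size_poly.
  have := phi_mono_series s d_gt1 szPJ szPI.
  under eq_bigr do rewrite coefP.
  rewrite eb rmorph0 => /eqP; rewrite mulf_eq0 expf_eq0 (negPf (w_neq0 k)) andbF /=.
  move=> /eqP /kerE [g def_P] ij.
  suff P0 : P = 0 by rewrite -coefP P0 !coef0.
  apply: contrapT => /eqP P0.
  have g0 : g != 0 by apply: contraNneq P0 => g0; rewrite def_P g0 mul0r.
  have : (size p0 <= size P)%N.
    have : (0 < size g)%N by rewrite size_poly_gt0.
    by rewrite def_P size_Mmonic //; case: (size g) => // x _; apply: leq_addl.
  rewrite leqNgt; move/negP; apply; apply: leq_ltn_trans szPJ _.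
  by move: sz_r; rewrite /base_change size_map_inj_poly ?rmorph0 //; apply: map_poly_inj.
have := phi_mono_series (f \o s) d_gt1 (leqnn _) szI.
rewrite er mulr0 => /esym /eqP; rewrite tofrac_eq0 => /eqP e0.
apply/polyP => j; apply/polyP => i; rewrite !coef0.
case: (ltnP j J) => [jJ|le]; last by rewrite [r`_j]nth_default // coef0.
case: (ltnP i I) => [iI|le]; last by rewrite nth_default // (leq_trans (szI j)).
have indL := @series_independent_map _ _ f _ _ ind.
apply: (indL (fun ij => r`_(ij.2)`_(ij.1)) _ (Ordinal iI, Ordinal jJ)).
rewrite -[RHS]e0; apply: eq_bigr => ij _.
by rewrite mono_series_map.
Qed.
End BaseChange.

Lemma dynatomic_geometrically_irreducible (k : fieldType) (d : nat) (U : seq k) :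
  (1 < d)%N -> d%:R \is a @GRing.unit k ->
  uniq U -> size U = d -> (forall a, a \in U -> a ^+ d = 1) ->
  forall p : {poly {poly k}}, dynatomic d p -> geometrically_irreducible p.
Proof.
move=> d_gt1 dU U_uniq U_size U_root p dp L f.
have [s [_ _ ps]] := dynatomic_root d_gt1 dU U_uniq U_size U_root dp.
have [c [p0 [c0 mon def_p]]] := dynatomic_monic d_gt1 dp.
have ideal_p (F : fieldType) (a : F) (q P : {poly {poly F}}) : a != 0 ->
    in_principal_ideal (a%:P%:P * q) P <-> in_principal_ideal q P.
  move=> a0; split=> [] [r ->]; first by exists (r * a%:P%:P); rewrite mulrA.
  by exists (r * a^-1%:P%:P); rewrite -mulrA (mulrA _ a%:P%:P) -!polyCM mulVf // mul1r.
apply: (@kernel_irreducible _ _ (phi d (f \o s))) => a.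
have -> : base_change f p = (f c)%:P%:P * base_change f p0.
  rewrite def_p /base_change (rmorphM (map_poly (map_poly f))); congr (_ * _).
  by rewrite [LHS]map_polyC /= map_polyC.
rewrite ideal_p ?fmorph_eq0 //; apply: phi_base_change_kernel => // b.
rewrite (phi_kernel d_gt1 dp.1 ps) def_p; exact: ideal_p.
Qed.

(** * Functions of low degree in positive characteristic *)

Section FrobeniusPower.
Variables (R : comNzRingType) (q : nat).

Definition frob (qP : [pchar R]%R.-nat q) (x : R) := x ^+ q.

Variable qP : [pchar R]%R.-nat q.
Lemma frob_is_zmod_morphism : zmod_morphism (frob qP).
Proof. by move=> x y; rewrite /frob exprDn_pchar // exprNn_pchar. Qed.
Lemma frob_is_monoid_morphism : monoid_morphism (frob qP).
Proof. by split=> [|x y]; rewrite /frob ?expr1n // exprMn. Qed.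
HB.instance Definition _ := GRing.isZmodMorphism.Build R R (frob qP) frob_is_zmod_morphism.
HB.instance Definition _ := GRing.isMonoidMorphism.Build R R (frob qP) frob_is_monoid_morphism.
End FrobeniusPower.

(** If t minus its constant coefficient had a finite order n > 0, its Frobenius twist would have
    order n as well, but its qth power would have order n q > n. *)
Lemma frob_fixed_series (R : idomainType) q (qP : [pchar R]%R.-nat q) (t : series R) :
  (1 < q)%N -> series_map (frob qP) t = t ^+ q -> t = cst (coefs t 0%N).
Proof.
move=> q1 e; apply/eqP; rewrite -subr_eq0; apply/negPn/negP => /series_neq0P.
have [a def_a] : exists a, a = coefs t 0%N by exists (coefs t 0%N).
rewrite -def_a => -[n [u [def_t u0]]].
have n0 : (0 < n)%N.
  rewrite lt0n; apply: contraNneq u0 => n0.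
  have := congr1 (fun v => coefs v 0%N) def_t.
  by rewrite n0 expr0 mul1r coefsB coefs_cst def_a subrr => <-.
have qS : [pchar series R]%R.-nat q.
  by apply: (sub_in_pnat _ qP) => p _; apply: (rmorph_pchar (@cst R)).
have {}def_t : t = cst a + wvar R ^+ n * u by rewrite -def_t addrC subrK.
have e1 : series_map (frob qP) t = cst (a ^+ q) + wvar R ^+ n * series_map (frob qP) u.
  by rewrite def_t rmorphD rmorphM rmorphXn /= series_map_cst series_map_w.
have e2 : t ^+ q = cst (a ^+ q) + wvar R ^+ (n * q) * u ^+ q.
  by rewrite def_t exprDn_pchar // exprMn -exprM rmorphXn.
move: e; rewrite e1 e2 => /addrI /(congr1 (fun v => coefs v n)).
rewrite !coefs_wXM ltnn subnn coefs_map ltn_Pmulr // => /eqP.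
by rewrite expf_eq0 (negPf u0) andbF.
Qed.

(** The constant coefficient a of t is a root of r. Either t = a, or t is a root of r / (X - a),
    which has smaller degree. *)
Lemma const_series_eq (k : fieldType) (r : {poly k}) (t : series k) : r != 0 ->
  (map_poly (@cst k) r).[t] = 0 -> t = cst (coefs t 0%N).
Proof.
have [n] := ubnP (size r); elim: n r => // n IH r szr r0 rt.
pose a := coefs t 0%N.
have : root r a.
  have := congr1 (@coefs_at0 k) rt; rewrite -horner_map /= -map_poly_comp rmorph0 => /eqP.
  by rewrite /root; congr ((_).[_] == _); rewrite map_poly_id // => x _ /=;
    rewrite /coefs_at0 coefs_cst.
move=> /factor_theorem [r' def_r].
have r'0 : r' != 0 by apply: contraNneq r0 => r'0; rewrite def_r r'0 mul0r.
move: rt; rewrite def_r rmorphM /= hornerM => /eqP; rewrite mulf_eq0 => /orP [/eqP|].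
  apply: IH (r'0); move: szr; rewrite def_r size_Mmonic ?monicXsubC //.
  by rewrite size_XsubC addn2.
rewrite (rmorphB (map_poly (@cst k))) /= map_polyX map_polyC hornerXsubC subr_eq0.
by move/eqP.
Qed.

(** * Polynomials in a function, and their transfer between points *)

Section Omega.
Variable k : fieldType.
Local Notation Om := {fraction series k}.
Local Notation fr := (@tofrac (series k)).

Definition peval (x : Om) : {rmorphism {poly k} -> Om} :=
  (horner_eval x \o map_poly (const_Om k))%FUN.

Lemma pevalE x r : peval x r = (map_poly (const_Om k) r).[x]. Proof. by []. Qed.
Lemma peval_coef x (r : {poly k}) : peval x r = \sum_(i < size r) const_Om k r`_i * x ^+ i.
Proof.
rewrite pevalE horner_coef size_map_poly; apply: eq_bigr => i _.
by rewrite coef_map.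
Qed.
Lemma peval_wide x (r : {poly k}) n : (size r <= n)%N ->
  peval x r = \sum_(i < n) const_Om k r`_i * x ^+ i.
Proof.
move=> sz; rewrite pevalE (@horner_coef_wide _ n) ?size_map_poly //.
by apply: eq_bigr => i _; rewrite coef_map.
Qed.
Lemma pevalX x : peval x 'X = x.
Proof. by rewrite pevalE map_polyX hornerX. Qed.
Lemma pevalC x a : peval x a%:P = const_Om k a.
Proof. by rewrite pevalE map_polyC hornerC. Qed.
Lemma peval_fr t r : peval (fr t) r = fr (map_poly (@cst k) r).[t].
Proof. by rewrite pevalE -horner_map -map_poly_comp. Qed.
Opaque peval.

Lemma tofrac_div (u v t : series k) : v != 0 -> u = t * v -> fr u / fr v = fr t.
Proof. by move=> v0 ->; rewrite (rmorphM fr) mulfK ?tofrac_eq0. Qed.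

Lemma Om_integral_or_inverse (u v : series k) : v != 0 ->
  (exists t, fr u / fr v = fr t /\ u = t * v) \/
  (exists t, [/\ fr v / fr u = fr (wvar k * t), v = wvar k * t * u & u != 0]).
Proof.
move=> v0; have [[t e]|[t e]] := series_valuation_ring u v0.
  by left; exists t; rewrite (tofrac_div v0 e).
have u0 : u != 0 by apply: contraNneq v0 => u0; rewrite e u0 mulr0.
by right; exists t; rewrite (tofrac_div u0 e).
Qed.

End Omega.
Opaque peval.
Arguments peval : simpl never.

Lemma fraction_num_den (R : idomainType) (x : {fraction R}) :
  exists u v, v != 0 /\ x = tofrac u / tofrac v.
Proof.
elim/quotW: x => x; exists \n_x, \d_x; split; first exact: denom_ratioP.
have d0 : tofrac \d_x != 0 :> {fraction R} by rewrite tofrac_eq0 denom_ratioP.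
apply: (mulIf d0); rewrite mulfVK //; unlock tofrac.
rewrite -[LHS]FracField.pi_mul; apply/eqmodP.
rewrite /= FracField.equivfE /FracField.mulf /=.
by rewrite !numden_Ratio ?oner_neq0 ?mulr1 // ?mulf_neq0 ?oner_neq0 ?denom_ratioP // mulrC.
Qed.

(** This is B^N r(A/B) without denominators, provided that N is at least the size of r. *)
Definition homog (R : comNzRingType) N (r : {poly R}) (A B : {poly {poly R}}) :=
  \sum_(t < N) (r`_t)%:P%:P * A ^+ t * B ^+ (N - t).

(* An identity of the form sum_i r_i(x) e_i = 0, where x = A/B, is carried from one
   evaluation to another one with a larger kernel by homogenizing the r_i. *)
Section Transfer.
Variable k : fieldType.
Implicit Types (A B : {poly {poly k}}) (r : {poly k}).

Definition lineval (F : fieldType) (E : {rmorphism {poly {poly k}} -> F}) (x : F) r : F :=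
  \sum_(t < size r) E (r`_t)%:P%:P * x ^+ t.

Lemma lineval_wide (F : fieldType) (E : {rmorphism {poly {poly k}} -> F}) x r N :
  (size r <= N)%N -> lineval E x r = \sum_(t < N) E (r`_t)%:P%:P * x ^+ t.
Proof.
move=> szr; rewrite /lineval -(subnKC szr) big_split_ord /= [X in _ = _ + X]big1 ?addr0 //.
by move=> i _; rewrite nth_default ?leq_addr // !rmorph0 mul0r.
Qed.

Lemma eval_homog (F : fieldType) (E : {rmorphism {poly {poly k}} -> F}) N r A B :
  E B != 0 -> (size r <= N)%N -> E (homog N r A B) = E B ^+ N * lineval E (E A / E B) r.
Proof.
move=> EB szr; rewrite (lineval_wide _ _ szr) /homog rmorph_sum mulr_sumr.
apply: eq_bigr => t _; rewrite !rmorphM !rmorphXn /= expr_div_n.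
have -> : E B ^+ N = E B ^+ (N - t) * E B ^+ t by rewrite -exprD subnK // ltnW.
have: E B ^+ t != 0 by rewrite expf_neq0.
by move: (E _) (E A ^+ t) (E B ^+ t) (E B ^+ _) => x y z u z0; field.
Qed.

Lemma transfer (F F' : fieldType) (E : {rmorphism {poly {poly k}} -> F})
    (E' : {rmorphism {poly {poly k}} -> F'}) (I : finType) A B
    (r : I -> {poly k}) (e : I -> {poly {poly k}}) :
  (forall P, E P = 0 -> E' P = 0) -> E B != 0 -> E' B != 0 ->
  \sum_i lineval E (E A / E B) (r i) * E (e i) = 0 ->
  \sum_i lineval E' (E' A / E' B) (r i) * E' (e i) = 0.
Proof.
move=> kerEE' EB E'B eq0; pose N := \max_i size (r i).
have szN i : (size (r i) <= N)%N by apply: leq_bigmax.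
have key (G : fieldType) (H : {rmorphism {poly {poly k}} -> G}) : H B != 0 ->
    H (\sum_i homog N (r i) A B * e i) =
    H B ^+ N * \sum_i lineval H (H A / H B) (r i) * H (e i).
  move=> HB; rewrite rmorph_sum mulr_sumr; apply: eq_bigr => i _.
  by rewrite rmorphM /= eval_homog // mulrA.
have /eqP : E' (\sum_i homog N (r i) A B * e i) = 0.
  by apply: kerEE'; rewrite key // eq0 mulr0.
by rewrite key // mulf_eq0 expf_eq0 (negPf E'B) andbF => /eqP.
Qed.

Lemma lineval_opp (F : fieldType) (E : {rmorphism {poly {poly k}} -> F}) x r :
  lineval E x (- r) = - lineval E x r.
Proof.
rewrite /lineval size_polyN -sumrN; apply: eq_bigr => t _.
by rewrite coefN !polyCN rmorphN mulNr.
Qed.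

Lemma transfer_eq (F F' : fieldType) (E : {rmorphism {poly {poly k}} -> F})
    (E' : {rmorphism {poly {poly k}} -> F'}) (I : finType) A B
    rho e0 (r : I -> {poly k}) (e : I -> {poly {poly k}}) :
  (forall P, E P = 0 -> E' P = 0) -> E B != 0 -> E' B != 0 ->
  lineval E (E A / E B) rho * E e0 = \sum_i lineval E (E A / E B) (r i) * E (e i) ->
  lineval E' (E' A / E' B) rho * E' e0 = \sum_i lineval E' (E' A / E' B) (r i) * E' (e i).
Proof.
move=> kerEE' EB E'B eq0.
pose r' (o : 'I_1 + I) := if o is inr i then - r i else rho.
pose e' (o : 'I_1 + I) := if o is inr i then e i else e0.
have sumE (G : fieldType) (H : {rmorphism {poly {poly k}} -> G}) z :
    \sum_o lineval H z (r' o) * H (e' o) =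
    lineval H z rho * H e0 - \sum_i lineval H z (r i) * H (e i).
  rewrite big_sumType big_ord1 -sumrN; congr (_ + _); apply: eq_bigr => i _.
  by rewrite lineval_opp mulNr.
have := @transfer _ _ E E' _ A B r' e' kerEE' EB E'B.
by rewrite !sumE eq0 subrr => /(_ erefl) /eqP; rewrite subr_eq0 => /eqP.
Qed.
End Transfer.

Lemma map2_polyC (R S : nzRingType) (f : {rmorphism R -> S}) a :
  map_poly (map_poly f) a%:P%:P = (f a)%:P%:P.
Proof. by rewrite [LHS]map_polyC /= map_polyC. Qed.

Lemma map2M (R S : nzRingType) (f : {rmorphism R -> S}) P Q :
  map_poly (map_poly f) (P * Q) = map_poly (map_poly f) P * map_poly (map_poly f) Q.
Proof. exact: (rmorphM (map_poly (map_poly f))). Qed.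

Lemma map2_mono (R S : nzRingType) (f : {rmorphism R -> S}) i j :
  map_poly (map_poly f) (('X^i)%:P * 'X^j) = ('X^i)%:P * 'X^j.
Proof.
rewrite (rmorphM (map_poly (map_poly f))) rmorphXn /= map_polyX map_polyC /=.
by rewrite rmorphXn /= map_polyX.
Qed.

Lemma poly2_monoE (R : comNzRingType) (P : {poly {poly R}}) :
  P = \sum_(j < size P) \sum_(i < size P`_j)
        (P`_j`_i)%:P%:P * (('X^i)%:P * 'X^j).
Proof.
have monoE (S : nzRingType) (p : {poly S}) : p = \sum_(i < size p) (p`_i)%:P * 'X^i.
  by rewrite -{1}[p]coefK poly_def; apply: eq_bigr => i _; rewrite mul_polyC.
rewrite {1}[P]monoE; apply: eq_bigr => j _.
rewrite {1}[P`_j]monoE (rmorph_sum (@polyC _)) mulr_suml; apply: eq_bigr => i _.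
by rewrite rmorphM /= mulrA.
Qed.

Lemma fraction_row (R : idomainType) (I : finType) (u : I -> {fraction R}) :
  exists p (c : I -> R), p != 0 /\ forall i, tofrac (c i) = tofrac p * u i.
Proof.
have /choice [f fP] i : exists ab : R * R, ab.2 != 0 /\ u i = tofrac ab.1 / tofrac ab.2.
  by have [a [b h]] := fraction_num_den (u i); exists (a, b).
pose p := \prod_i (f i).2; exists p.
have /choice [c cP] i : exists c, tofrac c = tofrac p * u i.
  have [bi0 ->] := fP i; exists ((\prod_(j | j != i) (f j).2) * (f i).1).
  have -> : p = (f i).2 * \prod_(j | j != i) (f j).2 by rewrite /p (bigD1 i).
  have key (F : fieldType) (x y z : F) : y != 0 -> x * z = y * x * (z / y).
    by move=> y0; field.
  rewrite (rmorphM (@tofrac R)) (rmorphM (@tofrac R)).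
  by apply: key; rewrite tofrac_eq0.
exists c; split=> //.
by apply/prodf_neq0 => i _; case: (fP i).
Qed.

Lemma domain_left_kernel (R : idomainType) n m (M : 'M[R]_(n, m)) : (m < n)%N ->
  exists c : 'rV[R]_n, c != 0 /\ c *m M = 0.
Proof.
move=> mn; pose MF := map_mx (@tofrac R) M.
have /rowV0Pn [u uker u0] : kermx MF != 0.
  rewrite -mxrank_eq0 mxrank_ker -lt0n subn_gt0.
  exact: leq_ltn_trans (rank_leq_col _) mn.
have [p [c [p0 cP]]] := fraction_row (fun i => u 0 i).
exists (\row_i c i); split.
  have [i ui] : exists i, u 0 i != 0.
    apply: contrapT => /forallNP h; move/eqP: u0; apply; apply/rowP => i.
    by rewrite mxE; apply/eqP/negPn/negP/h.
  apply/eqP => /rowP /(_ i); rewrite !mxE => ci0.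
  by have /eqP := cP i; rewrite ci0 rmorph0 eq_sym mulf_eq0 tofrac_eq0 (negPf p0) (negPf ui).
apply/rowP => j; rewrite !mxE; apply/eqP; rewrite -tofrac_eq0; apply/eqP.
move: uker; rewrite sub_kermx => /eqP /rowP /(_ j); rewrite !mxE => e.
rewrite -[RHS](mulr0 (tofrac p)) -e mulr_sumr rmorph_sum; apply: eq_bigr => i _.
by rewrite !mxE rmorphM /= cP mulrA.
Qed.

(** * Degree over k(x) in terms of linear dependence *)

Section Dependence.
Variable k : fieldType.
Local Notation Om := {fraction series k}.
Local Notation fr := (@tofrac (series k)).
Implicit Types (V : series k) (x : Om) (P : {poly {poly k}}) (r : {poly k}).

Definition evO V : {rmorphism {poly {poly k}} -> Om} := (fr \o ev V)%FUN.

Lemma evOE V P : evO V P = fr (ev V P). Proof. by []. Qed.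
Lemma evO_eq0 V P : (evO V P == 0) = (ev V P == 0). Proof. exact: tofrac_eq0. Qed.
Lemma evOc V a : evO V a%:P%:P = const_Om k a.
Proof. by rewrite evOE evC. Qed.
Opaque evO.
Arguments evO : simpl never.

Lemma lineval_evO V x r : lineval (evO V) x r = peval x r.
Proof. by rewrite peval_coef; apply: eq_bigr => i _; rewrite evOc. Qed.

(* [dep V x n]: any n + 1 elements of k[w, V] are linearly dependent over k[x], that
   is, the degree of k(w, V) over k(x) is at most n. *)
Definition dep V x n : Prop := forall e : 'I_n.+1 -> {poly {poly k}},
  exists r : 'I_n.+1 -> {poly k}, (exists i, r i != 0) /\
    \sum_i peval x (r i) * evO V (e i) = 0.

Definition nonconstant x : Prop := forall a, x != const_Om k a.

Lemma nonconstant_neq0 x : nonconstant x -> x != 0.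
Proof. by move=> /(_ 0); rewrite rmorph0. Qed.

Lemma nonconstant_inv x : nonconstant x -> nonconstant x^-1.
Proof.
move=> nc a; apply: contraNneq (nc a^-1) => e.
by rewrite -[x]invrK e fmorphV.
Qed.

Definition rev_poly N r : {poly k} := \poly_(i < N.+1) r`_(N - i).

Lemma peval_rev N r x : x != 0 -> (size r <= N.+1)%N ->
  peval x^-1 (rev_poly N r) = x ^- N * peval x r.
Proof.
move=> x0 szr; rewrite (peval_wide _ (size_poly _ _)) (peval_wide _ szr) mulr_sumr.
rewrite (reindex_inj rev_ord_inj) /=; apply: eq_bigr => i _.
have iN : (i <= N)%N by rewrite -ltnS ltn_ord.
rewrite coef_poly subSS ltnS leq_subr subKn // mulrCA; congr (_ * _).
rewrite exprVn; have -> : x ^+ N = x ^+ (N - i) * x ^+ i by rewrite -exprD subnK.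
by rewrite invfM mulfVK // expf_neq0.
Qed.

Lemma rev_poly_neq0 N r : r != 0 -> (size r <= N.+1)%N -> rev_poly N r != 0.
Proof.
move=> r0 szr; apply/eqP => e; move: r0; rewrite -lead_coef_eq0 lead_coefE.
have h : ((size r).-1 <= N)%N by move: szr; case: (size r).
have := congr1 (fun p : {poly k} => p`_(N - (size r).-1)) e.
by rewrite coef_poly ltnS leq_subr subKn // coef0 => ->; rewrite eqxx.
Qed.

(** One of x and 1/x is a power series. It is a root of r or of the reversed polynomial, and power
    series that are algebraic over k are constant. *)
Lemma nonconstant_transcendental x r : nonconstant x -> peval x r = 0 -> r = 0.
Proof.
move=> nc e; apply: contrapT => /eqP r0.
have [u [v [v0 def_x]]] := fraction_num_den x.
have [[t [ext _]]|[t [ext _ _]]] := Om_integral_or_inverse u v0.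
  move: e; rewrite def_x ext peval_fr => /eqP; rewrite tofrac_eq0 => /eqP.
  move/(const_series_eq r0) => def_t; have := nc (coefs t 0%N).
  by rewrite def_x ext {1}def_t eqxx.
have x0 := nonconstant_neq0 nc.
have exV : x^-1 = fr (wvar k * t) by rewrite def_x invf_div ext.
have szr : (size r <= (size r).-1.+1)%N by rewrite leqSpred.
have := peval_rev x0 szr; rewrite e mulr0 exV peval_fr => /eqP.
rewrite tofrac_eq0 => /eqP /(const_series_eq (rev_poly_neq0 r0 szr)) def_t.
by have := nonconstant_inv nc (coefs (wvar k * t) 0%N); rewrite exV {1}def_t eqxx.
Qed.

Lemma dep_sub V x n a : dep V x n -> dep V (x - const_Om k a) n.
Proof.
move=> dx e; have [r [[i ri] eq0]] := dx e.
pose r' i := r i \Po ('X + a%:P); exists r'; split.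
  by exists i; rewrite comp_poly2_eq0 // size_XaddC.
rewrite -[RHS]eq0; apply: eq_bigr => j _; congr (_ * _).
rewrite /r' !pevalE map_comp_poly horner_comp; congr (_.[_]).
by rewrite rmorphD /= map_polyX map_polyC hornerD hornerX hornerC subrK.
Qed.

Lemma dep_inv V x n : x != 0 -> dep V x n -> dep V x^-1 n.
Proof.
move=> x0 dx e; have [r [[i ri] eq0]] := dx e.
pose N := \max_i size (r i).
have szN j : (size (r j) <= N.+1)%N by apply/leqW/leq_bigmax.
exists (fun i => rev_poly N (r i)); split; first by exists i; apply: rev_poly_neq0.
apply: (etrans _ (etrans (congr1 (fun y => x ^- N * y) eq0) (mulr0 _))).
rewrite mulr_sumr; apply: eq_bigr => j _.
by rewrite peval_rev // mulrA.
Qed.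

(** For nonconstant x: y lies in the k(x)-span of b, written with a common denominator. *)
Definition spans V x m (b : 'I_m -> Om) (y : Om) : Prop :=
  exists rho (r : 'I_m -> {poly k}), rho != 0 /\
    peval x rho * y = \sum_i peval x (r i) * b i.

(** Choose m such that some family of m elements is independent and none of m + 1 elements is.
    Adding e to the family yields a relation in which the coefficient of e is nonzero. *)
Lemma dep_spans V x n : dep V x n ->
  exists m (b : 'I_m -> {poly {poly k}}), (m <= n)%N /\
    forall e, spans V x (fun i => evO V (b i)) (evO V e).
Proof.
move=> dx.
pose indep m := exists b : 'I_m -> {poly {poly k}}, forall r : 'I_m -> {poly k},
  \sum_i peval x (r i) * evO V (b i) = 0 -> forall i, r i = 0.
have indep0 : indep 0%N by exists (fun=> 0) => r _ [].
have nindep : ~ indep n.+1.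
  by move=> [b ib]; have [r [[i ri] /ib /(_ i) e]] := dx b; rewrite e eqxx in ri.
have [m [mn [b ib] nm]] : exists m, [/\ (m <= n)%N, indep m & ~ indep m.+1].
  elim: {dx} n nindep => [|n IH] nindep; first by exists 0%N.
  have [h|/IH [m [mn im nim]]] := pselect (indep n.+1); first by exists n.+1.
  by exists m; split=> //; apply: leqW.
exists m, b; split=> // e.
pose b' i := if unlift ord_max i is Some i' then b i' else e.
have : ~ forall r : 'I_m.+1 -> {poly k},
    \sum_i peval x (r i) * evO V (b' i) = 0 -> forall i, r i = 0.
  by move=> h; apply: nm; exists b'.
move=> /existsNP [r /not_implyP [eq0 nr0]].
have sumE : peval x (r ord_max) * evO V e =
    - \sum_i peval x (r (lift ord_max i)) * evO V (b i).
  apply/eqP; rewrite -addr_eq0 -[X in _ == X]eq0 (bigD1_ord ord_max) //= /b' unlift_none.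
  by apply/eqP; congr (_ + _); apply: eq_bigr => i _; rewrite liftK.
exists (r ord_max), (fun i => - r (lift ord_max i)); split; last first.
  by rewrite sumE -sumrN; apply: eq_bigr => i _; rewrite rmorphN mulNr.
apply/eqP => rm0; apply: nr0 => i.
have rl0 := ib (fun i => r (lift ord_max i)).
move: sumE; rewrite rm0 rmorph0 mul0r => /eqP; rewrite eq_sym oppr_eq0 => /eqP /rl0 h.
by case: (unliftP ord_max i) => [i' ->|->].
Qed.

Lemma spans_dep V x n m (b : 'I_m -> Om) : (m <= n)%N ->
  (forall e, spans V x b (evO V e)) -> dep V x n.
Proof.
move=> mn sp e.
have /choice [f fP] i : exists rr : {poly k} * ('I_m -> {poly k}), rr.1 != 0 /\
    peval x rr.1 * evO V (e i) = \sum_j peval x (rr.2 j) * b j.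
  by have [rho [r h]] := sp (e i); exists (rho, r).
pose M : 'M[{poly k}]_(n.+1, m) := \matrix_(i, j) (f i).2 j.
have [c [c0 cM]] := domain_left_kernel M mn.
exists (fun i => c 0 i * (f i).1); split.
  have [i ci] : exists i, c 0 i != 0.
    apply: contrapT => /forallNP h; move/eqP: c0; apply; apply/rowP => i.
    by rewrite mxE; apply/eqP/negPn/negP/h.
  by exists i; rewrite mulf_neq0 //; case: (fP i).
under eq_bigr => i _ do rewrite rmorphM -mulrA (fP i).2 mulr_sumr.
rewrite exchange_big big1 //= => j _.
have := congr1 (fun N : 'rV_m => peval x (N 0 j)) cM; rewrite !mxE rmorph0 rmorph_sum => e0.
apply: (etrans _ (etrans (congr1 (fun y => y * b j) e0) (mul0r _))).
rewrite mulr_suml; apply: eq_bigr => i _.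
by rewrite mxE rmorphM mulrA.
Qed.

Lemma spans_add V x m (b : 'I_m -> Om) y z :
  spans V x b y -> spans V x b z -> spans V x b (y + z).
Proof.
move=> [rho [r [rho0 ey]]] [rho' [r' [rho'0 ez]]].
exists (rho * rho'), (fun i => rho' * r i + rho * r' i); split; first by rewrite mulf_neq0.
transitivity (peval x rho' * (peval x rho * y) + peval x rho * (peval x rho' * z)).
  by rewrite rmorphM; ring.
rewrite ey ez !mulr_sumr -big_split; apply: eq_bigr => i _.
by rewrite rmorphD !rmorphM mulrDl !mulrA.
Qed.

Lemma spans_scale V x m (b : 'I_m -> Om) a y :
  spans V x b y -> spans V x b (const_Om k a * y).
Proof.
move=> [rho [r [rho0 ey]]]; exists rho, (fun i => a%:P * r i); split=> //.
rewrite mulrCA ey mulr_sumr; apply: eq_bigr => i _.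
by rewrite rmorphM pevalC mulrA.
Qed.

Lemma spans0 V x m (b : 'I_m -> Om) : spans V x b 0.
Proof.
exists 1, (fun=> 0); rewrite oner_neq0 mulr0; split=> //.
by rewrite big1 // => i _; rewrite rmorph0 mul0r.
Qed.
End Dependence.
Opaque evO.
Arguments evO : simpl never.

(** * The Frobenius twist of a function *)

Section Frobenius.
Variables (k : fieldType) (q : nat).
Hypotheses (qP : [pchar k]%R.-nat q) (q_gt1 : (1 < q)%N).
Local Notation Om := {fraction series k}.
Local Notation fr := (@tofrac (series k)).
Local Notation sigma := (frob qP).
Local Notation sigmaP := (map_poly (map_poly sigma)).

Variables (V : series k) (A B : {poly {poly k}}) (n : nat).
Hypotheses (V_sigma : series_map sigma V = V) (B_neq0 : evO V B != 0).
Local Notation x := (evO V A / evO V B).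
Local Notation y := (evO V (sigmaP A) / evO V (sigmaP B)).
Hypotheses (x_nc : nonconstant x) (x_dep : dep V x n).

Lemma ev_sigma (W : series k) P : series_map sigma W = W ->
  ev W (sigmaP P) = series_map sigma (ev W P).
Proof. by move=> e; rewrite ev_map e. Qed.

Lemma series_map_sigma_eq0 u : (series_map sigma u == 0) = (u == 0).
Proof.
apply/eqP/eqP => [e|->]; last exact: rmorph0.
by apply: (series_map_inj (@fmorph_inj _ _ sigma)); rewrite e rmorph0.
Qed.

Lemma sigma_B_neq0 : evO V (sigmaP B) != 0.
Proof. by rewrite evO_eq0 ev_sigma // series_map_sigma_eq0 -evO_eq0. Qed.

Definition evOs : {rmorphism {poly {poly k}} -> Om} := (evO V \o sigmaP)%FUN.

Lemma evOsE P : evOs P = evO V (sigmaP P). Proof. by []. Qed.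

Lemma lineval_evOs (z : Om) r : lineval evOs z r = peval z (map_poly sigma r).
Proof.
rewrite (peval_wide _ (size_poly _ _)); apply: eq_bigr => i _.
by rewrite evOsE map2_polyC evOc coef_map.
Qed.

Lemma ev_kernel_sigma P : evO V P = 0 -> evOs P = 0.
Proof.
move/eqP; rewrite evO_eq0 => /eqP e; apply/eqP.
by rewrite evOsE evO_eq0 ev_sigma // e rmorph0.
Qed.

(** As k need not be perfect, sigma need not map k[w, V] onto itself, so relations cannot be
    transported for an arbitrary family. Instead a spanning family is twisted: sigma fixes the
    monomials in w and V, so the twisted family spans them over k(y), and hence all their
    combinations. *)
Lemma dep_sigma : dep V y n.
Proof.
have [m [b [mn sp]]] := dep_spans x_dep.
apply: (spans_dep (b := fun i => evO V (sigmaP (b i))) mn) => e.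
rewrite [e]poly2_monoE rmorph_sum.
elim/big_ind: _ => [||j _]; [exact: spans0 | exact: spans_add|].
rewrite rmorph_sum.
elim/big_ind: _ => [||i _]; [exact: spans0 | exact: spans_add|].
rewrite rmorphM evOc; apply: spans_scale.
have [rho [r [rho0 eq]]] := sp (('X^i)%:P * 'X^j).
exists (map_poly sigma rho), (fun i => map_poly sigma (r i)).
split; first by rewrite map_poly_eq0.
have := @transfer_eq _ _ _ (evO V) evOs _ A B rho (('X^i)%:P * 'X^j) r b
  ev_kernel_sigma B_neq0 sigma_B_neq0.
rewrite lineval_evO (eq_bigr (fun i => peval x (r i) * evO V (b i))); last first.
  by move=> l _; rewrite lineval_evO.
move=> /(_ eq); rewrite lineval_evOs !evOsE map2_mono => ->.
by apply: eq_bigr => l _; rewrite lineval_evOs.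
Qed.

(** One of x and 1/x is a power series t. If sigma x = x^q, then sigma t = t^q, and t is
    constant. *)
Lemma sigma_neq_expn : y != x ^+ q.
Proof.
apply/eqP => e.
have B0 : ev V B != 0 by rewrite -evO_eq0.
have sB0 : ev V (sigmaP B) != 0 by rewrite -evO_eq0 sigma_B_neq0.
have {}e : series_map sigma (ev V A) * ev V B ^+ q = ev V A ^+ q * series_map sigma (ev V B).
  have key (F : fieldType) (a b a' b' : F) : b != 0 -> b' != 0 ->
      a' / b' = a / b -> a' * b = a * b'.
    by move=> b0 b'0 /eqP; rewrite eqr_div // => /eqP.
  apply/eqP; rewrite -tofrac_eq; apply/eqP.
  rewrite !(rmorphM (@tofrac _)) /= -!ev_sigma //.
  apply: key; rewrite ?tofrac_eq0 ?expf_neq0 //.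
  by move: e; rewrite !evOE expr_div_n !(rmorphXn (@tofrac _)).
have cancel (a b c u v : series k) : c != 0 -> u * c = a -> v * c = b -> a = b -> u = v.
  by move=> c0 <- <- /(mulIf c0).
have [[t [ext def_A]]|[t [ext def_B A0]]] := Om_integral_or_inverse (ev V A) B0.
  have : series_map sigma t = t ^+ q.
    apply: (cancel _ _ (series_map sigma (ev V B) * ev V B ^+ q) _ _ _ _ _ e).
    - by rewrite mulf_neq0 ?series_map_sigma_eq0 // expf_neq0.
    - by rewrite def_A rmorphM; ring.
    by rewrite def_A exprMn; ring.
  move/(frob_fixed_series q_gt1) => def_t.
  by have := x_nc (coefs t 0%N); rewrite !evOE ext {1}def_t eqxx.
have : series_map sigma (wvar k * t) = (wvar k * t) ^+ q.
  apply: (cancel _ _ (series_map sigma (ev V A) * ev V A ^+ q) _ _ _ _ _ (esym e)).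
  - by rewrite mulf_neq0 ?series_map_sigma_eq0 // expf_neq0.
  - by rewrite def_B rmorphM; ring.
  by rewrite def_B !exprMn; ring.
move/(frob_fixed_series q_gt1) => def_t.
have := nonconstant_inv x_nc (coefs (wvar k * t) 0%N).
by rewrite invf_div !evOE ext {1}def_t eqxx.
Qed.
End Frobenius.

Lemma eval_mono_homog (k : fieldType) (F : fieldType) (E : {rmorphism {poly {poly k}} ->
  F}) A B n i :
  E B != 0 -> (i <= n)%N -> E (A ^+ i * B ^+ (n - i)) = E B ^+ n * (E A / E B) ^+ i.
Proof.
move=> EB le; rewrite rmorphM !rmorphXn expr_div_n.
have -> : E B ^+ n = E B ^+ (n - i) * E B ^+ i by rewrite -exprD subnK.
have: E B ^+ i != 0 by rewrite expf_neq0.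
by move: (E A ^+ i) (E B ^+ i) (E B ^+ _) => a b c b0; field.
Qed.

Section Bidegree.
Variables (k : fieldType) (x y : {fraction series k}).
Notation psi := (eval2 (const_Om k) x y).

Lemma eval2_sum (P : {poly {poly k}}) n : (size P <= n)%N -> psi P = \sum_(j < n) peval x
  P`_j * y ^+ j.
Proof.
move=> szP; have -> : psi P = (map_poly (peval x) P).[y] by [].
rewrite (@horner_coef_wide _ n); last exact: leq_trans (size_poly _ _) szP.
by apply: eq_bigr => j _; rewrite coef_map.
Qed.

Lemma eval2_swapXY (P : {poly {poly k}}) : psi (swapXY P) = eval2 (const_Om k) y x P.
Proof.
apply: (@poly2_morph_eq _ _ (psi \o swapXY)%FUN) => [a||].
- by rewrite -[LHS]/(psi (swapXY a%:P%:P)) swapXY_polyC map_polyC !eval2c.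
- by rewrite -[LHS]/(psi (swapXY ('X)%:P)) swapXY_Y eval2Z eval2C.
by rewrite -[LHS]/(psi (swapXY 'X)) swapXY_X eval2Z eval2C.
Qed.
End Bidegree.

Section FrobeniusCount.
Variables (k : fieldType) (q : nat).
Hypotheses (qP : [pchar k]%R.-nat q) (q_gt1 : (1 < q)%N).
Local Notation Om := {fraction series k}.
Local Notation fr := (@tofrac (series k)).
Local Notation sigma := (frob qP).
Local Notation sigmaP := (map_poly (map_poly sigma)).

Variables (V : series k) (A B : {poly {poly k}}) (n : nat).
Hypotheses (V_sigma : series_map sigma V = V) (B_neq0 : evO V B != 0).
Local Notation x := (evO V A / evO V B).
Local Notation y := (evO V (sigmaP A) / evO V (sigmaP B)).
Hypotheses (x_nc : nonconstant x) (x_dep : dep V x n).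

(** The powers of y are dependent over k[x] and those of x over k[y], which gives one relation of
    degree at most n in each variable. The ideal of all relations has a generator R, which divides
    both and inherits both bounds. If R(X, X^q) = 0, then Y - X^q divides R; since y is not x^q, the
    quotient is again a relation, hence a multiple of R, which is impossible. *)
Lemma bidegree_relation : exists R : {poly {poly k}},
  [/\ (size R <= n.+1)%N, (sizeY R <= n.+1)%N, eval2 (const_Om k) x y R = 0 &
      R.['X^q] != 0].
Proof.
set psi := eval2 _ _ _.
have sB0 : evO V (sigmaP B) != 0 by apply: sigma_B_neq0.
have psi_inj (p : {poly k}) : psi p%:P = 0 -> p = 0.
  by rewrite eval2P -pevalE; apply: nonconstant_transcendental.
have [R kerR] := principal_kernel psi_inj.
(* Dependence is available for elements of k[w, V] only, so the powers t^i with i <= n are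
   multiplied by the common denominator B0^n. *)
have relation (z t : Om) A0 B0 : evO V B0 != 0 -> t = evO V A0 / evO V B0 -> dep V z n ->
    exists P : {poly {poly k}}, [/\ P != 0, (size P <= n.+1)%N & eval2 (const_Om k) z t P = 0].
  move=> B00 -> dz; have [r [[i ri] e]] := dz (fun i => A0 ^+ i * B0 ^+ (n - i)).
  pose r' j := if insub j is Some i then r i else 0.
  have r'E (j : 'I_n.+1) : r' j = r j by rewrite /r' valK.
  exists (\poly_(j < n.+1) r' j); split; last 1 first.
  - have B0n : evO V B0 ^+ n != 0 by rewrite expf_neq0.
    apply: (mulfI B0n); rewrite mulr0; apply: etrans e.
    rewrite (eval2_sum _ _ (size_poly _ _)) mulr_sumr.
    apply: eq_bigr => j _; rewrite coef_poly ltn_ord r'E (eval_mono_homog _ B00 (leq_ord j)).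
    exact: mulrCA.
  - apply/eqP => /(congr1 (fun P : {poly {poly k}} => P`_i)).
    by rewrite coef_poly ltn_ord r'E coef0; apply/eqP.
  exact: size_poly.
have [P1 [P10 szP1 /kerR [Q1 def_P1]]] :=
  relation _ _ (sigmaP A) (sigmaP B) sB0 erefl x_dep.
have [P2' [P20 szP2 e2]] :=
  relation y x A B B_neq0 erefl (dep_sigma V_sigma B_neq0 x_dep).
have /kerR [Q2 def_P2] : psi (swapXY P2') = 0 by rewrite eval2_swapXY.
have R0 : R != 0 by apply: contraNneq P10 => R0; rewrite def_P1 R0 mulr0.
have le_size (S : idomainType) (P Q M : {poly S}) : P != 0 -> P = Q * M -> (size M <= size P)%N.
  move=> P0 e; have Q0 : Q != 0 by apply: contraNneq P0 => Q0; rewrite e Q0 mul0r.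
  have M0 : M != 0 by apply: contraNneq P0 => M0; rewrite e M0 mulr0.
  rewrite e size_mul //; have : (0 < size Q)%N by rewrite size_poly_gt0.
  by case: (size Q) => // m _; rewrite addSn /= leq_addl.
exists R; split.
- exact: leq_trans (le_size _ _ _ _ P10 def_P1) szP1.
- rewrite sizeYE; apply: leq_trans szP2; apply: (le_size _ _ (swapXY Q2)) => //.
  by rewrite -[P2']swapXYK def_P2 rmorphM.
- by apply/kerR; exists 1; rewrite mul1r.
apply/negP => /factor_theorem [T def_R].
have : psi T = 0.
  have : psi R = 0 by apply/kerR; exists 1; rewrite mul1r.
  rewrite {1}def_R rmorphM => /eqP; rewrite mulf_eq0 => /orP [/eqP //|].
  rewrite rmorphB eval2Z eval2P map_polyXn hornerXn subr_eq0.
  by rewrite (negPf (sigma_neq_expn q_gt1 V_sigma B_neq0 x_nc)).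
move=> /kerR [S def_T].
have : R * (S * ('X - ('X^q)%:P)) = R * 1 by rewrite mulr1 {2}def_R def_T; ring.
move/(mulfI R0)/(congr1 (fun P : {poly {poly k}} => P.['X^q])).
by rewrite hornerM hornerXsubC subrr mulr0 hornerC => /eqP; rewrite eq_sym oner_eq0.
Qed.

(* Here t_0 is the value of x at the place defined by W. *)
Lemma value_root (R : {poly {poly k}}) (W t : series k) : (size R <= n.+1)%N ->
  eval2 (const_Om k) x y R = 0 -> series_map sigma W = W ->
  (forall P, evO V P = 0 -> evO W P = 0) -> evO W B != 0 ->
  ev W A = t * ev W B -> root R.['X^q] (coefs t 0%N).
Proof.
move=> szR e0 W_sigma kerVW WB0 def_A.
have sB0 : evO V (sigmaP B) != 0 by apply: sigma_B_neq0.
have sWB0 : evO W (sigmaP B) != 0 by apply: sigma_B_neq0.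
have := @transfer _ _ _ (evO V) (evO W) 'I_n.+1 A B (fun j => R`_j)
  (fun j => sigmaP A ^+ j * sigmaP B ^+ (n - j)) kerVW B_neq0 WB0.
have WB0' : ev W B != 0 by rewrite -evO_eq0.
have -> : evO W A / evO W B = fr t by rewrite !evOE (tofrac_div WB0' def_A).
have -> : \sum_(j < n.+1) lineval (evO V) x R`_j * evO V (sigmaP A ^+ j * sigmaP B ^+ (n -
  j)) = 0.
  apply: (etrans _ (mulr0 (evO V (sigmaP B) ^+ n))).
  apply: (etrans _ (congr1 (fun z => evO V (sigmaP B) ^+ n * z) e0)).
  rewrite (eval2_sum _ _ szR) mulr_sumr.
  apply: eq_bigr => j _; rewrite (eval_mono_homog _ sB0 (leq_ord j)) lineval_evO.
  exact: mulrCA.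
move=> /(_ erefl) e.
have : \sum_(j < n.+1) (map_poly (@cst k) R`_j).[t] * series_map sigma t ^+ j = 0.
  apply/eqP; rewrite -tofrac_eq0; apply/eqP.
  have Bn0 : evO W (sigmaP B) ^+ n != 0 by rewrite expf_neq0.
  apply: (mulfI Bn0); rewrite mulr0; apply: etrans e; rewrite rmorph_sum mulr_sumr.
  apply: eq_bigr => j _; rewrite (eval_mono_homog _ sWB0 (leq_ord j)) lineval_evO peval_fr.
  rewrite mulrCA rmorphM rmorphXn; congr (_ * (_ * _ ^+ _)).
  rewrite !evOE !ev_sigma //; apply/esym/tofrac_div; first by rewrite series_map_sigma_eq0.
  by rewrite def_A rmorphM.
move/(congr1 (@coefs_at0 k)); rewrite rmorph_sum rmorph0 => e1.
apply/eqP; apply: etrans e1; rewrite (horner_coef_wide _ szR) horner_sum.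
apply: eq_bigr => j _; rewrite rmorphM rmorphXn hornerM !horner_exp hornerX.
congr (_ * _ ^+ _).
rewrite -[RHS]/(coefs_at0 _) -horner_map -map_poly_comp; congr (_.[_]).
by rewrite map_poly_id // => a _ /=; rewrite /coefs_at0 coefs_cst.
Qed.
End FrobeniusCount.

(** The factor of [e i] that belongs to j' has the value w^N (v_(shift^l s) - c_j'(l)) at the point
    of s, where l is an index at which c_i and c_j' differ. Its reduced constant coefficient is thus
    zero at c_j' and nonzero at c_i. The exponent N is made common to all factors, so that the same
    power of w splits off everywhere. *)
Lemma separating_polys (k : fieldType) (d m : nat) (c : 'I_m -> nat -> k) :
  (1 < d)%N -> d%:R \is a @GRing.unit k -> (forall i, itinerary d (c i)) ->
  (forall i j, c i =1 c j -> i = j) ->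
  exists (e : 'I_m -> {poly {poly k}}) (E : nat) (u : 'I_m -> 'I_m -> series k),
    forall i j, ev (point_series d (c j)) (e i) = wvar k ^+ E * u i j /\
      (coefs (u i j) 0%N == 0) = (i != j).
Proof.
move=> d_gt1 dU c_it c_inj.
have /choice [l lP] (ij : 'I_m * 'I_m) : exists l, ij.1 != ij.2 -> c ij.1 l != c ij.2 l.
  case: ij => i j; have [->|ne] := eqVneq i j; first by exists 0%N => /=; rewrite eqxx.
  apply: contrapT => /forallNP h; move/eqP: ne; apply; apply: c_inj => l.
  by apply/eqP/negPn/negP => ne; apply: (h l).
pose N := \max_ij d ^ l ij.
have leN ij : ((d ^ l ij).-1 <= N)%N by apply: leq_trans (leq_pred _) (leq_bigmax _).
pose factor i j : {poly {poly k}} :=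
  ('X^(N - (d ^ l (i, j)).-1))%:P * gpoly k d (l (i, j)) -
  ('X^N)%:P * (c j (l (i, j)))%:P%:P.
pose v i j (s : nat -> k) := point_series d (iter (l (i, j)) (@shift k) s) - cst (c j (l (i, j))).
have ev_factor s i j : itinerary d s ->
    ev (point_series d s) (factor i j) = wvar k ^+ N * v i j s.
  move=> hs; rewrite rmorphB !rmorphM !evC ev_gpoly // !rmorphXn mulrA -exprD.
  by rewrite subnK // /v mulrBr.
exists (fun i => \prod_(j | j != i) factor i j), (N * m.-1)%N.
exists (fun i j => \prod_(j' | j' != i) v i j' (c j)) => i j; split.
  rewrite rmorph_prod; under eq_bigr => j' _ do rewrite ev_factor //.
  rewrite big_split /= prodr_const cardC1 card_ord -exprM //.
rewrite -/(coefs_at0 _) rmorph_prod /=.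
have v0 j' : coefs_at0 (v i j' (c j)) = c j (l (i, j')) - c j' (l (i, j')).
  rewrite /v rmorphB /= /coefs_at0 coefs_cst point_series0 //; last exact: itinerary_iter.
  by rewrite iter_shift.
under eq_bigr => j' _ do rewrite v0.
have [<-|ne] := eqVneq i j.
  apply/negbTE/prodf_neq0 => j' ne; rewrite subr_eq0.
  by apply: (lP (i, j')); rewrite eq_sym.
by rewrite (bigD1 j) ?(eq_sym j) //= subrr mul0r eqxx.
Qed.

Section Fibre.
Variables (k : fieldType) (d : nat).
Hypotheses (d_gt1 : (1 < d)%N) (dU : d%:R \is a @GRing.unit k).
Variables (V : series k) (n : nat).

(** A function has no more zeros than its degree. If x vanished at n + 1 places, take a relation
    over k[x] between polynomials that separate them, of least total size. Some coefficient r_j then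
    has a nonzero constant term, for otherwise the relation could be divided by x. At the place c_j,
    where x vanishes, the lowest coefficient of the relation is r_j(0) times a nonzero constant. *)
Lemma fibre_bound A B (c : 'I_n.+1 -> nat -> k) (t : 'I_n.+1 -> series k) :
  evO V A != 0 -> evO V B != 0 -> dep V (evO V A / evO V B) n ->
  (forall i, itinerary d (c i)) -> (forall i j, c i =1 c j -> i = j) ->
  (forall i P, evO V P = 0 -> evO (point_series d (c i)) P = 0) ->
  (forall i, evO (point_series d (c i)) B != 0) ->
  (forall i, ev (point_series d (c i)) A = t i * ev (point_series d (c i)) B) ->
  (forall i, coefs (t i) 0%N = 0) -> False.
Proof.
move=> A0 B0 dx c_it c_inj kerV WB0 def_A t0.
set x := _ / _ in dx; have x0 : x != 0 by apply: mulf_neq0 A0 (invr_neq0 B0).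
have [e [E [u uP]]] := separating_polys d_gt1 dU c_it c_inj.
have [|r [[[i ri] eq0] min_r]] := @ex_minimal _
    (fun r : 'I_n.+1 -> {poly k} => (exists i, r i != 0) /\
       \sum_i peval x (r i) * evO V (e i) = 0) (fun r => \sum_i size (r i))%N.
  exact: dx.
have [j rj] : exists j, (r j).[0] != 0.
  apply: contrapT => /forallNP h.
  have /choice [r' r'P] j : exists r', r j = r' * 'X.
    have : root (r j) 0 by apply/negPn/negP; apply: h.
    by move=> /factor_theorem [r']; rewrite subr0; exists r'.
  have r'i : r' i != 0 by apply: contraNneq ri => r'i; rewrite r'P r'i mul0r.
  have : (\sum_i size (r i) <= \sum_i size (r' i))%N.
    apply: min_r; split; first by exists i.
    apply: (mulIf x0); rewrite mul0r; apply: etrans eq0; rewrite mulr_suml.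
    by apply: eq_bigr => l _; rewrite r'P rmorphM pevalX mulrAC.
  rewrite leqNgt => /negP; apply.
  rewrite (bigD1 i) //= [X in (_ < X)%N](bigD1 i) //= -addSn leq_add //.
    by rewrite r'P size_mulX.
  by apply: leq_sum => l _; rewrite r'P; have [->|nz] := eqVneq (r' l) 0;
    rewrite ?mul0r // size_mulX.
pose W := point_series d (c j).
have WB0' : ev W B != 0 by move: (WB0 j); rewrite evO_eq0.
have := @transfer _ _ _ (evO V) (evO W) 'I_n.+1 A B r e (kerV j) B0 (WB0 j).
rewrite (eq_bigr (fun i => peval x (r i) * evO V (e i))); last first.
  by move=> l _; rewrite lineval_evO.
move=> /(_ eq0).
rewrite !evOE (tofrac_div WB0' (def_A j)) => {}eq0.
have : wvar k ^+ E * \sum_i (map_poly (@cst k) (r i)).[t j] * u i j = 0.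
  apply/eqP; rewrite -tofrac_eq0; apply/eqP; apply: etrans eq0.
  rewrite mulr_sumr rmorph_sum; apply: eq_bigr => l _.
  by rewrite lineval_evO peval_fr evOE (uP l j).1 -rmorphM mulrCA.
move/eqP; rewrite mulf_eq0 expf_eq0 (negPf (wvar_neq0 k)) andbF /= => /eqP.
move/(congr1 (@coefs_at0 k)); rewrite rmorph_sum rmorph0 (bigD1 j) //= big1 ?addr0.
  move/eqP; rewrite rmorphM mulf_eq0 /= [X in _ || X](uP j j).2 eqxx orbF => /eqP e0.
  move: rj; suff -> : (r j).[0] = 0 by rewrite eqxx.
  rewrite -[RHS]e0 -horner_map -map_poly_comp /= /coefs_at0 t0; congr (_.[_]).
  by rewrite map_poly_id // => a _ /=; rewrite coefs_cst.
move=> l lj; rewrite rmorphM /= [X in _ * X]/(coefs_at0 _).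
by have := (uP l j).2; rewrite lj => /eqP ->; rewrite mulr0.
Qed.
End Fibre.

Lemma size_undup_bound (T : eqType) (s : seq T) n :
  (forall y, count_mem y s <= n)%N -> (size s <= n * size (undup s))%N.
Proof.
move=> h; rewrite -(perm_size (perm_count_undup s)) size_flatten /shape -map_comp sumnE big_map.
apply: (leq_trans (leq_sum _ (E2 := fun=> n) _)) => [y _|].
  by rewrite /= size_nseq.
by rewrite big_const_seq count_predT iter_addn_0.
Qed.

Lemma fibre_choice (T : eqType) M (val : 'I_M -> T) y n :
  (n < count_mem y (codom val))%N ->
  exists f : 'I_n.+1 -> 'I_M, injective f /\ forall i, val (f i) = y.
Proof.
rewrite /codom count_map -size_filter; set idx := filter _ _ => lt.
have idx_uniq : uniq idx by rewrite filter_uniq // enum_uniq.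
case def_idx : idx lt => [//|i0 idx'] lt; rewrite -def_idx in lt.
have lt' (i : 'I_n.+1) : (i < size idx)%N by apply: leq_trans lt; apply: ltn_ord.
exists (fun i => nth i0 idx i); split=> [i j /eqP|i].
  by rewrite nth_uniq // => /eqP /val_inj.
by have := mem_nth i0 (lt' i); rewrite mem_filter => /andP [/eqP].
Qed.

Lemma point_frob (k : fieldType) d q (qP : [pchar k]%R.-nat q) s :
  d%:R \is a @GRing.unit k -> (forall a : k, a ^+ d = 1 -> a ^+ q = a) ->
  itinerary d s -> series_map (frob qP) (point_series d s) = point_series d s.
Proof.
move=> dU hq hs; rewrite point_series_map //; congr point_series.
by apply: funext => i; apply: hq; apply: hs.
Qed.

Section PlaceCount.
Variables (k : fieldType) (d q : nat).
Hypotheses (d_gt1 : (1 < d)%N) (dU : d%:R \is a @GRing.unit k).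
Hypotheses (qP : [pchar k]%R.-nat q) (q_gt1 : (1 < q)%N).
Hypothesis frob_mu : forall a : k, a ^+ d = 1 -> a ^+ q = a.
Variables (s : nat -> k) (A B : {poly {poly k}}) (n M : nat) (c : 'I_M -> nat -> k).
Local Notation V := (point_series d s).
Local Notation x := (evO V A / evO V B).
Local Notation W i := (point_series d (c i)).
Hypotheses (s_it : itinerary d s) (B_neq0 : evO V B != 0).
Hypotheses (x_nc : nonconstant x) (x_dep : dep V x n).
Hypotheses (c_it : forall i, itinerary d (c i)) (c_inj : forall i j, c i =1 c j -> i = j).
Hypothesis c_ker : forall i P, evO V P = 0 <-> evO (W i) P = 0.

Lemma place_count : (M <= n * (n + n * q).+1)%N.
Proof.
have fixW s' : itinerary d s' -> series_map (frob qP) (point_series d s') = point_series d s'.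
  exact: point_frob.
have WB0 i : evO (W i) B != 0 by apply: contra_neq B_neq0 => /c_ker.
have WB0' i : ev (W i) B != 0 by move: (WB0 i); rewrite evO_eq0.
have A_neq0 : evO V A != 0.
  by apply: contraNneq (nonconstant_neq0 x_nc) => ->; rewrite mul0r.
have WA0 i : evO (W i) A != 0 by apply: contra_neq A_neq0 => /c_ker.
(* The value of x at a place is a point of P^1(k), with [None] for a pole. *)
have /choice [val valP] i : exists o : option k,
    if o is Some a then exists t, ev (W i) A = t * ev (W i) B /\ coefs t 0%N = a
    else exists t, ev (W i) B = t * ev (W i) A /\ coefs t 0%N = 0.
  have [[t [_ e]]|[t [_ e _]]] := Om_integral_or_inverse (ev (W i) A) (WB0' i).
    by exists (Some (coefs t 0%N)), t.
  by exists None, (wvar k * t); rewrite e coefs_wM.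
have [R [szR szYR eR Q0]] :=
  bidegree_relation (qP := qP) q_gt1 (fixW _ s_it) B_neq0 x_nc x_dep.
(* R has degree at most n in each variable, so R(X, X^q) has degree at most n + n q. *)
have szQ : (size R.['X^q] <= (n + n * q).+1)%N.
  rewrite (horner_coef_wide _ szR); apply: (leq_trans (size_sum _ _ _)).
  apply/bigmax_leqP => j _; apply: (leq_trans (size_polyMleq _ _)).
  rewrite -exprM size_polyXn addnS /= -addSn.
  apply: leq_add; first exact: leq_trans (max_size_coefXY _ _) szYR.
  by rewrite mulnC leq_mul2r -ltnS ltn_ord orbT.
(* There are at most n + n q finite values, being roots of R(X, X^q); the pole accounts for the
   successor. *)
have val_le : (size (undup (codom val)) <= (n + n * q).+1)%N.
  set vs := undup _; have vs_uniq : uniq vs by apply: undup_uniq.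
  pose roots := pmap id vs.
  have roots_uniq : uniq roots by rewrite /roots (pmap_uniq (g := Some)) // => -[].
  have sz_roots : (size vs <= (size roots).+1)%N.
    rewrite size_pmap -(count_predC (fun o : option k => o : bool) vs) -addn1 leq_add2l.
    have -> : count (predC (fun o : option k => o : bool)) vs = count_mem None vs.
      by apply: eq_count => -[].
    by rewrite count_uniq_mem //; case: (_ \in _).
  apply: leq_trans sz_roots _; apply: leq_trans szQ; apply: max_poly_roots => //.
  apply/allP => a; rewrite mem_pmap map_id mem_undup => /codomP [i] def_a.
  have := valP i; rewrite -def_a => -[t [def_A <-]].
  apply: (value_root (qP := qP) (fixW _ s_it) B_neq0 szR eR (fixW _ (c_it i)) _ (WB0 i) def_A).
  by move=> P /c_ker.
(* The bound for zeros is applied to x - a for a finite value a, and to 1/x for the poles. *)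
have fibre y : (count_mem y (codom val) <= n)%N.
  rewrite leqNgt; apply/negP => /fibre_choice [f [f_inj fP]].
  pose c' i := c (f i).
  have c'_inj i j : c' i =1 c' j -> i = j by move/c_inj/f_inj.
  case: y fP => [a|] fP.
    have /choice [t tP] i : exists t, ev (W (f i)) A = t * ev (W (f i)) B /\ coefs t 0%N = a.
      by have := valP (f i); rewrite fP.
    have evA' V' : ev V' (A - a%:P%:P * B) = ev V' A - cst a * ev V' B.
      by rewrite rmorphB rmorphM evC.
    have x'E : evO V (A - a%:P%:P * B) / evO V B = x - const_Om k a.
      by rewrite rmorphB rmorphM evOc mulrBl mulfK.
    apply: (@fibre_bound k d d_gt1 dU V n (A - a%:P%:P * B) B c' (fun i => t i - cst a)).
    - apply: contraNneq (x_nc a) => e; apply/eqP/esym/eqP.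
      by rewrite -subr_eq0 -opprB -x'E e mul0r oppr0.
    - exact: B_neq0.
    - by rewrite x'E; apply: dep_sub.
    - by move=> i; apply: c_it.
    - exact: c'_inj.
    - by move=> i P; apply: (c_ker (f i) P).1.
    - by move=> i; apply: WB0.
    - by move=> i; rewrite evA' (tP i).1 mulrBl.
    by move=> i; rewrite coefsB coefs_cst (tP i).2 subrr.
  have /choice [t tP] i : exists t, ev (W (f i)) B = t * ev (W (f i)) A /\ coefs t 0%N = 0.
    by have := valP (f i); rewrite fP.
  apply: (@fibre_bound k d d_gt1 dU V n B A c' t).
  - exact: B_neq0.
  - exact: A_neq0.
  - rewrite -invf_div; apply: dep_inv x_dep; exact: nonconstant_neq0.
  - by move=> i; apply: c_it.
  - exact: c'_inj.
  - by move=> i P; apply: (c_ker (f i) P).1.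
  - by move=> i; apply: WA0.
  - by move=> i; case: (tP i).
  by move=> i; case: (tP i).
have := size_undup_bound fibre; rewrite size_codom card_ord => /leq_trans; apply.
by rewrite leq_mul2l val_le orbT.
Qed.
End PlaceCount.

(** * Conjugate points and Northcott's finiteness *)

Definition kernel_generator (k : fieldType) (V : series k) (P : {poly {poly k}}) : Prop :=
  P \is monic /\ forall a, ev V a = 0 <-> exists Q, a = Q * P.

Lemma kernel_generator_self (k : fieldType) (V : series k) P :
  kernel_generator V P -> ev V P = 0.
Proof. by move=> [_ kerP]; apply/kerP; exists 1; rewrite mul1r. Qed.

Lemma kernel_generator_min (k : fieldType) (V : series k) P a :
  kernel_generator V P -> ev V a = 0 -> (size a < size P)%N -> a = 0.
Proof.
move=> [mon kerP] /kerP [Q ->] lt; have [->|Q0] := eqVneq Q 0; first by rewrite mul0r.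
move: lt; rewrite size_Mmonic //; have: (0 < size Q)%N by rewrite size_poly_gt0.
by case: (size Q) => // x _; rewrite ltnNge leq_addl.
Qed.

Lemma kernel_generator_exists (k : fieldType) (V : series k) F :
  F \is monic -> ev V F = 0 -> exists P, kernel_generator V P.
Proof.
move=> monF evF.
have inj (p : {poly k}) : ev V p%:P = 0 -> p = 0.
  by rewrite evC -(rmorph0 (@poly_series k)) => /poly_series_inj.
have [M kerM] := principal_kernel inj.
have [Q def_F] := (kerM F).1 evF.
have lcU : lead_coef M \is a GRing.unit.
  apply/unitrPr; exists (lead_coef Q).
  by apply/eqP; rewrite mulrC -lead_coefM -def_F -monicE.
have lcV : (lead_coef M)^-1 * lead_coef M = 1 by apply: mulVr.
exists ((lead_coef M)^-1%:P * M); split.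
  by rewrite monicE lead_coefM lead_coefC lcV.
move=> a; rewrite kerM; split=> -[S ->].
  by exists (S * (lead_coef M)%:P);
    rewrite mulrA -(mulrA S) -polyCM mulrC [_ * _^-1]mulrC lcV mulr1 mulrC.
by exists (S * (lead_coef M)^-1%:P); rewrite mulrA.
Qed.

Lemma roots_list (D : idomainType) (p : {poly D}) : p != 0 ->
  exists rs : seq D, forall z, root p z -> z \in rs.
Proof.
move=> p0.
have [|rs [[all_rs urs] max_rs]] := @ex_minimal _
    (fun rs : seq D => all (root p) rs /\ uniq rs) (fun rs => size p - size rs)%N.
  by exists [::].
exists rs => z pz; apply/negPn/negP => zrs.
have : (size p - size rs <= size p - (size rs).+1)%N.
  by apply: (max_rs (z :: rs)); rewrite /= pz zrs.
have := max_poly_roots p0 all_rs urs.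
by move: (size p) (size rs) => a b; lia.
Qed.

Section ConjugatePoints.
Variables (k : fieldType) (d : nat) (U : seq k).
Hypotheses (d_gt1 : (1 < d)%N) (dU : d%:R \is a @GRing.unit k).
Hypotheses (U_uniq : uniq U) (U_size : size U = d) (U_root : forall a, a \in U -> a ^+ d = 1).
Variables (s : nat -> k) (n0 m0 : nat) (P : {poly {poly k}}).
Hypotheses (s_it : itinerary d s) (mn : (m0 < n0)%N) (s_per : preperiodic n0 m0 s).
Local Notation V := (point_series d s).
Hypothesis kerP : kernel_generator V P.
Local Notation toS := (map_poly (@poly_series k)).

(** The generator P' at W divides P = Q P'. As P generates a prime ideal, Q or P' is a multiple of
    P; in the first case P' would be a unit, although it vanishes at W. *)
Lemma conjugate_same_kernel W : ev W P = 0 -> (exists F, F \is monic /\ ev W F = 0) ->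
  forall a, ev V a = 0 <-> ev W a = 0.
Proof.
move=> WP [F [monF WF]] a; have [monP kerE] := kerP.
have [P' [monP' kerE']] := kernel_generator_exists monF WF.
split; first by move=> /kerE [Q ->]; rewrite rmorphM WP mulr0.
have [Q def_P] := (kerE' P).1 WP.
have : ev V (Q * P') = 0 by rewrite -def_P; apply: kernel_generator_self kerP.
move=> /eqP; rewrite rmorphM mulf_eq0 => /orP [|] /eqP /kerE [S def_S].
  have e1 : P * (S * P') = P * 1 by rewrite mulr1 [RHS]def_P def_S; ring.
  have SP' := mulfI (monic_neq0 monP) e1.
  have : ev W (S * P') = 0.
    by rewrite rmorphM (_ : ev W P' = 0) ?mulr0 //; apply/kerE'; exists 1; rewrite mul1r.
  by rewrite SP' rmorph1 => /eqP; rewrite oner_eq0.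
move=> /kerE' [T ->]; apply/kerE; exists (T * S).
by rewrite def_S mulrA.
Qed.

Lemma cycle_poly_factor : exists Q, cycle_poly k d n0 m0 = Q * P.
Proof. by apply/kerP.2; apply: ev_cycle_poly. Qed.

(** The distinct roots of the cycle polynomial Q P are roots of Q or of P, and their number is the
    sum of both degrees. So P has its full number of roots among them, and these are points of
    itineraries. *)
Lemma conjugate_points : exists c : 'I_(size P).-1 -> nat -> k,
  [/\ forall i, itinerary d (c i), forall i j, c i =1 c j -> i = j &
      forall i a, ev V a = 0 <-> ev (point_series d (c i)) a = 0].
Proof.
have [Q def_F] := cycle_poly_factor.
have [monF szF] := cycle_poly_monic_size k d_gt1 mn.
have [un szr] := cycle_roots_uniq_size d_gt1 dU U_uniq U_size U_root mn.
pose rs := cycle_roots d U n0 m0.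
have monP := kerP.1.
have monQ : Q \is monic by move: monF; rewrite def_F monicMr.
pose rP := [seq v <- rs | root (toS P) v]; pose rQ := [seq v <- rs | root (toS Q) v].
have szS (p : {poly {poly k}}) : size (toS p) = size p.
  by rewrite size_map_inj_poly ?rmorph0 //; apply: poly_series_inj.
have size_rt (p : {poly {poly k}}) : p \is monic ->
    (size [seq v <- rs | root (toS p) v] < size p)%N.
  move=> mon; rewrite -szS; apply: max_poly_roots.
  - by rewrite monic_neq0 // monic_map.
  - by apply/allP => v; rewrite mem_filter => /andP [].
  by rewrite filter_uniq.
have evroot v (p : {poly {poly k}}) : root (toS p) v = (ev v p == 0) by [].
have cover v : v \in rs -> root (toS P) v || root (toS Q) v.
  move=> /(cycle_rootsP d_gt1 dU U_uniq U_size U_root mn) [s' [-> hs' ps']].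
  have := ev_cycle_poly d_gt1 dU mn hs' ps'.
  by rewrite def_F rmorphM !evroot => /eqP; rewrite mulf_eq0 orbC.
have szP : size rP = (size P).-1.
  have h1 := size_rt _ monP; have h2 := size_rt _ monQ.
  have h3 : (size rs <= size rP + size rQ)%N.
    rewrite !size_filter -count_predUI; apply: leq_trans (leq_addr _ _).
    by rewrite -(count_predT rs) -!size_filter; apply: (eq_leq); rewrite !size_filter;
      apply: eq_in_count => v /cover.
  have : size (Q * P) = (size Q + size P).-1 by rewrite size_Mmonic // monic_neq0.
  rewrite -def_F szF -szr -/rs; rewrite -/rP in h1; rewrite -/rQ in h2.
  move: h1 h2 h3; move: (size P) (size Q) (size rP) (size rQ) (size rs) => a b x y z.
  by clear; lia.
have /choice [c cP] (i : 'I_(size P).-1) : exists s', [/\ nth 0 rP i = point_series d s',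
    itinerary d s', preperiodic n0 m0 s' & ev (point_series d s') P = 0].
  have : nth 0 rP i \in rP by rewrite mem_nth // szP.
  rewrite mem_filter => /andP [rt].
  move=> /(cycle_rootsP d_gt1 dU U_uniq U_size U_root mn) [s' [e hs' ps']].
  by exists s'; split=> //; apply/eqP; rewrite -evroot -e.
exists c; split=> [i|i j e|i].
- by case: (cP i).
- have [ei _ _ _] := cP i; have [ej _ _ _] := cP j.
  have /eqP : nth 0 rP i = nth 0 rP j by rewrite ei ej; congr point_series; apply: funext.
  by rewrite nth_uniq ?szP // ?filter_uniq // => /eqP /val_inj.
have [_ hs' ps' eP] := cP i; apply: conjugate_same_kernel => //.
exists (cycle_poly k d n0 m0); split=> //.
exact: ev_cycle_poly.
Qed.

(** The twist of P is monic of the same degree and vanishes at V too, so its difference to P lies in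
    the kernel and has too small a degree to be nonzero. *)
Lemma kernel_generator_frob q (qP : [pchar k]%R.-nat q) :
  (forall a : k, a ^+ d = 1 -> a ^+ q = a) -> map_poly (map_poly (frob qP)) P = P.
Proof.
move=> hq; have fixV := point_frob qP dU hq s_it.
set P' := map_poly _ P.
have monP := kerP.1; have monP' : P' \is monic by rewrite !monic_map.
have szP' : size P' = size P.
  by rewrite size_map_inj_poly ?rmorph0 //; apply: map_poly_inj.
apply/eqP; rewrite -subr_eq0; apply/eqP; apply: (kernel_generator_min kerP).
  by rewrite rmorphB (ev_sigma _ fixV) (kernel_generator_self kerP) rmorph0 subr0.
have lt0 : (0 < size P)%N by rewrite size_poly_gt0 monic_neq0.
rewrite -(prednK lt0) ltnS; apply/leq_sizeP => j le.
have [->|ne] := eqVneq j (size P).-1.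
  by rewrite coefB -{1}szP' -!lead_coefE (monicP monP) (monicP monP') subrr.
have lt : (size P <= j)%N by rewrite -(prednK lt0) ltn_neqAle eq_sym ne.
by rewrite coefB !nth_default ?subrr ?szP'.
Qed.
End ConjugatePoints.

(* The total degree of P is the degree in w of P(w, w y). *)
Section TotalDegree.
Variable k : fieldType.
Implicit Types P Q : {poly {poly k}}.

Definition weigh : {rmorphism {poly {poly k}} -> {poly {poly k}}} :=
  (swapXY \o comp_poly (('X)%:P * 'X))%FUN.

Lemma weighE P : weigh P = swapXY (P \Po (('X)%:P * 'X)). Proof. by []. Qed.

Lemma coef_weigh P i j : (weigh P)`_(i + j)`_j = P`_j`_i.
Proof.
rewrite weighE coef_swapXY comp_polyE coef_sum.
have E (l : 'I_(size P)) : (P`_l *: (('X)%:P * 'X) ^+ l)`_j = (P`_l * 'X^l) *+ (j == l).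
  rewrite exprMn -polyC_exp scalerAl -mul_polyC -polyCM coefCM coefXn.
  by case: (j == l); rewrite ?mulr1 ?mulr0.
under eq_bigr => l _ do rewrite E.
case: (ltnP j (size P)) => [lt|le].
  rewrite (bigD1 (Ordinal lt)) //= eqxx big1 ?addr0.
    by rewrite coefMXn ltnNge leq_addl /= addnK.
  by move=> l /eqP ne; case: eqP => // e; case: ne; apply: val_inj.
rewrite big1 => [|l _]; first by rewrite coef0 [P`_j]nth_default // coef0.
by case: eqP => // e; move: le; rewrite leqNgt e ltn_ord.
Qed.

Lemma size_weigh_monic P : P \is monic -> (size P <= size (weigh P))%N.
Proof.
move=> mon; have lt0 : (0 < size P)%N by rewrite size_poly_gt0 monic_neq0.
rewrite -(prednK lt0) ltnNge; apply/negP => le.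
have := coef_weigh P 0 (size P).-1; rewrite add0n [(weigh P)`__]nth_default // coef0.
by rewrite -lead_coefE (monicP mon) coef1 => /eqP; rewrite eq_sym oner_eq0.
Qed.

Lemma weigh_gpoly d n : (1 < d)%N -> (size (weigh (gpoly k d n)) <= (d ^ n).+1)%N.
Proof.
move=> d_gt1; have wX : weigh ('X)%:P = 'X by rewrite weighE comp_polyC swapXY_Y.
elim: n => [|n IH].
  rewrite weighE comp_polyX rmorphM /= swapXY_X swapXY_Y mulrC.
  by rewrite size_mulX ?polyC_eq0 ?polyX_eq0 // size_polyC polyX_eq0.
rewrite rmorphB rmorphXn polyC_exp rmorphXn wX.
apply: (leq_trans (size_polyD _ _)); rewrite size_polyN size_polyXn geq_max.
apply/andP; split; last by rewrite ltnS leq_subr.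
apply: (leq_trans (size_poly_exp_leq _ _)); rewrite ltnS expnSr leq_mul2r.
by apply/orP; right; move: IH; case: (size _).
Qed.

Lemma weigh_cycle_poly d n m : (1 < d)%N -> (m < n)%N ->
  (size (weigh (cycle_poly k d n m)) <= (d ^ n).+1)%N.
Proof.
move=> d_gt1 mn; have wX : weigh ('X)%:P = 'X by rewrite weighE comp_polyC swapXY_Y.
rewrite rmorphB rmorphM polyC_exp rmorphXn wX.
apply: (leq_trans (size_polyD _ _)); rewrite size_polyN geq_max weigh_gpoly //=.
have := weigh_gpoly m d_gt1; have : (d ^ m <= d ^ n)%N by rewrite leq_exp2l // ltnW.
move=> le h; apply: (leq_trans (size_polyMleq _ _)); rewrite size_polyXn addSn /=.
apply: (leq_trans (leq_add (leqnn _) h)).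
by rewrite addnS subnK.
Qed.

(** Total degrees add up in the product Q P, whose total degree is at most its degree in the outer
    variable. For each monic factor the total degree is at least the outer degree, so equality holds
    for both. *)
Lemma coef_size_factor d n m P Q : (1 < d)%N -> (m < n)%N -> P \is monic ->
  cycle_poly k d n m = Q * P -> forall j, (size (P`_j)%R <= size P)%N.
Proof.
move=> d_gt1 mn monP def_F j.
have [monF szF] := cycle_poly_monic_size k d_gt1 mn.
have monQ : Q \is monic by move: monF; rewrite def_F monicMr.
have hQ := size_weigh_monic monQ; have hP := size_weigh_monic monP.
have h0 (p : {poly {poly k}}) : p \is monic -> (0 < size (weigh p))%N.
  move=> mon; apply: leq_trans (size_weigh_monic mon).
  by rewrite size_poly_gt0 monic_neq0.
have nz (p : {poly {poly k}}) : p \is monic -> weigh p != 0.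
  by move=> /h0; rewrite size_poly_gt0.
have hw : (size (weigh P) <= size P)%N.
  have := weigh_cycle_poly d_gt1 mn; rewrite -szF def_F rmorphM.
  rewrite size_mul ?nz // size_Mmonic ?monic_neq0 //.
  have q0 : (0 < size Q)%N by rewrite size_poly_gt0 monic_neq0.
  have p0 : (0 < size P)%N by rewrite size_poly_gt0 monic_neq0.
  move: q0 p0 hQ hP (h0 _ monP) (h0 _ monQ).
  by move: (size Q) (size P) (size (weigh Q)) (size (weigh P)); clear; lia.
apply/leq_sizeP => i le; rewrite -coef_weigh [(weigh P)`__]nth_default ?coef0 //.
by apply: leq_trans hw _; apply: leq_trans le _; apply: leq_addr.
Qed.
End TotalDegree.

Lemma northcott (k : fieldType) (d q S : nat) (U : seq k) (qP : [pchar k]%R.-nat q) :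
  (1 < d)%N -> d%:R \is a @GRing.unit k ->
  uniq U -> size U = d -> (forall a, a \in U -> a ^+ d = 1) ->
  (1 < q)%N -> (forall a : k, a ^+ d = 1 -> a ^+ q = a) ->
  exists X : seq (series k), forall s n m P, itinerary d s -> (m < n)%N ->
    preperiodic n m s -> kernel_generator (point_series d s) P -> (size P <= S)%N ->
    point_series d s \in X.
Proof.
move=> d_gt1 dU U_uniq U_size U_root q1 hq.
have Xq0 : 'X^q - 'X != 0 :> {poly k}.
  apply/eqP => /(congr1 (fun p : {poly k} => p`_q)).
  rewrite coefB coefXn eqxx coefX coef0 gtn_eqF // subr0 => /eqP.
  by rewrite oner_eq0.
have [Fl FlP] := roots_list Xq0.
pose I := ('I_S * 'I_S)%type.
pose toP (f : {ffun I -> 'I_(size Fl)}) : {poly {poly k}} :=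
  \poly_(j < S) \poly_(i < S)
    (if insub j is Some j' then if insub i is Some i' then Fl`_(f (j', i')) else 0 else 0).
have /choice [rts rtsP] (f : {ffun I -> 'I_(size Fl)}) : exists rs : seq (series k),
    toP f != 0 -> forall z, ev z (toP f) = 0 -> z \in rs.
  have [->|f0] := eqVneq (toP f) 0; first by exists [::].
  have [|rs rsP] := @roots_list _ (map_poly (@poly_series k) (toP f)).
    rewrite -(rmorph0 (map_poly (@poly_series k))).
    by rewrite (inj_eq (map_inj_poly (@poly_series_inj k) (rmorph0 _))).
  by exists rs => _ z e; apply: rsP; apply/eqP.
exists (flatten [seq rts f | f <- enum {ffun I -> 'I_(size Fl)}]).
move=> s n m P s_it mn s_per kerP szP; have [monP _] := kerP.
have [Q def_F] := cycle_poly_factor d_gt1 dU s_it mn s_per kerP.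
have szPj j : (size (P`_j)%R <= S)%N.
  exact: leq_trans (coef_size_factor d_gt1 mn monP def_F j) szP.
have PF j i : P`_j`_i \in Fl.
  apply: FlP; have := kernel_generator_frob dU s_it kerP qP hq.
  move=> /(congr1 (fun p : {poly {poly k}} => p`_j`_i)); rewrite !coef_map /= /frob => e.
  by rewrite /root hornerD hornerN hornerXn hornerX e subrr.
have lt j i : (index (P`_j`_i)%R Fl < size Fl)%N by rewrite index_mem.
pose f : {ffun I -> 'I_(size Fl)} := [ffun ji : I => Ordinal (lt ji.1 ji.2)].
have def_P : toP f = P.
  apply/polyP => j; rewrite coef_poly; case: ltnP => [jS|le]; last first.
    by rewrite nth_default // (leq_trans szP).
  apply/polyP => i; rewrite coef_poly; case: ltnP => [iS|le]; last first.
    by rewrite nth_default // (leq_trans (szPj j)).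
  by rewrite !insubT /= ffunE /= nth_index.
apply/flattenP; exists (rts f); first by rewrite map_f // mem_enum.
apply: rtsP; first by rewrite def_P monic_neq0.
by rewrite def_P; apply: kernel_generator_self kerP.
Qed.

(** * Reduction at a place of residue characteristic l *)

Lemma lift_poly (R S : nzRingType) (f : {rmorphism R -> S}) (p : {poly S}) :
  (forall i, exists a, f a = p`_i) -> exists p', map_poly f p' = p.
Proof.
move=> /choice [a aP]; exists (\poly_(i < size p) a i).
apply/polyP => i; rewrite coef_map coef_poly; case: ltnP => [_|le]; first exact: aP.
by rewrite /= rmorph0 nth_default.
Qed.

Lemma lift_poly2 (R S : nzRingType) (f : {rmorphism R -> S}) (P : {poly {poly S}}) :
  (forall i j, exists a, f a = P`_i`_j) -> exists P', map_poly (map_poly f) P' = P.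
Proof. by move=> h; apply: lift_poly => i; apply: lift_poly => j; apply: h. Qed.

(* A valuation ring O of k with residue field kap. *)
Section Place.
Variables (k kap : fieldType) (O : idomainType).
Variables (io : {rmorphism O -> k}) (rho : {rmorphism O -> kap}).
Hypothesis io_inj : injective io.
Hypothesis valuation : forall x : k, x != 0 -> exists a, io a = x \/ io a = x^-1.
Hypothesis rho_unit : forall a, rho a != 0 -> a \is a GRing.unit.
Hypothesis rho_surj : forall b, exists a, rho a = b.
Notation m2 f := (map_poly (map_poly f)).

Lemma valuation_total (x y : k) : y != 0 ->
  (exists a, x = io a * y) \/ (exists a, y = io a * x).
Proof.
move=> y0; have [->|x0] := eqVneq x 0; first by left; exists 0; rewrite rmorph0 mul0r.
have xy0 : x / y != 0 by rewrite mulf_neq0 // invr_neq0.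
have [a [ea|ea]] := valuation xy0; first by left; exists a; rewrite ea divfK.
by right; exists a; rewrite ea invf_div divfK.
Qed.

Lemma dvd_total (a b : O) : b != 0 -> (exists c, a = c * b) \/ (exists c, b = c * a).
Proof.
move=> b0; have ib0 : io b != 0 by rewrite -(rmorph0 io) (inj_eq io_inj).
have [[c e]|[c e]] := valuation_total (io a) ib0; [left|right]; exists c;
  by apply: io_inj; rewrite rmorphM.
Qed.

Lemma max_value (s : seq k) : (exists2 x, x \in s & x != 0) ->
  exists b, [/\ b \in s, b != 0 & forall x, x \in s -> exists c, x = io c * b].
Proof.
elim: s => [[x]//|y s IH] [x xs x0].
have [/hasP [z zs z0]|/hasPn s0] := boolP (has (fun z => z != 0) s).
  have [|b [bs b0 bP]] := IH; first by exists z.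
  have [[a ey]|[a eb]] := valuation_total y b0.
    exists b; split=> // [|t]; first by rewrite inE bs orbT.
    by rewrite inE => /orP [/eqP ->|/bP //]; exists a.
  exists y; split=> [||t]; first by rewrite inE eqxx.
    by apply: contraNneq b0 => y0; rewrite eb y0 mulr0.
  rewrite inE => /orP [/eqP ->|/bP [c ->]]; first by exists 1; rewrite rmorph1 mul1r.
  by exists (c * a); rewrite rmorphM eb mulrA.
have sz z : z \in s -> z = 0 by move=> /s0; rewrite negbK => /eqP.
have xy : x = y by move: xs; rewrite inE => /orP [/eqP //|/sz e]; rewrite e eqxx in x0.
exists y; split; rewrite ?inE ?eqxx // -?xy // => t.
rewrite inE => /orP [/eqP ->|/sz ->]; first by exists 1; rewrite xy rmorph1 mul1r.
by exists 0; rewrite rmorph0 mul0r.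
Qed.

(** Of two elements of k one is an O-multiple of the other, so some coefficient b of u divides all
    the others. After division by b a coefficient equals 1, and the reduction is nonzero. It is
    recorded that b is a coefficient of u, because the contents of successive polynomials are
    compared through their coefficients. *)
Lemma primitive_part (u : {poly {poly k}}) : u != 0 ->
  exists b (y : {poly {poly O}}),
    [/\ b != 0, exists i j, b = u`_i`_j, u = b%:P%:P * m2 io y, m2 rho y != 0 &
        forall i, (size (y`_i)%R <= size (u`_i)%R)%N /\ (size y <= size u)%N].
Proof.
move=> u0; pose cs := flatten [seq polyseq p | p <- polyseq u].
have csP i j : u`_i`_j != 0 -> u`_i`_j \in cs.
  move=> nz; have [lj|/(nth_default 0) e] := ltnP j (size (u`_i)%R); last first.
    by rewrite e eqxx in nz.
  have [li|/(nth_default 0) e] := ltnP i (size u); last by rewrite e coef0 eqxx in nz.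
  apply/flattenP; exists (u`_i : seq k); last exact: mem_nth.
  by apply/mapP; exists u`_i => //; apply: mem_nth.
have [|b [bcs b0 bP]] := @max_value cs.
  exists (lead_coef (lead_coef u)); last by rewrite !lead_coef_eq0.
  by apply: csP; rewrite -!lead_coefE !lead_coef_eq0.
have [i0 [j0 eb]] : exists i j, b = u`_i`_j.
  move: bcs => /flattenP [s /mapP [p pu ->] bp].
  by exists (index p u), (index b p); rewrite !nth_index.
have /choice [c cP] (ij : nat * nat) : exists c, u`_(ij.1)`_(ij.2) = io c * b.
  have [->|nz] := eqVneq u`_(ij.1)`_(ij.2) 0; last exact/bP/csP.
  by exists 0; rewrite rmorph0 mul0r.
pose y : {poly {poly O}} := \poly_(i < size u) \poly_(j < size (u`_i)%R) c (i, j).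
have def_u : u = b%:P%:P * m2 io y.
  apply/polyP => i; apply/polyP => j; rewrite !coefCM !coef_map /= coef_poly.
  case: ltnP => [li|le]; last by rewrite /= coef0 rmorph0 mulr0 [u`_i]nth_default // coef0.
  rewrite coef_poly; case: ltnP => [lj|le]; last by rewrite /= rmorph0 mulr0 nth_default.
  by rewrite mulrC -(cP (i, j)).
exists b, y; split=> //; first by exists i0, j0.
  apply/eqP => e.
  have : b * io y`_i0`_j0 = b * 1 by rewrite mulr1 [RHS]eb def_u !coefCM !coef_map.
  move/(mulfI b0) => /esym e1; have y1 : y`_i0`_j0 = 1 by apply: io_inj; rewrite -e1 rmorph1.
  have := congr1 (fun P : {poly {poly kap}} => P`_i0`_j0) e.
  by rewrite !coef_map y1 /= rmorph1 !coef0 => /eqP; rewrite oner_eq0.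
move=> i; split; last exact: size_poly.
rewrite coef_poly; case: ltnP => [li|le]; first exact: size_poly.
by rewrite size_poly0.
Qed.

Lemma m2_inj (R S : nzRingType) (f : {rmorphism R -> S}) : injective f -> injective (m2 f).
Proof.
by move=> fI; apply: map_inj_poly; rewrite ?rmorph0 //; apply: map_inj_poly; rewrite ?rmorph0.
Qed.

Lemma primitive_partO (u : {poly {poly O}}) : u != 0 ->
  exists b (y : {poly {poly O}}),
    [/\ b != 0, exists i j, b = u`_i`_j, u = b%:P%:P * y, m2 rho y != 0 & (size y <= size u)%N].
Proof.
move=> u0; have iu0 : m2 io u != 0.
  by rewrite -(rmorph0 (m2 io)) (inj_eq (m2_inj io_inj)).
have [b [y [b0 [i [j eb]] def_u y0 sz]]] := primitive_part iu0.
have eb' : b = io u`_i`_j by rewrite eb !coef_map.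
exists u`_i`_j, y; split=> //; last 1 first.
- by have [_] := sz 0%N; rewrite size_map_inj_poly ?rmorph0 //; apply: map_inj_poly;
  rewrite ?rmorph0.
- by apply: contraNneq b0 => e; rewrite eb' e rmorph0.
- by exists i, j.
apply: (m2_inj io_inj); rewrite def_u map2M; congr (_ * _).
by rewrite map2_polyC eb'.
Qed.

Lemma io_neq0 a : a != 0 -> io a != 0.
Proof. by rewrite -(rmorph0 io) (inj_eq io_inj). Qed.

Variable l : nat.
Hypotheses (l_prime : prime l) (l_kap : l%:R = 0 :> kap).
Hypothesis natO_neq0 : forall n : nat, (0 < n)%N -> n%:R != 0 :> O.

Lemma l_char : l \in [pchar kap]%R.
Proof. by rewrite inE l_prime l_kap eqxx. Qed.

Lemma rho_int0 (n : int) : rho n%:~R = 0 -> exists n', n = n' * l%:Z.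
Proof.
rewrite rmorph_int => e.
have : (`|n|%N)%:R = 0 :> kap.
  case: n e => n e; first exact: e.
  by move/eqP: e; rewrite NegzE mulrNz oppr_eq0 => /eqP.
move/eqP; rewrite -(dvdn_pcharf l_char) => /dvdnP [c ec].
exists (sgz n * c%:Z); rewrite -mulrA -PoszM -ec.
exact: intEsg.
Qed.

(** An integer modulo l O. In general rho a = 0 does not make a divisible by l, as l need not
    generate the maximal ideal; for an integer modulo l it does. *)
Definition near_int (a : O) : Prop := exists (m : int) c, a = m%:~R + c * l%:R.

Lemma near_int_int m : near_int m%:~R.
Proof. by exists m, 0; rewrite mul0r addr0. Qed.
Lemma near_int1 : near_int 1. Proof. exact: (near_int_int 1). Qed.
Lemma near_intB a b : near_int a -> near_int b -> near_int (a - b).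
Proof.
move=> [m [c ->]] [m' [c' ->]]; exists (m - m'), (c - c').
by rewrite rmorphB; ring.
Qed.
Lemma near_intM a b : near_int a -> near_int b -> near_int (a * b).
Proof.
move=> [m [c ->]] [m' [c' ->]].
exists (m * m'), (m%:~R * c' + c * m'%:~R + c * c' * l%:R).
by rewrite rmorphM; ring.
Qed.

Lemma near_int_rho0 a : near_int a -> rho a = 0 -> exists c, a = c * l%:R.
Proof.
move=> [m [c ->]]; rewrite rmorphD rmorphM rmorph_nat l_kap mulr0 addr0.
move=> /rho_int0 [m' ->]; exists (m'%:~R + c); rewrite rmorphM mulrDl.
by [].
Qed.

Definition cdvd (a : O) (u : series O) : Prop := exists u', u = cst a * u'.

Lemma cdvdP a u : (forall n, exists c, coefs u n = c * a) -> cdvd a u.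
Proof.
move=> /choice [c cP]; exists (Series c); apply: seriesP => n.
by rewrite coefs_cstM cP mulrC.
Qed.

Lemma cst_neq0 a : a != 0 -> cst a != 0 :> series O.
Proof. by rewrite -(rmorph0 (@cst O)) (inj_eq (@cst_inj O)). Qed.

(* A coefficient of pi which vanishes in the residue field is divisible by l, because
   it is an integer modulo l. *)
Lemma cdvd_regular (pi g : series O) M : (forall n, near_int (coefs pi n)) ->
  series_map rho pi != 0 -> cdvd (l%:R ^+ M) (pi * g) -> cdvd (l%:R ^+ M) g.
Proof.
move=> pi_int pi0.
have l0 : l%:R != 0 :> O by rewrite natO_neq0 // prime_gt0.
have base h : cdvd l%:R (pi * h) -> cdvd l%:R h.
  (* Let i be the order of the reduction of pi. The coefficients of pi below i are divisible by l,
     and the rest is w^i times an invertible series, so that h can be isolated. *)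
  move=> [v ev]; have [i [t [e t0]]] := series_neq0P pi0.
  pose pi2 := Series (fun n => coefs pi (n + i)%N).
  pose low := Series (fun n => if (n < i)%N then coefs pi n else 0).
  have def_pi : pi = low + wvar O ^+ i * pi2.
    apply: seriesP => n; rewrite coefsD coefs_wXM /low /pi2 /coefs.
    by case: ltnP => le; rewrite ?addr0 // add0r subnK.
  have [low' elow] : cdvd l%:R low.
    apply: cdvdP => n; rewrite /low /coefs; case: ltnP => [lt|_]; last by exists 0; rewrite mul0r.
    apply: near_int_rho0 => //.
    by rewrite -[LHS]/(coefs (series_map rho pi) n) e coefs_wXM lt.
  have U2 : coefs pi2 0%N \is a GRing.unit.
    apply: rho_unit; rewrite -[X in X != _]/(coefs (series_map rho pi) (0 + i)%N).
    by rewrite e coefs_wXM add0n ltnn subnn.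
  have [w2 ew2] := series_inv_exists U2.
  have : wvar O ^+ i * (pi2 * h) = cst l%:R * (v - low' * h).
    have -> : wvar O ^+ i * (pi2 * h) = (pi - low) * h by rewrite def_pi; ring.
    by rewrite mulrBl ev elow; ring.
  set r := v - _ => er.
  have [r' er'] : exists r', r = wvar O ^+ i * r'.
    have [n lt|r' ->] := @series_eqmod O i r 0; last by exists r'; rewrite add0r.
    have := congr1 (fun u => coefs u n) er; rewrite coefs_wXM lt coefs_cstM coefs0.
    by move/esym/eqP; rewrite mulf_eq0 (negPf l0) => /eqP.
  exists (r' * w2); have : pi2 * h = cst l%:R * r'.
    by apply: (@series_wX_inj O i); rewrite er er'; ring.
  by move=> e2; rewrite mulrA -e2 -mulrA mulrC -mulrA [w2 * _]mulrC ew2 mulr1.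
elim: M g => [|M IH] g; first by move=> _; exists g; rewrite expr0 rmorph1 mul1r.
rewrite exprS => -[v ev].
have [|g1 eg1] := base g; first by exists (cst (l%:R ^+ M) * v); rewrite ev rmorphM mulrA.
have [|g2 eg2] := IH g1.
  exists v; apply: (mulfI (cst_neq0 l0)).
  by rewrite mulrCA -eg1 ev rmorphM mulrA.
by exists g2; rewrite rmorphM eg1 eg2 mulrA.
Qed.

(** Multiplication by the complementary divisor c turns divisibility by nu into divisibility by a
    power of l. *)
Lemma cdvd_regular_dvd (pi g : series O) M nu c : (forall n, near_int (coefs pi n)) ->
  series_map rho pi != 0 -> nu * c = l%:R ^+ M -> cdvd nu (pi * g) -> cdvd nu g.
Proof.
move=> pi_int pi0 e [v ev].
have l0 : l%:R ^+ M != 0 :> O by rewrite expf_neq0 // natO_neq0 // prime_gt0.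
have c0 : c != 0 by apply: contraNneq l0 => c0; rewrite -e c0 mulr0.
have [|g' eg'] := @cdvd_regular pi (cst c * g) M pi_int pi0.
  by exists v; rewrite -e rmorphM mulrCA ev; ring.
exists g'; apply: (mulfI (cst_neq0 c0)).
by rewrite eg' -e rmorphM; ring.
Qed.
End Place.

Lemma ev_closed (R : comNzRingType) (P : R -> Prop) (V : series R) :
  P 1 -> (forall a b, P a -> P b -> P (a - b)) ->
  (forall a b, P a -> P b -> P (a * b)) -> (forall n, P (coefs V n)) ->
  forall (Z : {poly {poly int}}) n, P (coefs (ev V (map_poly (map_poly intr) Z)) n).
Proof.
move=> P1 PB PM PV.
have P0 : P 0 by rewrite -(subrr 1); apply: PB.
have PN a : P a -> P (- a) by rewrite -sub0r; apply: PB.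
have PD a b : P a -> P b -> P (a + b) by move=> Pa Pb; rewrite -[b]opprK; apply/PB/PN.
have Pnat (m : nat) : P m%:R by elim: m => [//|m IH]; rewrite -natr1; apply: PD.
have Pint (m : int) : P m%:~R.
  by case: m => m; rewrite ?NegzE ?mulrNz; [apply: Pnat | apply/PN/Pnat].
apply: poly2_ind => [a n|n|n|A B PA PB' n|A B PA PB' n].
- rewrite map2_polyC evC coefs_cst; case: (n == _)%N; rewrite ?mulr1n ?mulr0n //.
  exact: Pint.
- have -> : map_poly (map_poly intr) ('X)%:P = ('X)%:P :> {poly {poly R}}.
    by rewrite [LHS]map_polyC /= map_polyX.
  rewrite evC coefs_poly coefX; case: (n == _); [exact: P1 | exact: P0].
- by rewrite map_polyX evX.
- by rewrite !rmorphD coefsD; apply: PD.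
rewrite map2M rmorphM coefsM; elim/big_ind: _ => // i _; exact: PM.
Qed.

Lemma ev_wide (R : comNzRingType) (V : series R) (u : {poly {poly R}}) I J :
  (size u <= J)%N -> (forall j, (size (u`_j)%R <= I)%N) ->
  ev V u = \sum_(ij : 'I_I * 'I_J) cst u`_(ij.2)`_(ij.1) * ev V (('X^(ij.1))%:P * 'X^(ij.2)).
Proof.
move=> szJ szI.
have wideE (S : nzRingType) (p : {poly S}) N : (size p <= N)%N -> p = \sum_(i < N)
  (p`_i)%:P * 'X^i.
  move=> szp; have -> : p = \poly_(i < N) p`_i :> {poly S}.
    apply/polyP => i; rewrite coef_poly; case: ltnP => // le.
    by rewrite nth_default // (leq_trans szp).
  rewrite [LHS]poly_def; apply: eq_bigr => i _.
  by rewrite coef_poly ltn_ord mul_polyC.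
rewrite {1}(wideE _ u J szJ) rmorph_sum.
transitivity (\sum_(j < J) \sum_(i < I) cst u`_j`_i * ev V (('X^i)%:P * 'X^j)).
  apply: eq_bigr => j _; rewrite rmorphM {1}(wideE _ u`_j I (szI j)).
  rewrite (rmorph_sum (@polyC _)) rmorph_sum mulr_suml; apply: eq_bigr => i _.
  rewrite [X in ev V X](rmorphM (@polyC _)) [ev V (_ * 'X^j)]rmorphM.
  by rewrite rmorphM evC mulrA.
by rewrite exchange_big pair_big.
Qed.

(** The classes of 0, ..., l - 1 are l distinct roots of X^l - X, which has no others. *)
Lemma frob_fixed_nat (kap : fieldType) l (a : kap) : prime l -> l%:R = 0 :> kap ->
  a ^+ l = a -> exists m : nat, a = m%:R.
Proof.
move=> l_prime l_kap al; have l_gt0 := prime_gt0 l_prime; have ch := l_char l_prime l_kap.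
pose rs : seq kap := [seq (i : nat)%:R | i <- iota 0 l].
have [/mapP [m _ ->]|ars] := boolP (a \in rs); first by exists m.
have rs_uniq : uniq rs.
  rewrite map_inj_in_uniq ?iota_uniq // => i j; rewrite !mem_iota /= !add0n => il jl.
  move=> /eqP; rewrite -subr_eq0 => /eqP e.
  wlog ij : i j il jl e / (i <= j)%N.
    move=> h; case: (leqP i j) => [|/ltnW] /h; first exact.
    by move=> h'; apply/esym/h' => //; rewrite -opprB e oppr0.
  have : (l %| j - i)%N by rewrite (dvdn_pcharf ch) natrB // -opprB e oppr0.
  by rewrite /dvdn modn_small; [move/eqP; lia | lia].
have Xl0 : 'X^l - 'X != 0 :> {poly kap}.
  apply/eqP => /(congr1 (fun p : {poly kap} => p`_l)).
  rewrite coefB coefXn eqxx coefX coef0 gtn_eqF ?prime_gt1 // subr0 => /eqP.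
  by rewrite oner_eq0.
have := max_poly_roots Xl0 (rs := a :: rs); rewrite /= ars rs_uniq.
rewrite size_map size_iota => h.
have szX : size ('X^l - 'X : {poly kap}) = l.+1.
  rewrite size_polyDl ?size_polyXn // size_polyN size_polyX.
  by rewrite ltnS prime_gt1.
suff : (l.+1 < l.+1)%N by rewrite ltnn.
rewrite -{2}szX; apply: h => //; apply/andP; split.
  by rewrite /root hornerD hornerN hornerXn hornerX al subrr.
apply/allP => z /mapP [i _ ->].
rewrite /root hornerD hornerN hornerXn hornerX -(pFrobenius_autE ch) pFrobenius_aut_nat.
by rewrite subrr.
Qed.

(** * Arithmetic of the coefficients of the points over the valuation ring *)

Section PlacePoints.
Variables (k kap : fieldType) (O : idomainType).
Variables (io : {rmorphism O -> k}) (rho : {rmorphism O -> kap}).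
Hypothesis io_inj : injective io.
Hypothesis valuation : forall x : k, x != 0 -> exists a, io a = x \/ io a = x^-1.
Hypothesis rho_unit : forall a, rho a != 0 -> a \is a GRing.unit.
Hypothesis rho_surj : forall b, exists a, rho a = b.
Notation m2 f := (map_poly (map_poly f)).
Variable l : nat.
Hypotheses (l_prime : prime l) (l_kap : l%:R = 0 :> kap).
Hypothesis natO_neq0 : forall n : nat, (0 < n)%N -> n%:R != 0 :> O.
Variable d : nat.
Hypotheses (d_gt1 : (1 < d)%N) (dO : d%:R \is a @GRing.unit O).
Hypothesis d_l : (d %| l.-1)%N.
Let l_gt0 : (0 < l)%N := prime_gt0 l_prime.

Lemma frob_l_kap (a : kap) : a ^+ d = 1 -> a ^+ l = a.
Proof.
move=> ad; have [c ec] := dvdnP d_l.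
by rewrite -(prednK l_gt0) exprS ec mulnC exprM ad expr1n mulr1.
Qed.

(** The reduction of z lies in F_l, say it is that of m. Then z^d - m^d = 1 - m^d is an integer that
    reduces to 0, hence a multiple of l. Its cofactor S over z - m reduces to d m^(d-1), so it is a
    unit, and z - m is a multiple of l. *)
Lemma near_int_root (z : O) : z ^+ d = 1 -> near_int l z.
Proof.
move=> zd; have [m em] : exists m : nat, rho z = m%:R.
  by apply: (frob_fixed_nat l_prime l_kap); apply: frob_l_kap; rewrite -rmorphXn zd rmorph1.
pose S := \sum_(i < d) z ^+ (d.-1 - i) * m%:R ^+ i.
have eS : z ^+ d - m%:R ^+ d = (z - m%:R) * S.
  by rewrite subrXX; congr (_ * _); apply: eq_bigr => j _; rewrite -subn1 subnAC subn1.
have SU : S \is a GRing.unit.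
  apply: rho_unit; rewrite rmorph_sum (eq_bigr (fun=> m%:R ^+ d.-1)).
    rewrite sumr_const card_ord -[_ *+ d]mulr_natl mulf_neq0 //.
      by have := rmorph_unit rho dO; rewrite rmorph_nat unitfE.
    rewrite -em expf_neq0 //; apply/eqP => e.
    have := congr1 rho zd; rewrite rmorphXn e rmorph1 expr0n.
    by rewrite gtn_eqF ?(ltnW d_gt1) // => /eqP; rewrite eq_sym oner_eq0.
  move=> j _; rewrite rmorphM !rmorphXn rmorph_nat em -exprD subnK //.
  by rewrite -ltnS prednK // ltnW.
have [n' en'] : exists n', 1 - (m ^ d)%N%:Z = n' * l%:Z.
  apply: (rho_int0 l_prime l_kap (O := O) (rho := rho)).
  have := congr1 rho zd; rewrite rmorphXn em rmorph1 => e.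
  by rewrite rmorphB rmorph1 rmorphB rmorph1 rmorph_int -[X in _ - X]/((m ^ d)%N%:R) natrX
    e subrr.
exists m%:Z, (n'%:~R * S^-1).
have : (z - m%:R) * S = n'%:~R * l%:R.
  rewrite -eS zd -natrX -[l%:R]/(l%:Z%:~R) -rmorphM -en' rmorphB rmorph1.
  by [].
move/(congr1 (fun x => x * S^-1)); rewrite mulrK // => e.
by rewrite mulrAC -e addrC subrK.
Qed.

(** If l = 1 + t d, then 1/d = - t + l/d. *)
Lemma near_int_inv : near_int l (d%:R^-1 : O).
Proof.
have [t et] := dvdnP d_l; exists (- t%:Z), (d%:R^-1).
have e : l%:R = 1 + t%:R * d%:R :> O.
  by rewrite -natrM -et -{1}(prednK l_gt0) -natr1 addrC.
by rewrite e mulrDr mulr1 mulrCA mulVr // mulr1 rmorphN addrCA addNr addr0.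
Qed.

Variables (s : nat -> O).
Hypothesis s_it : itinerary d s.
Notation VO := (point_series d s).

Lemma near_int_ev (Z : {poly {poly int}}) n : near_int l (coefs (ev VO (m2 intr Z)) n).
Proof.
apply: ev_closed.
- exact: near_int1.
- exact: near_intB.
- exact: near_intM.
apply: point_series_closed.
- exact: near_int1.
- exact: near_intB.
- exact: near_intM.
- exact: near_int_inv.
by move=> i; apply: near_int_root; apply: s_it.
Qed.

(** Integrality over Z[1/d]: the denominators of the coefficients of v_s are powers of d. *)
Definition dintegral (a : O) : Prop := exists e, integralOver (intr : int -> O) (d%:R ^+ e * a).

Lemma integralX (a : O) e : integralOver (intr : int -> O) a -> integralOver (intr : int ->
  O) (d%:R ^+ e * a).
Proof.
move=> ia; apply: integral_mul => //; rewrite -natrX; exact: integral_nat.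
Qed.

Lemma dintegral1 : dintegral 1.
Proof. by exists 0%N; rewrite expr0 mulr1; apply: integral1. Qed.
Lemma dintegralB a b : dintegral a -> dintegral b -> dintegral (a - b).
Proof.
move=> [e ia] [f ib]; exists (e + f)%N.
have -> : d%:R ^+ (e + f) * (a - b) = d%:R ^+ f * (d%:R ^+ e * a) - d%:R ^+ e * (d%:R ^+ f * b).
  by rewrite exprD; ring.
by apply: integral_sub; apply: integralX.
Qed.
Lemma dintegralM a b : dintegral a -> dintegral b -> dintegral (a * b).
Proof.
move=> [e ia] [f ib]; exists (e + f)%N.
have -> : d%:R ^+ (e + f) * (a * b) = (d%:R ^+ e * a) * (d%:R ^+ f * b).
  by rewrite exprD; ring.
exact: integral_mul.
Qed.

Lemma dintegral_ev (Z : {poly {poly int}}) n : dintegral (coefs (ev VO (m2 intr Z)) n).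
Proof.
apply: ev_closed.
- exact: dintegral1.
- exact: dintegralB.
- exact: dintegralM.
apply: point_series_closed.
- exact: dintegral1.
- exact: dintegralB.
- exact: dintegralM.
- by exists 1%N; rewrite expr1 divrr //; apply: integral1.
move=> i; exists 0%N; rewrite expr0 mul1r; exists ('X^d - 1).
  by rewrite monic_Xn_sub_1 // ltnW.
by rewrite rmorphB /= map_polyXn rmorph1 /root hornerD hornerN hornerXn hornerC s_it subrr.
Qed.

Lemma int_dvd (n : int) N c : n%:~R = c * l%:R ^+ N :> O -> exists n', n = n' * l%:Z ^+ N.
Proof.
have l0 : l%:R != 0 :> O by rewrite natO_neq0.
elim: N n => [|N IH] n; first by exists n; rewrite expr0 mulr1.
rewrite exprSr mulrA => e.
have [|n1 en1] := rho_int0 l_prime l_kap (O := O) (rho := rho) (n := n).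
  by rewrite e rmorphM rmorph_nat l_kap mulr0.
have [|n2 en2] := IH n1.
  by apply: (mulIf l0); rewrite -e en1 rmorphM.
by exists n2; rewrite en1 en2 exprSr mulrA.
Qed.

(** An element b that is algebraic over Z divides the constant term p_0 of any integral equation of
    it, and p_0 is nonzero in an equation of least degree. If l^N divides a, then it divides p_0 in
    O, hence in Z; with N = |p_0| this fails, since N < l^N. The valuation of O alone would not
    exclude a nonzero element divisible by all powers of l. *)
Lemma dintegral_bound a : a != 0 -> dintegral a -> exists N, forall c, a <> c * l%:R ^+ N.
Proof.
move=> a0 [e [p0 monp0 rp0]].
set b := d%:R ^+ e * a in rp0.
have b0 : b != 0.
  by rewrite mulf_neq0 // expf_neq0 //; apply: contraTneq dO => ->; rewrite unitr0.
have [|p [[pn0 rp] min_p]] := @ex_minimal _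
    (fun p : {poly int} => p != 0 /\ root (map_poly intr p) b) (fun p => size p).
  by exists p0; rewrite monic_neq0.
have c0 : p`_0 != 0.
  apply/eqP => e0; have : root p 0 by rewrite /root horner_coef0 e0.
  move=> /factor_theorem [p1]; rewrite subr0 => def_p.
  have p10 : p1 != 0 by apply: contraNneq pn0 => p10; rewrite def_p p10 mul0r.
  have : (size p <= size p1)%N.
    apply: min_p; split=> //; move: rp; rewrite def_p rmorphM /= map_polyX.
    by rewrite rootM [root 'X b]/root hornerX (negPf b0) orbF.
  by rewrite def_p size_mulX // ltnn.
have [g eg] : exists g, (p`_0)%:~R = b * g.
  have : map_poly intr p = map_poly intr (\poly_(i < (size p).-1) p`_i.+1) * 'X +
    (p`_0)%:~R%:P :> {poly O}.
    apply/polyP => i; rewrite coef_map coefD coefMX coefC coef_map coef_poly.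
    case: i => [|i] /=; first by rewrite add0r.
    rewrite addr0; case: ltnP => [//|le].
    by rewrite nth_default //; move: le; case: (size p).
  move=> e1; move: rp; rewrite /root e1 hornerD hornerM hornerX hornerC.
  set h := _.[b]; rewrite addrC addr_eq0 => /eqP ->.
  by exists (- h); rewrite mulrN mulrC.
pose N := `|(p`_0)%R|%N; exists N => c ec.
have : exists c', (p`_0)%:~R = c' * l%:R ^+ N :> O.
  by exists (d%:R ^+ e * c * g); rewrite eg /b ec; ring.
have : (0 < N)%N by rewrite absz_gt0.
have : (N < l ^ N)%N by apply: ltn_expl; apply: prime_gt1.
move=> ltN _ [c' /int_dvd [n' en']].
have eN : N = (`|n'| * l ^ N)%N by rewrite {1}/N en' abszM abszX.
have n'0 : (0 < `|n'|)%N.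
  by rewrite absz_gt0; apply: contraNneq c0 => e0; rewrite en' e0 mul0r.
by move: ltN; rewrite ltnNge {2}eN leq_pmull.
Qed.
End PlacePoints.

Lemma monic_small_multiple (R : comNzRingType) (F S r : {poly R}) :
  F \is monic -> S * F = r -> (size r < size F)%N -> r = 0.
Proof.
move=> mon <- lt; have [->|S0] := eqVneq S 0; first by rewrite mul0r.
move: lt; rewrite size_Mmonic //; have: (0 < size S)%N by rewrite size_poly_gt0.
by case: (size S) => // x _; rewrite ltnNge leq_addl.
Qed.

Lemma pigeonhole (T : finType) (f : nat -> T) : exists i j, (i < j)%N /\ f i = f j.
Proof.
apply: contrapT => h; have inj : injective (fun i : 'I_#|T|.+1 => f i).
  move=> i j e; apply: val_inj; case: (ltngtP i j) => // lt; case: h.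
    by exists i, j.
  by exists j, i.
by have := leq_card _ inj; rewrite card_ord ltnn.
Qed.

Lemma dep_scale (k : fieldType) (V : series k) x n a : a != 0 -> dep V x n ->
  dep V (const_Om k a * x) n.
Proof.
move=> a0 dx e; have [r [[i ri] eq0]] := dx e.
pose r' i := r i \Po (a^-1 *: 'X); exists r'; split.
  exists i; rewrite comp_poly2_eq0 //.
  by rewrite size_scale ?invr_eq0 // size_polyX.
rewrite -[RHS]eq0; apply: eq_bigr => j _; congr (_ * _).
rewrite /r' !pevalE map_comp_poly horner_comp; congr (_.[_]).
rewrite map_polyZ /= map_polyX hornerZ hornerX mulrA.
have e1 : const_Om k a^-1 * const_Om k a = 1 by rewrite -rmorphM mulVf // rmorph1.
exact: etrans (congr1 (fun y => y * x) e1) (mul1r x).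
Qed.

Definition homog_series (R : comNzRingType) N (r : {poly R}) (a b : series R) : series R :=
  \sum_(t < N) cst r`_t * a ^+ t * b ^+ (N - t).

Lemma homog_seriesE (R : comNzRingType) (K : fieldType) (f : {rmorphism R -> K})
    N (r : {poly R}) (a b : series R) :
  series_map f b != 0 -> (size r <= N)%N ->
  tofrac (series_map f (homog_series N r a b)) =
  tofrac (series_map f b) ^+ N *
    peval (tofrac (series_map f a) / tofrac (series_map f b)) (map_poly f r).
Proof.
move=> b0 szr.
have key (F : fieldType) (c x y : F) t : y != 0 -> (t <= N)%N ->
    c * x ^+ t * y ^+ (N - t) = y ^+ N * (c * (x / y) ^+ t).
  move=> y0 tN; rewrite expr_div_n -[in y ^+ N](subnK tN) exprD mulrC -!mulrA.
  congr (_ * _); rewrite mulrCA; congr (_ * _).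
  by rewrite mulrCA mulfV ?mulr1 // expf_neq0.
have szf : (size (map_poly f r) <= N)%N by apply: leq_trans (size_poly _ _) szr.
rewrite (peval_wide _ szf) mulr_sumr !rmorph_sum; apply: eq_bigr => t _.
rewrite !rmorphM !rmorphXn /= series_map_cst coef_map.
apply: key; last exact: ltnW.
by rewrite tofrac_eq0.
Qed.

(** * Reduction of functions on the curve *)

Section Reduction.
Variables (k kap : fieldType) (O : idomainType).
Variables (io : {rmorphism O -> k}) (rho : {rmorphism O -> kap}).
Hypothesis io_inj : injective io.
Hypothesis valuation : forall x : k, x != 0 -> exists a, io a = x \/ io a = x^-1.
Hypothesis rho_unit : forall a, rho a != 0 -> a \is a GRing.unit.
Hypothesis rho_surj : forall b, exists a, rho a = b.
Local Notation m2 f := (map_poly (map_poly f)).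
Variable l : nat.
Hypotheses (l_prime : prime l) (l_kap : l%:R = 0 :> kap).
Hypothesis natO_neq0 : forall n : nat, (0 < n)%N -> n%:R != 0 :> O.
Variable d : nat.
Hypotheses (d_gt1 : (1 < d)%N) (dO : d%:R \is a @GRing.unit O).
Hypothesis d_l : (d %| l.-1)%N.
Variables (s : nat -> O) (n0 m0 : nat).
Hypotheses (s_it : itinerary d s) (mn : (m0 < n0)%N) (s_per : preperiodic n0 m0 s).
Local Notation VO := (point_series d s).
Local Notation Vk := (series_map io VO).
Local Notation Vkap := (series_map rho VO).
Variables (Pk : {poly {poly k}}) (Pkap : {poly {poly kap}}).
Hypotheses (kerPk : kernel_generator Vk Pk) (kerPkap : kernel_generator Vkap Pkap).
Local Notation intO := (intr : int -> O).

Lemma ev_io u : ev Vk (m2 io u) = series_map io (ev VO u).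
Proof. by rewrite ev_map. Qed.
Lemma ev_rho u : ev Vkap (m2 rho u) = series_map rho (ev VO u).
Proof. by rewrite ev_map. Qed.
(** The monomials of degree less than that of Pk in v are independent at the point, so their
    coefficients have a nonzero minor det T. It is integral over Z[1/d], hence not divisible by some
    l^N. If l^N divided the value of u, then by Cramer's rule it would divide det T times each
    coefficient of u, and one of these is a unit. It matters that N does not depend on u. *)
Lemma minor_bound I J : (J < size Pk)%N -> exists N, forall u : {poly {poly O}},
  (size u <= J)%N -> (forall j, (size (u`_j)%R <= I)%N) -> m2 rho u != 0 ->
  ~ cdvd (l%:R ^+ N) (ev VO u).
Proof.
move=> ltJ; pose psi (ij : 'I_I * 'I_J) := ev VO (('X^(ij.1))%:P * 'X^(ij.2)).
have ind : series_independent psi.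
  move=> a e ij; pose u : {poly {poly O}} := \poly_(j < J) \poly_(i < I)
    (if insub i is Some i' then if insub j is Some j' then a (i', j') else 0 else 0).
  have coefu (ij' : 'I_I * 'I_J) : u`_(ij'.2)`_(ij'.1) = a ij'.
    by case: ij' => i j; rewrite coef_poly ltn_ord coef_poly ltn_ord !valK.
  have szu : (size u <= J)%N by apply: size_poly.
  have szuj j : (size (u`_j)%R <= I)%N.
    by rewrite coef_poly; case: ifP => _; rewrite ?size_poly0 // size_poly.
  have evu : ev VO u = 0.
    by rewrite (ev_wide _ szu szuj); under eq_bigr do rewrite coefu.
  have u0 : m2 io u = 0.
    apply: (kernel_generator_min kerPk); first by rewrite ev_io evu rmorph0.
    exact: leq_ltn_trans (leq_trans (size_poly _ _) szu) ltJ.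
  have {}u0 : u = 0 by apply: (m2_inj io_inj); rewrite u0 rmorph0.
  by rewrite -coefu u0 !coef0.
have [f detf] := nonzero_minor ind.
set T := \matrix_(i, j) _ in detf.
have dT : dintegral d (\det T).
  have D0 : dintegral d (0 : O).
    by rewrite -(subrr 1); apply: dintegralB => //; apply: dintegral1.
  have DN (a : O) : dintegral d a -> dintegral d (- a).
    by rewrite -sub0r; apply: dintegralB.
  have DD (a b : O) : dintegral d a -> dintegral d b -> dintegral d (a + b).
    by move=> Da Db; rewrite -[b]opprK; apply: dintegralB => //; apply: DN.
  rewrite /determinant; elim/big_ind: _ => // sg _; apply: dintegralM => //.
    rewrite -signr_odd; case: (odd _); rewrite ?expr1 ?expr0; [apply: DN|]; exact: dintegral1.
  elim/big_ind: _ => [||i _]; [exact: dintegral1 | by move=> a b; apply: dintegralM |].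
  rewrite mxE /psi -(map2_mono (intr : {rmorphism int -> O})).
  exact: dintegral_ev.
have [N NP] := dintegral_bound rho l_prime l_kap natO_neq0 dO detf dT.
exists N => u szu szuj u0 [v ev_u].
have [i1 [j1 nz]] : exists i j, rho u`_j`_i != 0.
  apply: contrapT => h; move/eqP: u0; apply; apply/polyP => j; apply/polyP => i.
  rewrite !coef_map !coef0 /=; apply/eqP/negPn/negP => nz; apply: h; by exists i, j.
have ltj : (j1 < J)%N.
  rewrite ltnNge; apply/negP => le; move: nz.
  by rewrite [u`_j1]nth_default ?coef0 ?rmorph0 ?eqxx // (leq_trans szu).
have lti : (i1 < I)%N.
  rewrite ltnNge; apply/negP => le; move: nz.
  by rewrite nth_default ?rmorph0 ?eqxx // (leq_trans (szuj j1)).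
pose ij (i : 'I_#|{: 'I_I * 'I_J}|) : 'I_I * 'I_J := enum_val i.
pose a : 'rV[O]_#|{: 'I_I * 'I_J}| := \row_i u`_((ij i).2)`_((ij i).1).
have aT : a *m T = l%:R ^+ N *: \row_j coefs v (f j).
  apply/rowP => j; rewrite !mxE -coefs_cstM -ev_u (ev_wide _ szu szuj) coefs_sum.
  rewrite [RHS](reindex (@enum_val _ predT)); last by apply/onW_bij/enum_val_bij.
  by apply: eq_bigr => i _; rewrite !mxE coefs_cstM.
pose i0 := enum_rank (Ordinal lti, Ordinal ltj).
have : a 0 i0 * \det T = l%:R ^+ N * ((\row_j coefs v (f j)) *m \adj T) 0 i0.
  have := congr1 (fun r : 'rV_#|{: 'I_I * 'I_J}| => (r *m \adj T) 0 i0) aT.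
  by rewrite -mulmxA mul_mx_adj -scalemxAl mul_mx_scalar !mxE mulrC.
rewrite mxE /ij enum_rankK /= => e; have U1 := rho_unit nz.
apply: (NP ((u`_j1`_i1)^-1 * ((\row_j coefs v (f j)) *m \adj T) 0 i0)).
by rewrite -[LHS](mulKr U1) e; ring.
Qed.

Variable U : seq kap.
Hypotheses (U_uniq : uniq U) (U_size : size U = d) (U_root : forall a, a \in U -> a ^+ d = 1).

Let VkapE : Vkap = point_series d (fun i => rho (s i)).
Proof. exact: point_series_map. Qed.
Let kap_it : itinerary d (fun i => rho (s i)).
Proof. by move=> i; rewrite -rmorphXn s_it rmorph1. Qed.
Let kap_per : preperiodic n0 m0 (fun i => rho (s i)).
Proof. by move=> i; rewrite s_per. Qed.
Let dkap : d%:R \is a @GRing.unit kap.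
Proof. by have := rmorph_unit rho dO; rewrite rmorph_nat. Qed.
Let kerPkap' : kernel_generator (point_series d (fun i => rho (s i))) Pkap.
Proof. by rewrite -VkapE. Qed.

(* The cofactor does not vanish at the point because the cycle polynomial has simple
   roots; its coefficients are fixed by the Frobenius, hence come from integers. *)
Lemma integral_cofactor : exists Z : {poly {poly int}},
  cycle_poly kap d n0 m0 = m2 intr Z * Pkap /\ ev Vkap (m2 intr Z) != 0.
Proof.
have [Q def_F] := cycle_poly_factor d_gt1 dkap kap_it mn kap_per kerPkap'.
have monP := kerPkap.1.
have fixk (a : kap) : a ^+ d = 1 -> a ^+ l = a by apply: frob_l_kap.
have lP : [pchar kap]%R.-nat l.
  rewrite pnatE //; exact: l_char.
have fixP := kernel_generator_frob dkap kap_it kerPkap' lP fixk.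
have fixQ : m2 (frob lP) Q = Q.
  apply: (mulIf (monic_neq0 monP)); rewrite -{1}fixP -map2M -def_F.
  by rewrite cycle_poly_map.
have [Z def_Q] : exists Z : {poly {poly int}}, m2 intr Z = Q.
  apply: (lift_poly2 (f := (intr : {rmorphism int -> kap}))) => i j.
  have [|m ->] := frob_fixed_nat (a := Q`_i`_j) l_prime l_kap; last by exists m%:Z.
  by rewrite -{2}fixQ !coef_map.
exists Z; rewrite def_Q; split=> //; apply/eqP => evQ.
have szS (p : {poly {poly kap}}) : size (map_poly (@poly_series kap) p) = size p.
  by rewrite size_map_inj_poly ?rmorph0 //; apply: poly_series_inj.
have [monF szF] := cycle_poly_monic_size kap d_gt1 mn.
have [un szr] := cycle_roots_uniq_size d_gt1 dkap U_uniq U_size U_root mn.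
have split := cycle_poly_split d_gt1 dkap U_uniq U_size U_root mn.
set rs := cycle_roots d U n0 m0 in un szr split.
have monQ : Q \is monic by move: monF; rewrite def_F monicMr.
pose toS := map_poly (@poly_series kap).
have evroot v (p : {poly {poly kap}}) : root (toS p) v = (ev v p == 0) by [].
have evP := kernel_generator_self kerPkap.
have count_rt (p : {poly {poly kap}}) : p \is monic ->
    (count (root (toS p)) rs < size p)%N.
  move=> mon; rewrite -szS -size_filter; apply: max_poly_roots.
  - by rewrite monic_neq0 // monic_map.
  - by apply/allP => v; rewrite mem_filter => /andP [].
  by rewrite filter_uniq.
have Vrs : Vkap \in rs.
  by rewrite -root_prod_XsubC -split evroot def_F rmorphM evQ mul0r.
have cnt := count_predUI (root (toS Pkap)) (root (toS Q)) rs.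
have cntU : count (predU (root (toS Pkap)) (root (toS Q))) rs = size rs.
  apply/eqP; rewrite -all_count; apply/allP => v vrs.
  have : root (toS (cycle_poly kap d n0 m0)) v by rewrite /toS split root_prod_XsubC.
  by rewrite evroot def_F rmorphM mulf_eq0 -!evroot orbC.
have cntI : (0 < count (predI (root (toS Pkap)) (root (toS Q))) rs)%N.
  by rewrite -has_count; apply/hasP; exists Vkap => //=; rewrite !evroot evQ evP eqxx.
have : size (Q * Pkap) = (size Q + size Pkap).-1 by rewrite size_Mmonic // monic_neq0.
move: cnt cntI (count_rt _ monP) (count_rt _ monQ).
rewrite -def_F szF cntU szr; clear; lia.
Qed.
Section Chain.
Variable Z : {poly {poly int}}.
Hypotheses (Z_factor : cycle_poly kap d n0 m0 = m2 intr Z * Pkap).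
Hypothesis (Z_neq0 : ev Vkap (m2 intr Z) != 0).
Local Notation ZO := (m2 intO Z).
Local Notation F R := (cycle_poly R d n0 m0).

Lemma rho_intr (W : {poly {poly int}}) : m2 rho (m2 intO W) = m2 intr W.
Proof.
apply/polyP => i; apply/polyP => j.
rewrite !coef_map; exact: rmorph_int.
Qed.

Lemma ev_ZO_neq0 j : series_map rho (ev VO ZO ^+ j) != 0.
Proof.
have <- : ev Vkap (m2 rho ZO) ^+ j = series_map rho (ev VO ZO ^+ j).
  by rewrite rmorphXn; congr (_ ^+ j); apply: ev_rho.
by rewrite rho_intr expf_neq0.
Qed.

Lemma near_int_ZO j n : near_int l (coefs (ev VO ZO ^+ j) n).
Proof.
have -> : ev VO ZO ^+ j = ev VO (m2 intO (Z ^+ j)).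
  rewrite -rmorphXn; congr (ev VO _); symmetry.
  exact: (rmorphXn (m2 (intr : {rmorphism int -> O}))).
by apply: (near_int_ev rho_unit l_prime l_kap d_gt1 dO d_l).
Qed.

Lemma evFO : ev VO (F O) = 0.
Proof. exact: ev_cycle_poly. Qed.

(** This is Z^j M modulo the monic cycle polynomial, computed over the integers. Extended linearly
    from monomials to u, it gives polynomials of bounded degree whose coefficients are combinations
    of those of u with integer multipliers, and the multipliers have finitely many residues modulo
    l^N. *)
Fixpoint cofactor_iter j (M : {poly {poly int}}) : {poly {poly int}} :=
  if j is j'.+1 then Pdiv.Ring.rmodp (Z * cofactor_iter j' M) (F int) else M.

Definition cofactor_sum I J (u : {poly {poly O}}) j : {poly {poly O}} :=
  \sum_(g : 'I_I * 'I_J) (u`_(g.2)`_(g.1))%:P%:P *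
    m2 intO (cofactor_iter j (('X^(g.1))%:P * 'X^(g.2))).

Lemma cofactor_sumS I J u j : exists S : {poly {poly O}},
  ZO * cofactor_sum I J u j = S * F O + cofactor_sum I J u j.+1 /\
  (size (cofactor_sum I J u j.+1) < size (F O))%N.
Proof.
have [monZ szZ] := cycle_poly_monic_size int d_gt1 mn.
have [monO szO] := cycle_poly_monic_size O d_gt1 mn.
exists (\sum_(g : 'I_I * 'I_J) (u`_(g.2)`_(g.1))%:P%:P *
  m2 intO (Pdiv.Ring.rdivp (Z * cofactor_iter j (('X^(g.1))%:P * 'X^(g.2))) (F int))); split.
  rewrite /cofactor_sum mulr_sumr mulr_suml -big_split; apply: eq_bigr => g _ /=.
  rewrite mulrCA -map2M {1}(Pdiv.RingMonic.rdivp_eq monZ (Z * _)).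
  by rewrite rmorphD /= map2M cycle_poly_map mulrDr mulrA.
rewrite szO ltnS; apply: leq_trans (size_sum _ _ _) _; apply/bigmax_leqP => g _.
rewrite mul_polyC; apply: leq_trans (size_scale_leq _ _) _.
apply: leq_trans (size_poly _ _) _; rewrite -ltnS -szZ.
by rewrite Pdiv.Ring.ltn_rmodp monic_neq0.
Qed.

Lemma ev_cofactor_sum I J (u : {poly {poly O}}) j : (size u <= J)%N -> (forall i, (size
  (u`_i)%R <= I)%N) ->
  ev VO (cofactor_sum I J u j) = ev VO ZO ^+ j * ev VO u.
Proof.
move=> szu szuj; elim: j => [|j IH].
  rewrite expr0 mul1r (ev_wide _ szu szuj) rmorph_sum; apply: eq_bigr => g _.
  rewrite rmorphM evC -[X in X = _]/(_ * _); congr (_ * _).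
  apply: congr1; exact: (map2_mono (intr : {rmorphism int -> O})).
have [S [e _]] := cofactor_sumS I J u j.
have := congr1 (ev VO) e; rewrite rmorphM rmorphD rmorphM evFO mulr0 add0r IH => <-.
by rewrite exprS mulrA.
Qed.

(* Multiplying by the cofactor and reducing, the content of u can only strictly
   increase in divisibility while the primitive part vanishes at the reduced point;
   it stays a nondivisor of l^N, and it takes finitely many values modulo l^N. *)
Lemma cofactor_chain (u : {poly {poly O}}) : (size u < size Pk)%N -> m2 rho u != 0 ->
  exists j nu y,
  [/\ ev VO ZO ^+ j * ev VO u = cst nu * ev VO y, ev Vkap (m2 rho y) != 0 &
      exists N c, nu * c = l%:R ^+ N].
Proof.
move=> szu u0.
pose I := \max_(i < size u) size (u`_i)%R.
have szuj j : (size (u`_j)%R <= I)%N.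
  have [lt|le] := ltnP j (size u); last by rewrite nth_default // size_poly0.
  exact: (leq_bigmax (Ordinal lt)).
have [N NP] := minor_bound I szu.
have {}NP := NP u (leqnn _) szuj u0.
pose v := cofactor_sum I (size u) u.
have ev_v j : ev VO (v j) = ev VO ZO ^+ j * ev VO u by apply: ev_cofactor_sum.
have evu0 : ev VO u != 0.
  apply/eqP => e; move/eqP: u0; apply.
  have -> : u = 0; last by rewrite rmorph0.
  apply: (m2_inj io_inj); rewrite rmorph0.
  apply: (kernel_generator_min kerPk); first by rewrite ev_io e rmorph0.
  by rewrite size_map_inj_poly ?rmorph0 //; apply: map_inj_poly; rewrite ?rmorph0.
have v0 j : v j != 0.
  apply/eqP => e; have /esym/eqP := ev_v j; rewrite e rmorph0 mulf_eq0 (negPf evu0) orbF.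
  by move=> /eqP e2; have := ev_ZO_neq0 j; rewrite e2 rmorph0 eqxx.
have /choice [ny nyP] j : exists ny : O * {poly {poly O}},
    [/\ ny.1 != 0, exists i i', ny.1 = (v j)`_i`_i', v j = ny.1%:P%:P * ny.2 & m2 rho ny.2 != 0].
  have [nu [y [a b c e _]]] := primitive_partO rho io_inj valuation (v0 j).
  by exists (nu, y).
(* If l^N divided the content of [v j], it would divide the value of ZO^j u. The factor ZO^j can be
   cancelled, as its value has a nonzero reduction and integers modulo l as coefficients; this
   contradicts the choice of N. *)
have nuN j c : (ny j).1 <> c * l%:R ^+ N.
  move=> e; apply: NP.
  apply: (cdvd_regular rho_unit l_prime l_kap natO_neq0 (pi := ev VO ZO ^+ j)).
  - exact: near_int_ZO.
  - exact: ev_ZO_neq0.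
  have [_ _ def_v _] := nyP j.
  rewrite -ev_v def_v rmorphM evC e; exists (cst c * ev VO (ny j).2).
  by rewrite rmorphM; ring.
have nu_dvd j : exists c, (ny j).1 * c = l%:R ^+ N.
  have [nz _ _ _] := nyP j.
  have [[c e]|[c e]] := dvd_total io_inj valuation (l%:R ^+ N) nz.
    by exists c; rewrite mulrC.
  by case: (nuN j c).
apply: contrapT => h.
have red0 j : ev Vkap (m2 rho (ny j).2) = 0.
  apply/eqP; apply: contrapT => /negP nz; apply: h.
  exists j, (ny j).1, (ny j).2; split=> //; last by exists N.
  by have [_ _ def_v _] := nyP j; rewrite -ev_v {1}def_v rmorphM evC.
(* The polynomial [v j.+1] is the content of [v j] times the remainder r of ZO y modulo the cycle
   polynomial, where y is the primitive part of [v j]. The reduction of y is a multiple of Pkap, so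
   that of ZO y is a multiple of the cycle polynomial, and r reduces to 0. *)
have step j : exists m, (ny j.+1).1 = (ny j).1 * m /\ rho m = 0.
  have [nz _ def_v _] := nyP j; have [_ [i [i' def_nu]] _ _] := nyP j.+1.
  have [S [eS szS]] := cofactor_sumS I (size u) u j.
  have [monO szO] := cycle_poly_monic_size O d_gt1 mn.
  have [monK szK] := cycle_poly_monic_size kap d_gt1 mn.
  have [T [r [eT szr]]] := monic_division monO (ZO * (ny j).2).
  have eq_v : v j.+1 = (ny j).1%:P%:P * r.
    apply/eqP; rewrite -subr_eq0; apply/eqP.
    apply: (monic_small_multiple monO (S := (ny j).1%:P%:P * T - S)).
      have e1 : v j.+1 = ZO * v j - S * F O by rewrite eS addrC addKr.
      have e2 : r = ZO * (ny j).2 - T * F O by rewrite eT addrC addKr.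
      by rewrite e1 e2 def_v; ring.
    apply: leq_ltn_trans (size_polyD _ _) _; rewrite gtn_max szS size_polyN.
    by rewrite mul_polyC (leq_ltn_trans (size_scale_leq _ _)).
  have rho_r : m2 rho r = 0.
    have [W eW] := (kerPkap.2 _).1 (red0 j).
    apply: (monic_small_multiple monK (S := W - m2 rho T)).
      have e2 : r = ZO * (ny j).2 - T * F O by rewrite eT addrC addKr.
      rewrite e2 rmorphB /= !map2M cycle_poly_map rho_intr eW Z_factor; ring.
    by rewrite szK -szO; apply: leq_ltn_trans (size_poly _ _) szr.
  exists r`_i`_i'; rewrite def_nu eq_v !coefCM; split=> //.
  by have := congr1 (fun p : {poly {poly kap}} => p`_i`_i') rho_r; rewrite !coef_map !coef0.
have descent i j : (i < j)%N -> exists m, (ny j).1 = (ny i).1 * m /\ rho m = 0.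
  elim: j => [//|j IH]; rewrite ltnS leq_eqVlt => /orP [/eqP <-|/IH [m [e _]]]; first exact: step.
  have [m' [e' m'0]] := step j; exists (m * m'); rewrite e' e mulrA; split=> //.
  by rewrite rmorphM m'0 mulr0.
have /choice [ii iiP] j : exists ii : nat * nat, (ny j).1 = (v j)`_ii.1`_ii.2.
  by have [_ [i [i' e]] _ _] := nyP j; exists (i, i').
pose z j (g : 'I_I * 'I_(size u)) : int :=
  (cofactor_iter j (('X^(g.1))%:P * 'X^(g.2)))`_(ii j).1`_(ii j).2.
have nuE j : (ny j).1 = \sum_(g : 'I_I * 'I_(size u)) u`_(g.2)`_(g.1) * (z j g)%:~R.
  rewrite iiP /v /cofactor_sum !coef_sum; apply: eq_bigr => g _.
  by rewrite !coefCM !coef_map.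
pose L := (l%:Z ^+ N)%R.
have L0 : L != 0 by rewrite expf_neq0 // eqz_nat -lt0n prime_gt0.
pose res j : {ffun 'I_I * 'I_(size u) -> 'I_(`|L|.-1.+1)%N} := [ffun g => inord `|(z j g %%
  L)%Z|%N].
have [i [j [ij e]]] := pigeonhole res.
have zL g : exists t, z i g - z j g = t * L.
  have := congr1 (fun f : {ffun _ -> _} => val (f g)) e; rewrite !ffunE.
  have bnd x : (`|(x %% L)%Z| < `|L|.-1.+1)%N.
    rewrite prednK ?absz_gt0 //.
    by move: (ltz_mod x L0) (modz_ge0 x L0); move: (x %% L)%Z => y; clear; lia.
  rewrite /= !inordK // => eabs.
  have eL : (z i g %% L)%Z = (z j g %% L)%Z.
    by move: (modz_ge0 (z i g) L0) (modz_ge0 (z j g) L0) eabs;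
      move: (_ %% L)%Z (_ %% L)%Z => y y'; clear; lia.
  have : (L %| z i g - z j g)%Z by rewrite -eqz_mod_dvd; apply/eqP.
  by move=> /dvdzP.
have /choice [t tP] := zL.
(* For i < j with congruent multipliers the contents nu_i and nu_j = nu_i m differ by a multiple of
   l^N. As 1 - m is a unit, l^N divides nu_i, which is excluded. *)
have [m [em m0']] := descent _ _ ij.
have U1 : 1 - m \is a GRing.unit.
  by apply: rho_unit; rewrite rmorphB rmorph1 m0' subr0 oner_eq0.
apply: (nuN i ((\sum_(g : 'I_I * 'I_(size u)) u`_(g.2)`_(g.1) * (t g)%:~R) * (1 - m)^-1)).
apply: (mulIr U1); rewrite mulrBr mulr1 -em !nuE -sumrB.
rewrite mulrAC mulrVK // mulr_suml; apply: eq_bigr => g _.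
rewrite -mulrBr -rmorphB tP rmorphM /L -mulrA; congr (_ * (_ * _)).
by rewrite rmorphXn.
Qed.
End Chain.
(** Up to a scalar, a nonzero value at the point is a series g over O with nonzero reduction. The
    series g need not come from a polynomial over O; a power of the cofactor times g does, which
    suffices to express the reduction of g by rational functions at the reduced point. *)
Lemma reduction Z (Z_factor : cycle_poly kap d n0 m0 = m2 intr Z * Pkap)
    (Z_neq0 : ev Vkap (m2 intr Z) != 0) u : ev Vk u != 0 ->
  exists (nu : k) j (u1 : {poly {poly O}}) (g : series O),
  [/\ nu != 0, ev Vk u = cst nu * series_map io g, 
      ev VO (m2 intr Z) ^+ j * g = ev VO u1 & ev Vkap (m2 rho u1) != 0].
Proof.
move=> evu; have [a [r [eu szr]]] := monic_division kerPk.1 u.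
have evr : ev Vk u = ev Vk r.
  by rewrite eu rmorphD rmorphM (kernel_generator_self kerPk) mulr0 add0r.
have r0 : r != 0 by apply: contraNneq evu => e; rewrite evr e rmorph0.
have [b [y [b0 _ def_r y0 szy]]] := primitive_part rho io_inj valuation r0.
have szy' : (size y < size Pk)%N := leq_ltn_trans (szy 0%N).2 szr.
have [j [nu [y' [e y'0 [N [c ec]]]]]] := cofactor_chain Z_factor Z_neq0 szy' y0.
have l0 : l%:R ^+ N != 0 :> O by rewrite expf_neq0 // natO_neq0 // prime_gt0.
have nu0 : nu != 0 by apply: contraNneq l0 => nu0; rewrite -ec nu0 mul0r.
have [g eg] : cdvd nu (ev VO y).
  apply: (cdvd_regular_dvd rho_unit l_prime l_kap natO_neq0 _ _ ec
    (pi := ev VO (m2 intr Z) ^+ j)).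
  - exact: near_int_ZO.
  - exact: ev_ZO_neq0.
  - by exists (ev VO y').
exists (b * io nu), j, y', g; split=> //.
- by rewrite mulf_neq0 // io_neq0.
- have e2 : series_map io (cst nu * g) = cst (io nu) * series_map io g.
    by rewrite rmorphM; congr (_ * _); apply: series_map_cst.
  by rewrite evr def_r rmorphM evC ev_io eg e2 mulrA rmorphM.
by apply: (mulfI (cst_neq0 nu0)); rewrite mulrCA -eg e.
Qed.

Local Notation fr := (@tofrac (series _)).

Lemma reduce_dep A B n : evO Vk B != 0 -> nonconstant (evO Vk A / evO Vk B) ->
  dep Vk (evO Vk A / evO Vk B) n ->
  exists A' B', [/\ evO Vkap B' != 0, nonconstant (evO Vkap A' / evO Vkap B') &
    dep Vkap (evO Vkap A' / evO Vkap B') n].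
Proof.
have [Z [Z_factor Z_neq0]] := integral_cofactor.
rewrite evO_eq0 => B0; set x := _ / _ => x_nc x_dep.
have [b [jB [B1 [gB [b0 evB eB B1_neq0]]]]] := reduction Z_factor Z_neq0 B0.
have rhoM u v : series_map rho (u * v) = series_map rho u * series_map rho v.
  exact: rmorphM.
have gB0 : series_map rho gB != 0.
  apply: contraNneq B1_neq0 => e; rewrite ev_rho -eB.
  by apply/eqP; apply: etrans (rhoM _ _) _; apply: etrans (congr1 (fun y => _ * y) e) (mulr0 _).
have [m gBm] : exists m, rho (coefs gB m) != 0.
  apply: contrapT => h; move/eqP: gB0; apply; apply: seriesP => m.
  by rewrite coefs_map coefs0; apply/eqP/negPn/negP => nz; apply: h; exists m.
have io_gBm : io (coefs gB m) != 0 by apply: (io_neq0 io_inj); apply: contraNneq gBm => ->;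
  rewrite rmorph0.
(* The index m is one at which the reduced denominator does not vanish, and a0 makes coefficient m
   of the numerator A - a0 B vanish. If the reduced quotient were a constant c, comparison at m
   would give c = 0, although the reduced numerator is nonzero. *)
pose a0 := coefs (ev Vk A) m / (b * io (coefs gB m)).
pose A2 := A - a0%:P%:P * B.
have evA2m : coefs (ev Vk A2) m = 0.
  rewrite /A2 rmorphB rmorphM evC coefsB coefs_cstM evB coefs_cstM coefs_map.
  by rewrite /a0 divfK ?subrr // mulf_neq0.
have xE : x - const_Om k a0 = evO Vk A2 / evO Vk B.
  rewrite /A2 (rmorphB (evO Vk)) (rmorphM (evO Vk)) mulrBl. rewrite evOc mulfK //.
  by rewrite evO_eq0.
have A20 : ev Vk A2 != 0.
  apply/eqP => e; have := x_nc a0; rewrite -subr_eq0 xE evOE e.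
  by rewrite tofrac0 mul0r eqxx.
have [a [jA [A3 [gA [a_neq0 evA eA A3_neq0]]]]] := reduction Z_factor Z_neq0 A20.
have gAm : coefs gA m = 0.
  move: evA2m; rewrite evA coefs_cstM coefs_map => /eqP; rewrite mulf_eq0 (negPf a_neq0) /=.
  by rewrite -(rmorph0 io) => /eqP /io_inj.
have gA0 : series_map rho gA != 0.
  apply: contraNneq A3_neq0 => e; rewrite ev_rho -eA.
  by apply/eqP; apply: etrans (rhoM _ _) _; apply: etrans (congr1 (fun y => _ * y) e) (mulr0 _).
pose x1 := tofrac (series_map io gA) / tofrac (series_map io gB).
pose y := tofrac (series_map rho gA) / tofrac (series_map rho gB).
have iogB0 : series_map io gB != 0.
  by apply: contraNneq B0 => e; rewrite evB; apply/eqP;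
    apply: etrans (congr1 (fun y => _ * y) e) (mulr0 _).
have x1_dep : dep Vk x1 n.
  have -> : x1 = const_Om k (b / a) * (x - const_Om k a0).
    have key (F : fieldType) (a' b' p q : F) : a' != 0 -> b' != 0 -> q != 0 ->
        p / q = b' / a' * (a' * p / (b' * q)).
      by move=> a1 b1 q1; field; rewrite a1 b1 q1.
    rewrite xE !evOE evA evB !(rmorphM (@tofrac (series k))) (rmorphM (const_Om k)) fmorphV.
    apply: key; last by rewrite tofrac_eq0.
      by rewrite (fmorph_eq0 (const_Om k)).
    by rewrite (fmorph_eq0 (const_Om k)).
  apply: dep_scale; first by rewrite mulf_neq0 ?invr_eq0.
  exact: dep_sub.
pose Zk : {poly {poly kap}} := m2 intr Z.
exists (m2 rho A3 * Zk ^+ jB), (m2 rho B1 * Zk ^+ jA).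
have fZ : tofrac (ev Vkap Zk) != 0 by rewrite tofrac_eq0.
have rhoZ j : series_map rho (ev VO (m2 intr Z) ^+ j) = ev Vkap Zk ^+ j.
  rewrite rmorphXn; congr (_ ^+ j); rewrite /Zk -rho_intr.
  by apply: esym; apply: ev_rho.
have eval C C' j j' g : ev VO (m2 intr Z) ^+ j * g = ev VO C' -> C = m2 rho C' * Zk ^+ j' ->
    evO Vkap C = tofrac (ev Vkap Zk) ^+ (j + j') * tofrac (series_map rho g).
  move=> e ->; rewrite evOE (rmorphM (ev Vkap)) ev_rho -e (rmorphXn (ev Vkap)).
  rewrite (rhoM (ev VO (m2 intr Z) ^+ j)) rhoZ mulrAC -exprD.
  by rewrite (rmorphM (@tofrac (series kap))) (rmorphXn (@tofrac (series kap))).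
have evA' := eval _ _ _ _ _ eA erefl; have {eval}evB' := eval _ _ _ _ _ eB erefl.
have def_y : evO Vkap (m2 rho A3 * Zk ^+ jB) / evO Vkap (m2 rho B1 * Zk ^+ jA) = y.
  rewrite evA' evB' addnC.
  have key (F : fieldType) (z p q : F) : z != 0 -> z * p / (z * q) = p / q.
    by move=> z0; rewrite invfM mulrACA mulfV // mul1r.
  by apply: key; rewrite expf_neq0.
have fB0 : tofrac (series_map rho gB) != 0 by rewrite tofrac_eq0.
rewrite def_y; split.
- by rewrite evB'; exact: mulf_neq0 (expf_neq0 _ fZ) fB0.
- move=> c; apply/eqP => ey.
  have e1 : series_map rho gA = cst c * series_map rho gB.
    apply/eqP; rewrite -tofrac_eq; apply/eqP.
    rewrite (rmorphM (@tofrac (series kap))) -[X in _ = X * _]/(const_Om kap c) -ey /y.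
    exact: esym (divfK fB0 _).
  have := congr1 (fun u => coefs u m) e1; rewrite coefs_map gAm rmorph0 coefs_cstM coefs_map.
  move/esym/eqP; rewrite mulf_eq0 (negPf gBm) orbF => /eqP c0.
  by move/eqP: gA0; apply; rewrite e1 c0 rmorph0 mul0r.
move=> e; have /choice [e' e'P] i : exists e', m2 rho e' = e i.
  by apply: lift_poly2 => a1 a2; apply: rho_surj.
have [r [[i0 ri0] eq0]] := x1_dep (fun i => m2 io (e' i)).
(* The coefficients of the relation are packed into one polynomial, so that a common scaling brings
   them into O without making all of them reduce to 0. *)
pose R : {poly {poly k}} := \poly_(i < n.+1) oapp r 0 (insub i).
have Ri (i : 'I_n.+1) : R`_i = r i by rewrite coef_poly ltn_ord valK.
have R0 : R != 0 by apply: contraNneq ri0 => e0; rewrite -Ri e0 coef0.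
have [c [Y [c0 _ def_R Y0 szY]]] := primitive_part rho io_inj valuation R0.
have eq1 : \sum_(i < n.+1) peval x1 (map_poly io Y`_i) * evO Vk (m2 io (e' i)) = 0.
  have cO : const_Om k c != 0 by rewrite (fmorph_eq0 (const_Om k)).
  apply: (mulfI cO); rewrite mulr0 mulr_sumr; apply: etrans eq0; apply: eq_bigr => i _.
  rewrite -Ri def_R coefCM coef_map mulrA; congr (_ * _).
  by rewrite !pevalE (rmorphM (map_poly (const_Om k))) hornerM /= map_polyC hornerC.
pose N := \max_(i < n.+1) size (Y`_i)%R.
have szN (i : 'I_n.+1) : (size (Y`_i)%R <= N)%N by apply: (leq_bigmax i).
(* The relation with denominators cleared: a series over O, which vanishes because its image over k
   does, so that its reduction vanishes too. *)
pose H := \sum_(i < n.+1) homog_series N Y`_i gA gB * ev VO (e' i).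
have HE (K : fieldType) (f : {rmorphism O -> K}) : series_map f gB != 0 ->
    tofrac (series_map f H) = tofrac (series_map f gB) ^+ N *
      \sum_(i < n.+1) peval (tofrac (series_map f gA) / tofrac (series_map f gB))
        (map_poly f Y`_i) * evO (series_map f VO) (m2 f (e' i)).
  move=> fgB; rewrite /H !rmorph_sum mulr_sumr; apply: eq_bigr => i _.
  apply: etrans (congr1 _ (rmorphM (series_map f) _ _)) _.
  rewrite (rmorphM (@tofrac (series K))) mulrA; congr (_ * _).
    exact: homog_seriesE.
  by rewrite evOE -ev_map.
have H0 : H = 0.
  apply: (series_map_inj io_inj); apply/eqP; rewrite -tofrac_eq; apply/eqP.
  rewrite HE // eq1 mulr0; symmetry; apply: etrans (congr1 _ (rmorph0 (series_map io))) _.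
  exact: tofrac0.
exists (fun i => map_poly rho Y`_i); split.
  have [i Yi] : exists i, map_poly rho Y`_i != 0.
    apply: contrapT => h; move/eqP: Y0; apply; apply/polyP => i.
    rewrite coef_map coef0; apply/eqP/negPn/negP => nz; apply: h; by exists i.
  have lti : (i < n.+1)%N.
    apply: leq_trans (leq_trans (szY 0%N).2 (size_poly _ _)).
    rewrite ltnNge; apply: contraNN Yi => le; rewrite nth_default //.
    by rewrite rmorph0.
  by exists (Ordinal lti).
apply: (mulfI (expf_neq0 N fB0)); rewrite mulr0.
transitivity (tofrac (series_map rho H)).
  rewrite (HE _ _ gB0); congr (_ * _); apply: eq_bigr => i _; by rewrite e'P.
rewrite H0; apply: etrans (congr1 _ (rmorph0 (series_map rho))) _; exact: tofrac0.
Qed.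
End Reduction.

(** * Existence of places *)

Lemma classical_idomain (R : comNzRingType) :
  (forall a b : R, a * b = 0 -> a = 0 \/ b = 0) ->
  exists (D : idomainType) (f : {rmorphism R -> D}) (g : {rmorphism D -> R}),
    cancel f g /\ cancel g f.
Proof.
move=> h.
pose D1 : comUnitRingType := HB.pack R (GRing.ComNzRing_hasMulInverse.Build R
  (@classical_mulVr R) (@classical_unitP R) (@classical_inv_out R)).
have h1 : GRing.integral_domain_axiom D1.
  by move=> a b /h [] ->; rewrite eqxx ?orbT.
pose D : idomainType := HB.pack D1 (GRing.ComUnitRing_isIntegral.Build D1 h1).
by exists D, (idfun : {rmorphism R -> R}), (idfun : {rmorphism R -> R}).
Qed.

Lemma classical_field (R : comNzRingType) :
  (forall a : R, a != 0 -> exists b, b * a = 1) ->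
  exists (F : fieldType) (f : {rmorphism R -> F}), bijective f.
Proof.
move=> h.
have mulVf (x : R) : x != 0 -> classical_inv x * x = 1.
  by move=> /h [y /classical_unitP]; apply: classical_mulVr.
have inv0 : classical_inv (0 : R) = 0.
  apply: classical_inv_out; rewrite !inE; apply/negP => /asboolP [y].
  by rewrite mulr0 => /eqP; rewrite eq_sym oner_eq0.
pose F : fieldType := HB.pack R (GRing.ComNzRing_isField.Build R mulVf inv0).
by exists F, (idfun : {rmorphism R -> R}); exists idfun.
Qed.

Section Subring.
Variables (R : comNzRingType) (S : subringClosed R).
Definition subring := {x : R | x \in S}.
HB.instance Definition _ := SubChoice.on subring.
HB.instance Definition _ := [SubChoice_isSubComNzRing of subring by <:].
End Subring.

Lemma subring_exists (R : comNzRingType) (A : R -> Prop) : A 1 ->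
  (forall a b, A a -> A b -> A (a - b)) -> (forall a b, A a -> A b -> A (a * b)) ->
  exists (O : comNzRingType) (io : {rmorphism O -> R}), injective io /\
    forall a, A a <-> exists b, io b = a.
Proof.
move=> A1 AB AM; pose P : {pred R} := fun x => `[< A x >].
have P_closed : subring_closed P.
  split; first by apply/asboolP.
    by move=> a b /asboolP Aa /asboolP Ab; apply/asboolP/AB.
  by move=> a b /asboolP Aa /asboolP Ab; apply/asboolP/AM.
pose S : subringClosed R := HB.pack (P : R -> bool) (GRing.isSubringClosed.Build R P P_closed).
exists (subring S), (val : {rmorphism subring S -> R}); split; first exact: val_inj.
move=> a; split=> [Aa|[b <-]]; last by apply/asboolP; apply: (valP b).
have Pa : a \in S by apply/asboolP.
by exists (exist _ a Pa).
Qed.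

Lemma quotient_exists (R : comNzRingType) (I : R -> Prop) : I 0 -> ~ I 1 ->
  (forall a b, I a -> I b -> I (a - b)) -> (forall a b, I b -> I (a * b)) ->
  exists (Q : comNzRingType) (f : {rmorphism R -> Q}),
    (forall b, exists a, f a = b) /\ forall a, f a = 0 <-> I a.
Proof.
move=> I0 I1 IB IM; pose P : {pred R} := fun x => `[< I x >].
have P_closed : idealr_closed P.
  split; first by apply/asboolP.
    by apply/negP => /asboolP.
  move=> a b c /asboolP Ib /asboolP Ic; apply/asboolP.
  by rewrite -[c]opprK; apply: (IB); [apply: IM | rewrite -sub0r; apply: (IB)].
pose S : idealr R := HB.pack (P : R -> bool) (isIdealr.Build R P P_closed).
pose Q := {ideal_quot S}.
have piE a : (\pi_Q a == 0) = (a \in S).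
  by rewrite -(rmorph0 (\pi_Q)) -[in RHS](subr0 a) Quotient.idealrBE.
exists Q, (\pi_Q : {rmorphism R -> Q}); split=> [b|a]; first by exists (repr b); rewrite /= reprK.
split=> [/eqP|Ia]; first by rewrite piE => /asboolP.
by apply/eqP; rewrite piE; apply/asboolP.
Qed.

Section ValuationRing.
Variables (k : fieldType) (l : nat).
Hypotheses (l_prime : prime l) (char0 : forall n : nat, (0 < n)%N -> n%:R != 0 :> k).
Local Notation lk := (l%:R : k).

Let l0 : lk != 0. Proof. by rewrite char0 // prime_gt0. Qed.

(* Besides the subrings of k which do not contain 1/l, the empty set is admitted, as
   the union of an empty chain. *)
Let avoids (A : set k) : Prop :=
  [/\ forall a b, A a -> A b -> A (a - b), forall a b, A a -> A b -> A (a * b),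
      forall a, A a -> A 1 & ~ A lk^-1].

(** For a subring S maximal among those without 1/l, the ring S[x] contains 1/l as soon as x is not
    in S. *)
Lemma maximal_subring : exists S : subringClosed k, lk^-1 \notin S /\
  forall x, x \notin S -> exists2 p, p \is a polyOver S & p.[x] = lk^-1.
Proof.
have [|A [[AB AM A1 Al] maxA]] := @Zorn_bigcup k avoids.
  move=> F FP tot.
  have both a b : (\bigcup_(X in F) X)%classic a -> (\bigcup_(X in F) X)%classic b ->
      exists X, [/\ F X, X a & X b].
    move=> [X FX Xa] [Y FY Yb]; have [XY|YX] := tot X Y FX FY.
      by exists Y; split=> //; apply: XY.
    by exists X; split=> //; apply: YX.
  split.
  - move=> a b Ua Ub; have [X [FX Xa Xb]] := both a b Ua Ub.
    by exists X => //; have [h _ _ _] := FP X FX; apply: h.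
  - move=> a b Ua Ub; have [X [FX Xa Xb]] := both a b Ua Ub.
    by exists X => //; have [_ h _ _] := FP X FX; apply: h.
  - move=> a [X FX Xa]; exists X => //; have [_ _ h _] := FP X FX; exact: h Xa.
  by move=> [X FX Xl]; have [_ _ _ h] := FP X FX; apply: h.
have {}A1 : A 1.
  apply: contrapT => nA1.
  have A0 a : ~ A a by move=> /A1.
  (* A maximal set is not empty, as the image of the integers is admissible and larger than the
     empty set. *)
  apply: (maxA (range (intr : int -> k))).
    split; first by move=> a /A0.
    by move=> h; apply: (A0 1); apply: h; exists 1.
  split.
  - by move=> _ _ [a _ <-] [b _ <-]; exists (a - b) => //; rewrite rmorphB.
  - by move=> _ _ [a _ <-] [b _ <-]; exists (a * b) => //; rewrite rmorphM.
  - by move=> _ _; exists 1.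
  move=> [z _ ez]; have e1 : (z * l%:Z - 1)%:~R = 0 :> k.
    rewrite rmorphB rmorphM [X in X * _ - _]ez.
    by apply/eqP; rewrite subr_eq0; apply/eqP; apply: mulVf.
  have z0 : z * l%:Z - 1 != 0.
    rewrite subr_eq0; apply/eqP => /(congr1 absz) /eqP;
      rewrite abszM muln_eq1 => /andP [_ /eqP el].
    by have := prime_gt1 l_prime; rewrite -[l]/(absz l) el.
  move: e1 z0; case: (z * _ - 1) => n; first by rewrite eqz_nat -lt0n => e /char0;
    rewrite -[n%:R]/(n%:~R) e eqxx.
  rewrite NegzE rmorphN => /eqP; rewrite oppr_eq0 => /eqP e _.
  by have := char0 (ltn0Sn n); rewrite -[n.+1%:R]/(n.+1%:~R) e eqxx.
pose P : {pred k} := fun x => `[< A x >].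
have P_closed : subring_closed P.
  split; first by apply/asboolP.
    by move=> a b /asboolP Aa /asboolP Ab; apply/asboolP/AB.
  by move=> a b /asboolP Aa /asboolP Ab; apply/asboolP/AM.
pose S : subringClosed k := HB.pack (P : k -> bool) (GRing.isSubringClosed.Build k P P_closed).
exists S; split; first by apply/asboolPn.
move=> x /asboolPn Ax; apply: contrapT => h.
pose B : set k := fun y => exists2 p, p \is a polyOver S & y = p.[x].
apply: (maxA B).
  split.
    move=> a Aa; exists a%:P; rewrite ?hornerC // polyOverC; exact/asboolP.
  move=> h'; apply: Ax; apply: h'; exists 'X; rewrite ?hornerX //.
  exact: polyOverX.
split.
- by move=> _ _ [p pS ->] [q qS ->]; exists (p - q); rewrite ?rpredB // hornerD hornerN.
- by move=> _ _ [p pS ->] [q qS ->]; exists (p * q); rewrite ?rpredM // hornerM.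
- by move=> _ _; exists 1; rewrite ?rpred1 // hornerC.
by move=> [p pS e]; apply: h; exists p.
Qed.

Section Maximal.
Variable S : subringClosed k.
Hypotheses (lS : lk^-1 \notin S)
  (S_max : forall x, x \notin S -> exists2 p, p \is a polyOver S & p.[x] = lk^-1).

(** Let u = 1 - l a. If 1/u were not in S, then 1/l = p(1/u) for some p over S, so that u^N / l is
    in S for N large. As u^N = 1 - l a' with a' in S, it would follow that 1/l = u^N / l + a' is in
    S. *)
Lemma one_sub_unit a : a \in S -> exists2 v, v \in S & v * (1 - lk * a) = 1.
Proof.
move=> aS; set u := 1 - _.
have lS' : lk \in S by apply: rpred_nat.
have uS : u \in S by rewrite rpredB ?rpred1 ?rpredM.
have u0 : u != 0.
  apply: contraNneq lS => /eqP; rewrite subr_eq0 => /eqP e.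
  by rewrite (_ : lk^-1 = a) //; apply: (mulfI l0); rewrite mulfV.
exists u^-1; last by rewrite mulVf.
apply: contraT => /S_max [p pS ep].
have uN N : exists2 a', a' \in S & u ^+ N = 1 - lk * a'.
  elim: N => [|N [a' a'S e]]; first by exists 0; rewrite ?rpred0 // mulr0 subr0 expr0.
  exists (a + a' - lk * a * a'); first by rewrite rpredB ?rpredD ?rpredM.
  by rewrite exprS e /u; ring.
have [a' a'S eN] := uN (size p).
have uNp : u ^+ (size p) * p.[u^-1] \in S.
  rewrite horner_coef mulr_sumr rpred_sum // => i _.
  rewrite mulrCA exprVn -[in u ^+ size p](subnK (ltnW (ltn_ord i))) exprD mulfK ?expf_neq0 //.
  by rewrite rpredM ?rpredX //; apply: (polyOverP pS).
apply: contraNT lS => _.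
rewrite (_ : lk^-1 = u ^+ size p * p.[u^-1] + a') ?rpredD //.
apply: (mulfI l0); rewrite ep mulrDr mulrCA mulfV // mulr1 eN.
by rewrite subrK.
Qed.

Let D x n := exists p, [/\ p \is a polyOver S, (size p <= n.+1)%N & lk * p.[x] = 1].

(** The relation 1 = l q(1/x) has the constant part l q_0, and 1 - l q_0 is a unit of S. Solving for
    1 and multiplying by x^n writes x^n as l times a polynomial in x of smaller degree; it replaces
    the top term of p. *)
Lemma degree_descent x n m : x != 0 -> (m <= n)%N -> D x n -> D x^-1 m ->
  (0 < n)%N /\ D x n.-1.
Proof.
move=> x0 mn [p [pS szp ep]] [q [qS szq eq]].
have lS' : lk \in S by apply: rpred_nat.
have D0 y : ~ D y 0.
  move=> [r [rS szr er]]; move/negP: lS; apply.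
  have -> : lk^-1 = r.[y] by apply: (mulfI l0); rewrite er mulfV.
  by rewrite (size1_polyC szr) hornerC; apply: (polyOverP rS).
have m0 : (0 < m)%N by rewrite lt0n; apply/eqP => e; apply: (D0 x^-1); rewrite -e; exists q.
have n0 : (0 < n)%N := leq_trans m0 mn.
split=> //.
have [v vS ev] := one_sub_unit (polyOverP qS 0%N).
pose r := v *: ('X^(n - m) * \poly_(i < m) q`_(m - i)).
have szr : (size r <= n)%N.
  apply: leq_trans (size_scale_leq _ _) _; rewrite mulrC.
  have [->|q0] := eqVneq (\poly_(i < m) q`_(m - i)) 0; first by rewrite mul0r size_poly0.
  rewrite size_mulXn //; have := size_poly m (fun i => q`_(m - i)); lia.
have rS : r \is a polyOver S.
  apply: polyOverZ => //; apply: rpredM; first by apply: rpredX; apply: polyOverX.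
  apply: polyOver_poly => i _; exact: (polyOverP qS).
have er : x ^+ n = lk * r.[x].
  have e1 : \sum_(i < m) q`_i.+1 * x^-1 ^+ i.+1 * lk = 1 - lk * q`_0.
    rewrite -[X in X - _]eq (horner_coef_wide _ szq) big_ord_recl expr0 mulr1 mulrDr addrAC
      subrr add0r.
    by rewrite -mulr_suml mulrC; congr (_ * _).
  have e2 : \sum_(i < m) q`_(m - i) * x ^+ i = x ^+ m * \sum_(i < m) q`_i.+1 * x^-1 ^+ i.+1.
    rewrite (reindex_inj rev_ord_inj) mulr_sumr; apply: eq_bigr => i _ /=.
    rewrite subKn // mulrCA exprVn; congr (_ * _).
    by rewrite -[in x ^+ m](subnK (ltn_ord i)) exprD mulfK // expf_neq0.
  rewrite /r hornerZ hornerM hornerXn horner_poly e2.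
  rewrite (_ : lk * _ = x ^+ (n - m) * x ^+ m * (v * \sum_(i < m) q`_i.+1 * x^-1 ^+ i.+1 * lk)).
    by rewrite e1 ev mulr1 -exprD subnK.
  by rewrite -mulr_suml; ring.
exists (\poly_(i < n) p`_i + (lk * p`_n) *: r); split.
- apply: rpredD; first by apply: polyOver_poly => i _; apply: (polyOverP pS).
  by apply: polyOverZ => //; rewrite rpredM //; apply: (polyOverP pS).
- rewrite prednK // (leq_trans (size_polyD _ _)) // geq_max size_poly.
  exact: leq_trans (size_scale_leq _ _) szr.
rewrite hornerD hornerZ horner_poly -[RHS]ep (horner_coef_wide _ szp) big_ord_recr /=.
by rewrite er; ring.
Qed.

(** If both were outside S, there would be relations for x and for 1/x, and the larger of the two
    degrees could be lowered for ever. *)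
Lemma maximal_valuation x : x != 0 -> x \in S \/ x^-1 \in S.
Proof.
move=> x0; apply: contrapT => /not_orP [/negP xS /negP xVS].
have DE y : y \notin S -> exists n, D y n.
  move=> /S_max [p pS e]; exists (size p), p; split=> //.
  by rewrite e mulfV.
have [n Dn] := DE _ xS; have [m Dm] := DE _ xVS.
have [N] := ubnP (n + m).
elim: N x n m x0 {xS xVS} Dn Dm => [//|N IH] x n m x0 Dn Dm lt.
have [mn|/ltnW nm] := leqP m n.
  have [n0 Dn'] := degree_descent x0 mn Dn Dm.
  by apply: (IH x n.-1 m) => //; lia.
have Vx0 : x^-1 != 0 by rewrite invr_eq0.
have [|m0 Dm'] := degree_descent Vx0 nm Dm; first by rewrite invrK.
by apply: (IH x n m.-1) => //; lia.
Qed.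
End Maximal.

(** The residue field is the quotient by the nonunits, which form an ideal because of two elements
    one divides the other. It kills l, since 1/l is not in the maximal subring. *)
Lemma place_exists : exists (O : idomainType) (kap : fieldType)
    (io : {rmorphism O -> k}) (rho : {rmorphism O -> kap}),
  [/\ injective io, forall x, x != 0 -> exists a, io a = x \/ io a = x^-1,
      forall a, rho a != 0 -> a \is a GRing.unit, forall b, exists a, rho a = b &
      l%:R = 0 :> kap].
Proof.
have [S [lS S_max]] := maximal_subring.
have val_S := maximal_valuation lS S_max.
have [|a b|a b|R [j [j_inj jP]]] := @subring_exists k (fun x => x \in S).
- exact: rpred1.
- exact: rpredB.
- exact: rpredM.
have [|O [f [g [fK gK]]]] := @classical_idomain R.
  move=> a b /(congr1 j); rewrite rmorphM rmorph0 => /eqP; rewrite mulf_eq0 => /orP [] /eqP e;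
    [left|right]; by apply: j_inj; rewrite rmorph0.
pose io : {rmorphism O -> k} := (j \o g)%FUN.
have io_inj : injective io by apply: inj_comp => //; apply: can_inj gK.
have ioP x : x \in S -> exists a, io a = x.
  by move=> /jP [b <-]; exists (f b); rewrite /io /= fK.
have valuation x : x != 0 -> exists a, io a = x \/ io a = x^-1.
  by move=> /val_S [] /ioP [a e]; exists a; [left|right].
have nonunitB (a b : O) : a \isn't a GRing.unit -> b \isn't a GRing.unit -> a - b \isn't a
  GRing.unit.
  move=> aU bU; have [->|b0] := eqVneq b 0; first by rewrite subr0.
  have [[c ->]|[c ->]] := dvd_total io_inj valuation a b0.
    by rewrite -{2}[b]mul1r -mulrBl unitrM negb_and bU orbT.
  by rewrite -{1}[a]mul1r -mulrBl unitrM negb_and aU orbT.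
have [||a b|a b|Q [q [q_surj qP]]] := @quotient_exists O (fun a => a \isn't a GRing.unit).
- by rewrite unitr0.
- by rewrite unitr1.
- exact: nonunitB.
- by move=> bU; rewrite unitrM negb_and bU orbT.
have [|kap [F [F' F_K F'_K]]] := @classical_field Q.
  move=> b; have [a <-] := q_surj b => qa0.
  have aU : a \is a GRing.unit by apply: contraNT qa0 => /qP ->.
  by exists (q a^-1); rewrite -rmorphM mulVr ?rmorph1.
have F_eq0 b : F b = 0 <-> b = 0.
  by split=> [e|->]; [apply: (can_inj F_K); rewrite e rmorph0 | rewrite rmorph0].
exists O, kap, io, (F \o q)%FUN; split=> //=.
- by move=> a; apply: contraNT => /qP ->; rewrite rmorph0.
- by move=> b; have [a ea] := q_surj (F' b); exists a; rewrite ea F'_K.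
rewrite -(rmorph_nat F); apply/F_eq0; rewrite -(rmorph_nat q); apply/qP; apply: contraNN lS => lU.
by apply/jP; exists (g (l%:R^-1)); rewrite -[LHS]/(io _) rmorphV // rmorph_nat.
Qed.
End ValuationRing.

(** Take a prime divisor l of Phi_d(x) for a multiple x of d. In F_l the class a of x satisfies a^d
    = 1, hence a and d are nonzero there. If the order of a were a proper divisor of d, then a would
    be a root of another Phi_m with m | d as well, hence a double root of X^d - 1, which is
    separable modulo l. So d is the order of a and divides l - 1. *)
Lemma prime_congruent_1 d : (1 < d)%N -> exists2 l, prime l & (d %| l.-1)%N.
Proof.
move=> d_gt1; have d0 : (0 < d)%N := ltnW d_gt1.
(* Outside the roots of P the value of Phi_d is neither 0 nor a unit of Z, so it has a prime
   divisor. *)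
pose P := 'Phi_d * ('Phi_d - 1) * ('Phi_d + 1).
have szPhi : (1 < size 'Phi_d)%N by rewrite size_Cyclotomic ltnS totient_gt0.
have sz1 (e : int) : (size e%:P < size 'Phi_d)%N := leq_ltn_trans (size_polyC_leq1 e) szPhi.
have P0 : P != 0.
  rewrite !mulf_neq0 // -?size_poly_gt0 ?(ltnW szPhi) //.
    by rewrite -polyC1 size_polyDl ?size_polyN ?sz1 // ltnW.
  by rewrite -polyC1 size_polyDl ?sz1 // ltnW.
pose xs := [seq (d * i)%N%:Z | i <- iota 0 (size P)].
have [/allP h|/allPn [x /mapP [i _ ex] rx]] := boolP (all (root P) xs).
  have : (size xs < size P)%N.
    apply: max_poly_roots => //; first exact/allP.
    rewrite map_inj_uniq ?iota_uniq // => i j [] /eqP.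
    by rewrite eqn_pmul2l // => /eqP.
  by rewrite size_map size_iota ltnn.
set v := ('Phi_d).[x].
have v1 : (`|v|%N != 1)%N.
  apply: contraNneq rx => e; rewrite /root /P !hornerM hornerD hornerN !hornerD !hornerC -/v.
  move: e; case: (v) => n; rewrite ?NegzE /= => en; rewrite !mulf_eq0.
    by rewrite (_ : n = 1%N) // subrr eqxx orbT.
  by rewrite (_ : n = 0%N) ?addNr ?eqxx ?orbT //; case: en.
have [l l_prime l_v] : exists2 l, prime l & (l %| `|v|)%N.
  have [v0|v0] := eqVneq `|v|%N 0%N; first by exists 2%N; rewrite // v0.
  exists (pdiv `|v|); rewrite ?pdiv_dvd // pdiv_prime //.
  by move: v0 v1; case: `|v|%N => [|[|]].
exists l => //.
pose toF := (intr : {rmorphism int -> 'F_l}); pose a := toF x.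
pose PhiF n := map_poly toF 'Phi_n.
have chl := pchar_Fp l_prime.
have Phia : (PhiF d).[a] = 0.
  rewrite /PhiF /a horner_map -/v /toF /=.
  have [c ->] : exists c, v = c * l%:Z.
    by have /dvdnP [c ec] := l_v; exists (sgz v * c%:Z); rewrite -mulrA -PoszM -ec; apply: intEsg.
  by rewrite rmorphM /= -[l%:~R]/(l%:R) pchar_Fp_0 ?mulr0.
have prodF n : (0 < n)%N -> \prod_(m <- divisors n) PhiF m = 'X^n - 1.
  move=> n0; rewrite -rmorph_prod prod_Cyclotomic // rmorphB rmorph1 /=.
  by rewrite map_polyXn.
have divF m : (m %| d)%N -> (PhiF m).[a] = 0 -> exists Q, 'X^m - 1 = PhiF m * Q.
  move=> md _; have m0 : (0 < m)%N by apply: dvdn_gt0 md.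
  exists (\prod_(j <- divisors m | j != m) PhiF j); rewrite -prodF //.
  by rewrite (bigD1_seq m) ?divisors_uniq //= -dvdn_divisors.
have ad : a ^+ d = 1.
  have [Q /(congr1 (fun p : {poly 'F_l} => p.[a]))] := divF d (dvdnn d) Phia.
  by rewrite hornerM Phia mul0r hornerD hornerN hornerXn hornerC => /eqP;
    rewrite subr_eq0 => /eqP.
have a0 : a != 0.
  by apply/eqP => a0; move: ad; rewrite a0 expr0n gtn_eqF // => /eqP; rewrite eq_sym oner_eq0.
have dl : d%:R != 0 :> 'F_l.
  apply: contraNneq a0 => d_l0; rewrite /a /toF ex /= -[X in X == _]/((d * i)%:R).
  by rewrite natrM d_l0 mul0r.
have [e e_prim e_d] := prim_order_exists d0 ad.
have [ed|ned] := eqVneq e d.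
  rewrite ed in e_prim; rewrite (prim_order_dvd e_prim).
  have : a ^+ l = a by rewrite -[RHS]expf_card card_Fp.
  have -> : a ^+ l = a * a ^+ l.-1 by rewrite -exprS prednK // prime_gt0.
  by rewrite -[RHS]mulr1 => /(mulfI a0) ->; rewrite eqxx.
exfalso.
have e0 : (0 < e)%N := dvdn_gt0 d0 e_d.
have [m me Phim] : exists2 m, (m %| e)%N & (PhiF m).[a] = 0.
  have : (\prod_(m <- divisors e) PhiF m).[a] = 0.
    by rewrite prodF // hornerD hornerN hornerXn hornerC (prim_expr_order e_prim) subrr.
  rewrite horner_prod => /eqP; rewrite prodf_seq_eq0 => /hasP [m];
    rewrite -dvdn_divisors // => me /eqP.
  by exists m.
have md : m != d.
  apply: contraNneq ned => emd; rewrite eqn_dvd e_d /= -emd.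
  exact: me.
have [Q fac] : exists Q, 'X^d - 1 = PhiF d * (PhiF m * Q).
  eexists; rewrite -prodF // (bigD1_seq d) ?divisors_uniq -?dvdn_divisors //=; congr (_ * _).
  rewrite -big_filter (bigD1_seq m) ?filter_uniq ?divisors_uniq //=.
  by rewrite mem_filter md -dvdn_divisors //; apply: dvdn_trans me e_d.
have := congr1 (fun p : {poly 'F_l} => (p^`()).[a]) fac.
rewrite !derivM derivB derivXn derivC subr0 !hornerD !hornerM Phia Phim.
rewrite !mul0r !mulr0 addr0 hornerMn hornerXn -mulr_natl => /eqP.
by rewrite mulf_eq0 (negPf dl) /= expf_eq0 (negPf a0) andbF.
Qed.

(** * Maps to the projective line *)

Section MapToP1.
Variables (k : fieldType) (d : nat).
Hypotheses (d_gt1 : (1 < d)%N) (dU : d%:R \is a @GRing.unit k).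
Variables (s : nat -> k) (p : {poly {poly k}}).
Hypotheses (s_it : itinerary d s) (irr : irreducible_elt p) (ps : phi d s p = 0).
Local Notation V := (point_series d s).
Local Notation Om := {fraction series k}.
Local Notation fr := (@tofrac (series k)).
Local Notation w := (fr (wvar k)).
Local Notation c := (cval k d).
Let d_gt0 : (0 < d)%N := ltnW d_gt1.

Lemma phic a : phi d s a%:P%:P = const_Om k a. Proof. exact: eval2c. Qed.
Lemma phiC : phi d s ('X)%:P = c. Proof. exact: eval2C. Qed.
Lemma phiZ : phi d s 'X = zval d s. Proof. exact: eval2Z. Qed.
Lemma evO_w : evO V ('X)%:P = w.
Proof. by rewrite evOE evC. Qed.
Lemma evO_v : evO V 'X = w * phi d s 'X.
Proof.
rewrite evOE evX phiZ /zval mulrC divfK //; exact: w_neq0.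
Qed.
Lemma cval_w : c * w ^+ d = -1.
Proof. by rewrite /cval mulNr mulVf // expf_neq0 // w_neq0. Qed.
Lemma cval_neq0 : c != 0.
Proof. by rewrite /cval oppr_eq0 invr_eq0 expf_neq0 // w_neq0. Qed.

Lemma lineval_phi x r : lineval (phi d s) x r = peval x r.
Proof. by rewrite peval_coef; apply: eq_bigr => i _; rewrite phic. Qed.

Lemma phi_evO a : exists N A, w ^+ N * phi d s a = evO V A.
Proof.
elim/poly2_ind: a => [a|||a b [N [A eA]] [M [B eB]]|a b [N [A eA]] [M [B eB]]].
- by exists 0%N, a%:P%:P; rewrite expr0 mul1r phic evOc.
- by exists d, (-1); rewrite phiC mulrC cval_w rmorphN1.
- by exists 1%N, 'X; rewrite evO_v.
- exists (N + M)%N, (('X)%:P ^+ M * A + ('X)%:P ^+ N * B).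
  rewrite (rmorphD (evO V)) !(rmorphM (evO V)) !(rmorphXn (evO V)) evO_w -eA -eB.
  rewrite (rmorphD (phi d s)) mulrDr exprD !mulrA; congr (_ * _ + _).
  exact: mulrC.
exists (N + M)%N, (A * B); rewrite (rmorphM (evO V)) (rmorphM (phi d s)) -eA -eB exprD.
exact: mulrACA.
Qed.

(* As w^d = -1/c, the powers w^r with r < d span k(w, V) over the function field. *)
Let decomposed y := exists N (E : 'I_d -> {poly {poly k}}),
  c ^+ N * y = \sum_(r < d) w ^+ r * phi d s (E r).

Let decomposedX y N E M : c ^+ N * y = \sum_(r < d) w ^+ r * phi d s (E r) ->
  exists E', c ^+ (M + N) * y = \sum_(r < d) w ^+ r * phi d s (E' r).
Proof.
move=> e; exists (fun r => ('X)%:P ^+ M * E r).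
rewrite exprD -mulrA e mulr_sumr; apply: eq_bigr => r _.
by rewrite (rmorphM (phi d s)) (rmorphXn (phi d s)) phiC mulrCA.
Qed.

Lemma decompose_family (I : finType) (e : I -> {poly {poly k}}) :
  exists N (E : I -> 'I_d -> {poly {poly k}}),
    forall i, c ^+ N * evO V (e i) = \sum_(r < d) w ^+ r * phi d s (E i r).
Proof.
have decD y z : decomposed y -> decomposed z -> decomposed (y + z).
  move=> [N [E e1]] [M [F e2]].
  have [E' e1'] := decomposedX M e1; have [F' e2'] := decomposedX N e2.
  exists (M + N)%N, (fun r => E' r + F' r).
  rewrite mulrDr e1' addnC e2' -big_split; apply: eq_bigr => r _.
  by rewrite (rmorphD (phi d s)) mulrDr.
have dec_mono m F : decomposed (w ^+ m * phi d s F).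
  have lt : (m %% d < d)%N by rewrite ltn_mod.
  pose E r := if r == Ordinal lt then (-1) ^+ (m %/ d) * F else 0; exists (m %/ d)%N, E.
  have E1 : E (Ordinal lt) = (-1) ^+ (m %/ d) * F by rewrite /E eqxx.
  rewrite (bigD1 (Ordinal lt) isT) big1 => [|r /negPf ne]; last first.
    by rewrite /E ne (rmorph0 (phi d s)) mulr0.
  rewrite [RHS]addr0 E1.
  rewrite (rmorphM (phi d s)) (rmorphXn (phi d s)) rmorphN1 -cval_w exprMn -exprM.
  have -> : w ^+ m = w ^+ (d * (m %/ d)) * w ^+ (m %% d) by rewrite -exprD mulnC -divn_eq.
  move: (c ^+ _) (w ^+ _) (w ^+ _) (phi d s F) => A B C D; clear.
  have key (R : comNzRingType) (x y z t : R) : x * (y * z * t) = z * (x * y * t) by ring.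
  exact: key.
have dec_e e0 : decomposed (evO V e0).
  rewrite [e0]poly2_monoE rmorph_sum; elim/big_ind: _ => [|//|j _].
    by exists 0%N, (fun=> 0); rewrite mulr0 big1 // => r _; rewrite rmorph0 mulr0.
  rewrite rmorph_sum; elim/big_ind: _ => [|//|i _].
    by exists 0%N, (fun=> 0); rewrite mulr0 big1 // => r _; rewrite rmorph0 mulr0.
  rewrite !(rmorphM (evO V)) evOc (rmorphXn (@polyC _)) (rmorphXn (evO V)) evO_w.
  rewrite (rmorphXn (evO V)) evO_v exprMn.
  rewrite [w ^+ i * _]mulrA -exprD -phic mulrCA -(rmorphXn (phi d s)) -(rmorphM (phi d s)).
  exact: dec_mono.
have /choice [NE NEP] i : exists NE : nat * ('I_d -> {poly {poly k}}),
    c ^+ NE.1 * evO V (e i) = \sum_(r < d) w ^+ r * phi d s (NE.2 r).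
  by have [N [E eE]] := dec_e (e i); exists (N, E).
pose N := \max_i (NE i).1; exists N.
have /choice [E EP] i : exists E : 'I_d -> {poly {poly k}},
    c ^+ N * evO V (e i) = \sum_(r < d) w ^+ r * phi d s (E r).
  have [E eE] := decomposedX (N - (NE i).1) (NEP i); exists E; move: eE.
  by rewrite subnK //; apply: (leq_bigmax i).
by exists E.
Qed.

Variables (K : fieldType) (pi : {rmorphism {poly {poly k}} -> K}).
Hypothesis Kpi : is_function_field p pi.
Variable h : {rmorphism {fraction {poly k}} -> K}.
Hypothesis h_const : forall a : k, h (tofrac a%:P) = pi a%:P%:P.

Lemma ker_pi_phi a : pi a = 0 <-> phi d s a = 0.
Proof. by rewrite Kpi.1 (phi_kernel d_gt1 irr ps). Qed.

Lemma h_tofrac r : h (tofrac r) = lineval pi (h (tofrac 'X)) r.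
Proof.
rewrite -{1}[r]coefK poly_def !rmorph_sum; apply: eq_bigr => t _.
rewrite -mul_polyC (rmorphM (@tofrac _)) (rmorphM h) h_const; congr (_ * _).
by rewrite (rmorphXn (@tofrac _)) (rmorphXn h).
Qed.

(** Up to a power of c, each of d n + 1 elements of k[w, V] has d components in the function field,
    along the powers of w, and each component has n coordinates over k(t). The resulting vectors of
    length d n are dependent over k(t), and the relation is carried over to the series. The function
    x, the image of t, is nonconstant because h is injective. *)
Lemma map_to_P1_dep n : extension_degree h n -> exists A B,
  [/\ evO V B != 0, nonconstant (evO V A / evO V B) & dep V (evO V A / evO V B) (d * n)].
Proof.
move=> [b bP]; have [a0 [b0 [pib0 def_t]]] := Kpi.2 (h (tofrac 'X)).
have phib0 : phi d s b0 != 0 by apply: contraNneq pib0 => /ker_pi_phi ->.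
set x := phi d s a0 / phi d s b0.
have x_nc : nonconstant x.
  move=> al; apply/eqP => ex.
  have : pi (a0 - al%:P%:P * b0) = 0.
    apply/ker_pi_phi; rewrite (rmorphB (phi d s)) (rmorphM (phi d s)) phic -ex /x.
    by rewrite divfK // subrr.
  rewrite rmorphB rmorphM -h_const => /eqP; rewrite subr_eq0 => /eqP e.
  have : h (tofrac 'X) = h (tofrac al%:P) by rewrite def_t e mulfK.
  move/fmorph_inj/eqP; rewrite tofrac_eq => /eqP /(congr1 (fun q : {poly k} => size q)).
  by rewrite size_polyX size_polyC; case: eqP.
have [Na [A eA]] := phi_evO a0; have [Nb [B eB]] := phi_evO b0.
have w0 : w != 0 by apply: w_neq0.
have xE : evO V (('X)%:P ^+ Nb * A) / evO V (('X)%:P ^+ Na * B) = x.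
  rewrite !(rmorphM (evO V)) !(rmorphXn (evO V)) evO_w -eA -eB.
  have key (F : fieldType) (y z u v : F) : y != 0 -> z != 0 -> y * (z * u) / (z * (y * v))
    = u / v.
    by move=> y0 z0; rewrite mulrCA !invfM mulrACA mulfV // mul1r mulrACA mulfV // mul1r.
  by apply: key; rewrite expf_neq0.
exists (('X)%:P ^+ Nb * A), (('X)%:P ^+ Na * B); rewrite xE; split; [|exact: x_nc|].
  rewrite (rmorphM (evO V)) (rmorphXn (evO V)) evO_w -eB.
  exact: mulf_neq0 (expf_neq0 _ w0) (mulf_neq0 (expf_neq0 _ w0) phib0).
move=> e; have [N [E EP]] := decompose_family e.
have /choice [al alP] (ir : 'I_(d * n).+1 * 'I_d) : exists al : 'rV[{fraction {poly k}}]_n,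
    pi (E ir.1 ir.2) = \sum_(j < n) h (al 0 j) * b j.
  by have [al [e1 _]] := bP (pi (E ir.1 ir.2)); exists al.
pose M : 'M[{fraction {poly k}}]_((d * n).+1, d * n) :=
  \matrix_i mxvec (\matrix_(r < d, j < n) al (i, r) 0 j).
have [u [u0 uM]] := domain_left_kernel M (ltnSn _).
have [q [r [q0 rE]]] := fraction_row (fun i => u 0 i).
exists r; split.
  have [i ui] : exists i, u 0 i != 0.
    apply: contrapT => /forallNP h0; move/eqP: u0; apply; apply/rowP => i.
    by rewrite mxE; apply/eqP/negPn/negP/h0.
  exists i; apply/eqP => ri0; have /eqP := rE i.
  by rewrite ri0 rmorph0 eq_sym mulf_eq0 tofrac_eq0 (negPf q0) (negPf ui).
have relK (t : 'I_d) : \sum_i lineval pi (pi a0 / pi b0) (r i) * pi (E i t) = 0.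
  rewrite -def_t; transitivity (\sum_i \sum_j h (tofrac (r i) * al (i, t) 0 j) * b j).
    apply: eq_bigr => i _; rewrite -h_tofrac (alP (i, t)) mulr_sumr; apply: eq_bigr => j _.
    by rewrite rmorphM mulrA.
  rewrite exchange_big big1 // => j _; rewrite -mulr_suml -rmorph_sum.
  suff -> : \sum_i tofrac (r i) * al (i, t) 0 j = 0 by rewrite rmorph0 mul0r.
  have := congr1 (fun v : 'rV_(d * n) => tofrac q * v 0 (mxvec_index t j)) uM.
  rewrite !mxE mulr0 mulr_sumr => e1; rewrite -[RHS]e1; apply: eq_bigr => i _.
  by rewrite rE mxE mxvecE mxE mulrA.
have relO (t : 'I_d) : \sum_i peval x (r i) * phi d s (E i t) = 0.
  have := transfer (fun a => iffLR (ker_pi_phi a)) pib0 phib0 (relK t).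
  move=> e1; apply: etrans e1; apply: eq_bigr => i _.
  by rewrite lineval_phi.
have cN0 : c ^+ N != 0 := expf_neq0 N cval_neq0.
apply: (mulfI cN0); rewrite mulr0 mulr_sumr.
transitivity (\sum_(t < d) w ^+ t * \sum_i peval x (r i) * phi d s (E i t)).
  under [RHS]eq_bigr do rewrite mulr_sumr.
  rewrite exchange_big; apply: eq_bigr => i _ /=.
  rewrite mulrCA EP mulr_sumr; apply: eq_bigr => t _.
  exact: mulrCA.
by rewrite big1 // => t _; rewrite relO mulr0.
Qed.
End MapToP1.

Lemma fraction_lift (R : idomainType) (K : fieldType) (f : {rmorphism R -> K}) :
  injective f -> exists h : {rmorphism {fraction R} -> K}, forall a, h (tofrac a) = f a.
Proof.
move=> f_inj; have f0 a : a != 0 -> f a != 0.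
  by apply: contraNneq => e; apply/eqP/f_inj; rewrite e rmorph0.
have t0 (a : R) : a != 0 -> tofrac a != 0 :> {fraction R} by rewrite tofrac_eq0.
have /choice [nd ndP] (u : {fraction R}) : exists nd : R * R,
    nd.2 != 0 /\ u = tofrac nd.1 / tofrac nd.2.
  by have [a [b e]] := fraction_num_den u; exists (a, b).
pose h u := f (nd u).1 / f (nd u).2.
have hE a b : b != 0 -> h (tofrac a / tofrac b) = f a / f b.
  move=> b0; rewrite /h; have [c0 e] := ndP (tofrac a / tofrac b); move: e c0.
  move: (nd _) => [n m] /= e m0; apply/eqP; rewrite eqr_div ?f0 // -!rmorphM.
  move/eqP: e; rewrite eqr_div ?t0 // -!(rmorphM (@tofrac R)) tofrac_eq => /eqP ->.
  by [].
have hB : zmod_morphism h.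
  move=> u v; have [b0 ->] := ndP u; have [b0' ->] := ndP v.
  move: (nd u) (nd v) b0 b0' => [a b] [a' b'] /= b0 b0'.
  have key (F : fieldType) (x y z t : F) : y != 0 -> t != 0 -> x / y - z / t = (x * t - z *
    y) / (y * t).
    by move=> y0 z0; rewrite -mulNr addf_div // mulNr.
  rewrite key ?t0 // -!(rmorphM (@tofrac R)) -(rmorphB (@tofrac R)) !hE ?mulf_neq0 //.
  by rewrite key ?f0 // rmorphB !rmorphM.
have hM : monoid_morphism h.
  split.
    have -> : 1 = tofrac 1 / tofrac 1 :> {fraction R} by rewrite rmorph1 divr1.
    by rewrite hE ?oner_neq0 // rmorph1 divr1.
  move=> u v; have [b0 ->] := ndP u; have [b0' ->] := ndP v.
  move: (nd u) (nd v) b0 b0' => [a b] [a' b'] /= b0 b0'.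
  rewrite mulf_div -!(rmorphM (@tofrac R)) !hE ?mulf_neq0 //.
  by rewrite mulf_div !rmorphM.
pose H : {rmorphism {fraction R} -> K} := HB.pack h (GRing.isZmodMorphism.Build _ _ h hB)
  (GRing.isMonoidMorphism.Build _ _ h hM).
exists H => a; rewrite -[H _]/(h _) -[tofrac a]divr1 -(rmorph1 (@tofrac R)) hE ?oner_neq0 //.
by rewrite rmorph1 divr1.
Qed.

Lemma image_fraction_field (R : comNzRingType) (F : fieldType) (f : {rmorphism R -> F}) :
  exists (K : fieldType) (pi : {rmorphism R -> K}),
    (forall a, pi a = 0 <-> f a = 0) /\
    forall u, exists a b, pi b != 0 /\ u = pi a / pi b.
Proof.
have [||a b|a b|Q [q [q_surj qP]]] := @quotient_exists R (fun a => f a = 0).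
- exact: rmorph0.
- by move/eqP; rewrite rmorph1 oner_eq0.
- by rewrite rmorphB => -> ->; rewrite subrr.
- by rewrite rmorphM => ->; rewrite mulr0.
have [|D [g [g' [gK g'K]]]] := @classical_idomain Q.
  move=> b b'; have [a <-] := q_surj b; have [a' <-] := q_surj b'.
  rewrite -rmorphM => /qP /eqP; rewrite rmorphM mulf_eq0 => /orP [] /eqP /qP ->; by [left|right].
exists {fraction D}, (@tofrac D \o (g \o q))%FUN; split=> [a|u] /=.
  split=> [/eqP|/qP ->]; last by rewrite !rmorph0.
  by rewrite tofrac_eq0 -(rmorph0 g) (can_eq gK) => /eqP /qP.
have [a [b [b0 ->]]] := fraction_num_den u.
have [a' ea] := q_surj (g' a); have [b' eb] := q_surj (g' b).
by exists a', b'; rewrite /= ea eb !g'K tofrac_eq0.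
Qed.

(* The function c has degree deg_z p on the curve. *)
Lemma map_to_P1_exists (k : fieldType) (d : nat) (s : nat -> k) (p : {poly {poly k}}) :
  (1 < d)%N -> dynatomic d p -> phi d s p = 0 -> exists n, has_dominant_map_to_P1 p n.
Proof.
move=> d_gt1 dp ps; have [irr _] := dp.
have [c0 [P [c0_neq0 monP def_p]]] := dynatomic_monic d_gt1 dp.
have [K [pi [ker_pi frac_pi]]] := image_fraction_field (phi d s).
have kerP a : pi a = 0 <-> exists Q, a = Q * P.
  rewrite ker_pi (phi_kernel d_gt1 irr ps) def_p; split=> [[Q ->]|[Q ->]].
    by exists (Q * c0%:P%:P); rewrite mulrA.
  exists (Q * c0^-1%:P%:P); rewrite mulrA -(mulrA Q) -!rmorphM mulVf // !rmorph1.
  by rewrite mulr1.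
have small (a : {poly {poly k}}) : (size a < size P)%N -> pi a = 0 -> a = 0.
  by move=> lt /kerP [Q e]; apply: (monic_small_multiple monP (esym e)).
have [|h hP] := @fraction_lift {poly k} K (pi \o polyC)%FUN.
  move=> a b /= e; apply/eqP; rewrite -subr_eq0; apply/eqP; apply: (phi_inj_coef d_gt1 (s := s)).
  by apply/ker_pi; rewrite rmorphB rmorphB /= e subrr.
exists (size P).-1, K, pi; split; first by split=> // q; rewrite ker_pi (phi_kernel d_gt1 irr ps).
exists h; split=> [a|]; first exact: hP.
set D := (size P).-1.
have szP : size P = D.+1 by rewrite prednK // size_poly_gt0 monic_neq0.
have pi_small (a : {poly {poly k}}) : (size a <= D)%N ->
    pi a = \sum_(j < D) h (tofrac a`_j) * pi 'X ^+ j.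
  move=> sza; have {1}-> : a = \poly_(j < D) a`_j.
    apply/polyP => j; rewrite coef_poly; case: ltnP => // le.
    by rewrite nth_default // (leq_trans sza).
  rewrite poly_def rmorph_sum; apply: eq_bigr => j _.
  by rewrite -mul_polyC rmorphM rmorphXn hP.
exists (fun j => pi 'X ^+ j) => u.
have [a [b [pib0 def_u]]] := frac_pi u.
(* For u = a / b, the D + 1 elements b z^i with i < D and a are dependent over k[c], since modulo P
   they lie in a free module of rank D. The coefficient of a in the relation turns out to be
   nonzero, and division by it expresses u through the powers of z. *)
pose e (i : 'I_D.+1) := if (i < D)%N then b * 'X^i else a.
have /choice [qr qrP] i : exists qr : {poly {poly k}} * {poly {poly k}},
    e i = qr.1 * P + qr.2 /\ (size qr.2 <= D)%N.
  by have [q [r [eq szr]]] := monic_division monP (e i); exists (q, r); rewrite -ltnS -szP.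
have [r [r0 rM]] := domain_left_kernel (\matrix_(i < D.+1, j < D) (qr i).2`_j) (ltnSn D).
have rel : \sum_i pi (r 0 i)%:P * pi (e i) = 0.
  have pir i : pi (e i) = \sum_(j < D) h (tofrac (qr i).2`_j) * pi 'X ^+ j.
    have [-> szr] := qrP i; rewrite rmorphD -pi_small //.
    by rewrite (_ : pi (_ * P) = 0) ?add0r //; apply/kerP; exists (qr i).1.
  transitivity (\sum_i \sum_(j < D) h (tofrac (r 0 i * (qr i).2`_j)) * pi 'X ^+ j).
    apply: eq_bigr => i _; rewrite pir mulr_sumr; apply: eq_bigr => j _.
    by rewrite !hP /= mulrA -!rmorphM.
  rewrite exchange_big big1 // => j _; rewrite -mulr_suml -!rmorph_sum.
  have := congr1 (fun v : 'rV_D => v 0 j) rM; rewrite !mxE => e1.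
  rewrite [X in h (tofrac X)](_ : _ = 0) ?rmorph0 ?mul0r //; rewrite -[RHS]e1.
  by apply: eq_bigr => i _; rewrite mxE.
have rel2 : pi b * (\sum_(j < D) pi (r 0 (widen_ord (leqnSn D) j))%:P * pi 'X ^+ j) =
    - (pi (r 0 ord_max)%:P * pi a).
  apply/eqP; rewrite -addr_eq0 -[X in _ == X]rel big_ord_recr /= {2}/e ltnn; apply/eqP;
    congr (_ + _).
  rewrite mulr_sumr; apply: eq_bigr => j _.
  by rewrite /e /= ltn_ord rmorphM rmorphXn mulrCA.
have uniq_coef (al : 'I_D -> {fraction {poly k}}) :
    \sum_(j < D) h (al j) * pi 'X ^+ j = 0 -> forall j, al j = 0.
  move=> eq0 j; have [q [c [q0 cE]]] := fraction_row al.
  pose C : {poly {poly k}} := \poly_(j < D) oapp c 0 (insub j).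
  have C0 : C = 0.
    apply: small; first by rewrite szP ltnS size_poly.
    rewrite pi_small ?size_poly //.
    transitivity (h (tofrac q) * \sum_(j < D) h (al j) * pi 'X ^+ j); last by rewrite eq0 mulr0.
    rewrite mulr_sumr.
    by apply: eq_bigr => i _; rewrite coef_poly ltn_ord valK /= cE rmorphM mulrA.
  have := cE j; have -> : c j = C`_j by rewrite coef_poly ltn_ord valK.
  rewrite C0 coef0 rmorph0 => /esym/eqP; rewrite mulf_eq0 tofrac_eq0 (negPf q0) => /eqP.
  by [].
have rmax : r 0 ord_max != 0.
  apply/eqP => e0; move: rel2; rewrite e0 rmorph0 mul0r oppr0 => /eqP.
  rewrite mulf_eq0 (negPf pib0) /= => /eqP e1; move/eqP: r0; apply; apply/rowP => i.
  rewrite mxE; have [lt|le] := ltnP i D; last first.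
    by rewrite (_ : i = ord_max) //; apply: val_inj; apply/eqP; rewrite eqn_leq le -ltnS ltn_ord.
  have := uniq_coef (fun j => tofrac (r 0 (widen_ord (leqnSn D) j))) _ (Ordinal lt).
  rewrite (_ : widen_ord _ _ = i); last exact: val_inj.
  move=> e2; apply/eqP; rewrite -tofrac_eq0; apply/eqP/e2; rewrite -[RHS]e1.
  by apply: eq_bigr => j _; rewrite hP.
have hmax : pi (r 0 ord_max)%:P != 0.
  rewrite -[pi _]/((pi \o polyC)%FUN _) -hP (fmorph_eq0 h) tofrac_eq0; exact: rmax.
pose al0 : 'rV[{fraction {poly k}}]_D :=
  \row_j - (tofrac (r 0 (widen_ord (leqnSn D) j)) / tofrac (r 0 ord_max)).
have al0P : u = \sum_(j < D) h (al0 0 j) * pi 'X ^+ j.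
  have e3 : pi (r 0 ord_max)%:P * u =
      - \sum_(j < D) pi (r 0 (widen_ord (leqnSn D) j))%:P * pi 'X ^+ j.
    by apply: (mulIf pib0); rewrite def_u mulrA mulfVK // mulNr [in RHS]mulrC rel2 opprK.
  apply: (mulfI hmax); rewrite e3 mulr_sumr -sumrN; apply: eq_bigr => j _.
  rewrite mxE rmorphN fmorph_div !hP /= mulNr mulrN; congr (- _).
  by rewrite mulrA mulrCA mulfV ?mulr1.
exists al0; split=> [|al' e2]; first exact: al0P.
apply/rowP => j; apply/eqP; rewrite -subr_eq0; apply/eqP.
apply: (uniq_coef (fun j => al0 0 j - al' 0 j)).
under eq_bigr do rewrite rmorphB mulrBl.
by rewrite sumrB -al0P -e2 subrr.
Qed.

Lemma gonality_exists (k : fieldType) (p : {poly {poly k}}) :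
  (exists n, has_dominant_map_to_P1 p n) -> exists g, is_gonality p g.
Proof. by move=> /(ex_minimal id). Qed.

(** * Finiteness of the curves of bounded gonality *)

Lemma injective_code_bounded (T : eqType) (X : seq T) (Q : nat -> Prop) (f : nat -> T) :
  (forall i, Q i -> f i \in X) -> (forall i j, Q i -> Q j -> f i = f j -> i = j) ->
  exists N, forall i, Q i -> (i < N)%N.
Proof.
move=> fX f_inj.
have /choice [g gP] (x : T) : exists N, forall i, Q i -> f i = x -> (i < N)%N.
  have [[i [Qi e]]|h] := pselect (exists i, Q i /\ f i = x); last first.
    by exists 0%N => i Qi e; case: h; exists i.
  by exists i.+1 => j Qj ej; rewrite (f_inj j i) // ej e.
exists (\max_(x <- X) g x) => i Qi; apply: leq_trans (gP (f i) i Qi erefl) _.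
by apply: leq_bigmax_seq (fX i Qi) _.
Qed.

Lemma root_of_unity_list (k : fieldType) (d : nat) (kbar : closedFieldType)
    (iota : {rmorphism k -> kbar}) : d%:R != 0 :> k -> (0 < d)%N ->
  (forall x : kbar, x ^+ d = 1 -> exists a, x = iota a) ->
  exists U : seq k, [/\ uniq U, size U = d & forall a, a \in U -> a ^+ d = 1].
Proof.
move=> dk d0 mu; have [r er] := closed_field_poly_normal ('X^d - 1 : {poly kbar}).
have mon : ('X^d - 1 : {poly kbar}) \is monic by apply: monic_Xn_sub_1.
move: er; rewrite (monicP mon) scale1r => er.
have r_uniq : uniq r.
  rewrite -separable_prod_XsubC -er separable_Xn_sub_1 //.
  by rewrite -(rmorph_nat iota) fmorph_eq0.
have r_root x : x \in r -> x ^+ d = 1.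
  rewrite -root_prod_XsubC -er /root hornerD hornerN hornerXn hornerC subr_eq0.
  by move=> /eqP.
have /choice [f fP] x : exists a, x \in r -> iota a = x.
  have [/r_root /mu [a ->]|_] := boolP (x \in r); first by exists a.
  by exists 0.
have fr : map iota (map f r) = r by rewrite -map_comp map_id_in.
exists (map f r); split.
- by apply: (@map_uniq _ _ iota); rewrite fr.
- have := size_prod_XsubC r id; rewrite -er size_map.
  by rewrite size_polyDl ?size_polyXn ?size_polyN ?size_poly1 ?ltnS // => -[].
move=> _ /mapP [x xr ->]; apply: (fmorph_inj iota).
by rewrite rmorphXn fP // rmorph1 r_root.
Qed.

Definition low_degree (k : fieldType) d (s : nat -> k) n : Prop := exists A B,
  [/\ evO (point_series d s) B != 0,
      nonconstant (evO (point_series d s) A / evO (point_series d s) B) &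
      dep (point_series d s) (evO (point_series d s) A / evO (point_series d s) B) n].

Definition preperiodic_itinerary (k : fieldType) d (s : nat -> k) : Prop :=
  itinerary d s /\ exists n m, (m < n)%N /\ preperiodic n m s.

Lemma point_generator (k : fieldType) d (s : nat -> k) n m : (1 < d)%N ->
  d%:R \is a @GRing.unit k -> itinerary d s -> (m < n)%N -> preperiodic n m s ->
  exists P, kernel_generator (point_series d s) P.
Proof.
move=> d_gt1 dU s_it mn s_per.
apply: (@kernel_generator_exists _ _ (cycle_poly k d n m)).
  by case: (cycle_poly_monic_size k d_gt1 mn).
exact: ev_cycle_poly.
Qed.

(** Finiteness by an injective code with values in a finite list. The type of the codes is left
    open, because in characteristic 0 an itinerary is coded by its point over the residue field. *)
Definition finitely_many (k : fieldType) d (Q : (nat -> k) -> Prop) : Prop :=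
  exists (T : eqType) (X : seq T) (f : (nat -> k) -> T),
    (forall s, preperiodic_itinerary d s -> Q s -> f s \in X) /\
    forall s s', itinerary d s -> itinerary d s' -> f s = f s' -> s = s'.

Section Finiteness.
Variables (d : nat).
Hypothesis d_gt1 : (1 < d)%N.
Let d0 : (0 < d)%N := ltnW d_gt1.

Lemma finiteness_pchar (k : fieldType) l (U : seq k) n :
  l \in [pchar k]%R -> d%:R \is a @GRing.unit k ->
  uniq U -> size U = d -> (forall a, a \in U -> a ^+ d = 1) ->
  exists X : seq (series k), forall s, preperiodic_itinerary d s ->
    low_degree d s n -> point_series d s \in X.
Proof.
move=> l_char dU U_uniq U_size U_root.
have l_prime := pcharf_prime l_char.
have co : coprime l d.
  by rewrite prime_coprime // (dvdn_pcharf l_char); move: dU; rewrite unitfE.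
(* By Euler's theorem q = 1 mod d, so the power q fixes the dth roots of unity. *)
pose q := (l ^ totient d)%N.
have q_gt1 : (1 < q)%N.
  by rewrite -(exp1n (totient d)) ltn_exp2r ?totient_gt0 // prime_gt1.
have qP : [pchar k]%R.-nat q by rewrite pnatX pnatE // l_char.
have q_mu (a : k) : a ^+ d = 1 -> a ^+ q = a.
  move=> ad; have := Euler_exp_totient co; rewrite -/q => e.
  by rewrite (divn_eq q d) e modn_small // exprD mulnC exprM ad expr1n mul1r expr1.
pose M := (n * (n + n * q).+1)%N.
have [X XP] := northcott M.+1 qP d_gt1 dU U_uniq U_size U_root q_gt1 q_mu.
exists X => s [s_it [n0 [m0 [mn s_per]]]] [A [B [B0 x_nc x_dep]]].
have [P kerP] := point_generator d_gt1 dU s_it mn s_per.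
have [c [c_it c_inj c_ker]] := conjugate_points d_gt1 dU U_uniq U_size U_root s_it mn s_per kerP.
apply: (XP s n0 m0 P) => //.
have := place_count d_gt1 dU qP q_gt1 q_mu s_it B0 x_nc x_dep c_it c_inj.
rewrite -/M => h; have : ((size P).-1 <= M)%N.
  have evOP (W : series k) a : evO W a = 0 <-> ev W a = 0.
    by split=> /eqP; [rewrite evO_eq0 | rewrite -evO_eq0] => /eqP.
  by apply: h => i a; rewrite !evOP.
by case: (size P).
Qed.
Lemma finiteness_char0 (k : fieldType) (U : seq k) n :
  (forall m : nat, (0 < m)%N -> m%:R != 0 :> k) ->
  uniq U -> size U = d -> (forall a, a \in U -> a ^+ d = 1) ->
  finitely_many d (fun s : nat -> k => low_degree d s n).
Proof.
move=> char0 U_uniq U_size U_root.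
have [l l_prime d_l] := prime_congruent_1 d_gt1.
have [O [kap [io [rho [io_inj valuation rho_unit rho_surj l_kap]]]]] := place_exists
  l_prime char0.
have natO_neq0 m : (0 < m)%N -> m%:R != 0 :> O.
  by move=> /char0; apply: contraNneq => e; rewrite -(rmorph_nat io) e rmorph0.
have dkap : d%:R != 0 :> kap.
  have [c ec] := dvdnP d_l; apply/eqP => e; have : l%:R = 1 :> kap.
    by rewrite -(prednK (prime_gt0 l_prime)) ec -natr1 natrM e mulr0 add0r.
  by rewrite l_kap => /eqP; rewrite eq_sym oner_eq0.
have dO : d%:R \is a @GRing.unit O by apply: rho_unit; rewrite rmorph_nat.
have dU : d%:R \is a @GRing.unit k by rewrite unitfE char0.
have dU' : d%:R \is a @GRing.unit kap by rewrite unitfE.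
(* The dth roots of unity lie in O: if b in O is the inverse of such a root a, then a = b^(d-1). *)
have lift (a : k) : exists b, a ^+ d = 1 -> io b = a.
  have [ad|] := pselect (a ^+ d = 1); last by move=> h; exists 0.
  have a0 : a != 0.
    by apply/eqP => e; move: ad; rewrite e expr0n gtn_eqF // => /eqP; rewrite eq_sym oner_eq0.
  have [b [e|e]] := valuation a a0; first by exists b.
  exists (b ^+ d.-1) => _; rewrite rmorphXn e exprVn; apply: (mulfI (expf_neq0 d.-1 a0)).
  by rewrite mulfV ?expf_neq0 // -exprSr prednK.
(* The quotient z = a / b reduces to 1, so 1 + z + ... + z^(d-1) reduces to d, which is nonzero; as
   z^d = 1, this forces z = 1. *)
have rho_inj_mu (a b : O) : a ^+ d = 1 -> b ^+ d = 1 -> rho a = rho b -> a = b.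
  move=> ad bd e; pose z := a * b ^+ d.-1.
  have bb : b ^+ d.-1 * b = 1 by rewrite -exprSr prednK.
  have rz : rho z = 1 by rewrite rmorphM e -rmorphM mulrC bb rmorph1.
  have zd : z ^+ d = 1 by rewrite exprMn ad mul1r exprAC bd expr1n.
  have /eqP : (z - 1) * (\sum_(i < d) z ^+ i) = 0 by rewrite -subrX1 zd subrr.
  have S0 : \sum_(i < d) z ^+ i != 0.
    apply/eqP => /(congr1 rho); rewrite rmorph_sum rmorph0.
    under eq_bigr do rewrite rmorphXn rz expr1n.
    by rewrite sumr_const card_ord => /eqP; rewrite (negPf dkap).
  rewrite mulf_eq0 (negPf S0) orbF subr_eq0 => /eqP z1.
  by rewrite -[LHS]mulr1 -bb mulrA -/z z1 mul1r.
have /choice [li liP] := lift.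
pose Ukap := [seq rho (li a) | a <- U].
have li_mu a : a ^+ d = 1 -> li a ^+ d = 1.
  by move=> ad; apply: io_inj; rewrite rmorphXn liP // rmorph1.
have Ukap_root b : b \in Ukap -> b ^+ d = 1.
  by move=> /mapP [a /U_root ad ->]; rewrite -rmorphXn li_mu ?rmorph1.
have Ukap_uniq : uniq Ukap.
  rewrite map_inj_in_uniq // => a b /U_root ad /U_root bd /rho_inj_mu e.
  by rewrite -(liP a) // -(liP b) // e // li_mu.
have Ukap_size : size Ukap = d by rewrite size_map.
have [X XP] := finiteness_pchar n (l_char l_prime l_kap) dU' Ukap_uniq Ukap_size Ukap_root.
exists (series kap), X, (fun s => point_series d (rho \o (li \o s))); split; last first.
  move=> s s' hs hs' e; apply: funext => i.
  have itk (t : nat -> k) : itinerary d t -> itinerary d (rho \o (li \o t)).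
    by move=> ht j; rewrite /= -rmorphXn li_mu ?rmorph1.
  have := point_series_inj d_gt1 dU' (itk _ hs) (itk _ hs') e i.
  by move=> /= /rho_inj_mu e1; rewrite -(liP (s i)) // -(liP (s' i)) // e1 // li_mu.
move=> s [hs [n0 [m0 [mn s_per]]]] [A [B]].
pose t := (li \o s)%FUN.
have t_it : itinerary d t by move=> i; apply: li_mu.
have t_per : preperiodic n0 m0 t by move=> i; rewrite /t /= s_per.
have -> : point_series d s = series_map io (point_series d t).
  rewrite point_series_map //; congr point_series; apply: funext => i /=.
  by rewrite liP.
have [Pk kerPk] := point_generator d_gt1 dU hs mn s_per.
move=> [B0 x_nc x_dep].
have r_it : itinerary d (rho \o t) by move=> i; rewrite /= -rmorphXn t_it rmorph1.
have r_per : preperiodic n0 m0 (rho \o t) by move=> i /=; rewrite t_per.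
have [Pkap kerPkap] := point_generator d_gt1 dU' r_it mn r_per.
apply: XP; first by split=> //; exists n0, m0.
move: kerPkap; rewrite /low_degree -(point_series_map _ _ dO) => kerPkap.
have kerPk' : kernel_generator (series_map io (point_series d t)) Pk.
  rewrite point_series_map //; move: kerPk; congr (kernel_generator (point_series d _) _).
  by apply: funext => i /=; rewrite liP.
exact: (reduce_dep io_inj valuation rho_unit rho_surj l_prime l_kap natO_neq0 d_gt1 dO d_l
  t_it mn t_per kerPk' kerPkap Ukap_uniq Ukap_size Ukap_root B0 x_nc x_dep).
Qed.

Lemma finiteness (k : fieldType) (U : seq k) n : d%:R \is a @GRing.unit k ->
  uniq U -> size U = d -> (forall a, a \in U -> a ^+ d = 1) ->
  finitely_many d (fun s : nat -> k => low_degree d s n).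
Proof.
move=> dU U_uniq U_size U_root.
have [char0|] := pselect (forall m : nat, (0 < m)%N -> m%:R != 0 :> k).
  exact: finiteness_char0 char0 U_uniq U_size U_root.
move=> /existsNP [m /not_implyP [m0 /negP]]; rewrite negbK => /(natf0_pchar m0) [l l_char].
have [X XP] := finiteness_pchar n l_char dU U_uniq U_size U_root.
exists (series k), X, (point_series d); split=> // s s' hs hs' e.
by apply: funext; apply: point_series_inj e.
Qed.
End Finiteness.

Theorem theorem1p1 (d : nat) (k : fieldType)
    (kbar : closedFieldType) (iota : {rmorphism k -> kbar})
    (kbar_algebraic : forall x : kbar, algebraicOver iota x)
    (d_ge2 : (2 <= d)%N)
    (char_ndvd_d : forall p : nat, p \in [pchar k] -> ~~ (p %| d)%N)
    (mu_d_sub_k : forall x : kbar, x ^+ d = 1 -> exists a : k, x = iota a) :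
  (forall p : {poly {poly k}}, dynatomic d p -> geometrically_irreducible p) /\
  (forall P : nat -> {poly {poly k}}, dynatomic_listing d P ->
     exists g : nat -> nat,
       (forall i, is_gonality (P i) (g i)) /\
       (forall B : nat, exists N : nat, forall i : nat,
          (N <= i)%N -> (B <= g i)%N)).
Proof.
have d0 : (0 < d)%N := ltnW d_ge2.
have dk : d%:R != 0 :> k.
  apply/negP => e; have [p pk] := natf0_pchar d0 e.
  by have := char_ndvd_d p pk; rewrite (dvdn_pcharf pk) e.
have [U [U_uniq U_size U_root]] := root_of_unity_list dk d0 mu_d_sub_k.
have dU : d%:R \is a @GRing.unit k by rewrite unitfE.
split; first exact: dynatomic_geometrically_irreducible d_ge2 dU U_uniq U_size U_root.
move=> P [P_dyn P_inj _].
have /choice [s sP] i : exists s : nat -> k,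
    [/\ itinerary d s, exists n m, (m < n)%N /\ preperiodic n m s & phi d s (P i) = 0].
  exact: dynatomic_root d_ge2 dU U_uniq U_size U_root (P i) (P_dyn i).
have /choice [g gP] i : exists g, is_gonality (P i) g.
  apply: gonality_exists; have [_ _ ps] := sP i.
  exact: map_to_P1_exists d_ge2 (P_dyn i) ps.
exists g; split=> // B.
(* Each single gonality n occurs finitely often, and only the n < B matter. *)
have /choice [N NP] n : exists N, forall i, g i = n -> (i < N)%N.
  have [T [X [f [fX f_inj]]]] := finiteness d_ge2 (d * n)%N dU U_uniq U_size U_root.
  apply: (@injective_code_bounded T X (fun i => g i = n) (f \o s)) => [i gi|i j _ _ e].
    have [s_it s_per ps] := sP i; apply: fX; first by split.
    have [[K [pi [Kpi [h [h_const h_deg]]]]] _] := gP i; rewrite gi in h_deg.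
    have [irr _] := P_dyn i.
    by have := map_to_P1_dep d_ge2 irr ps Kpi h_const h_deg.
  (* Curves with the same itinerary coincide, as the ideal of a curve is the kernel of evaluation at
     its point. *)
  have [s_it _ ps] := sP i; have [s_it' _ ps'] := sP j.
  have es : s i = s j by apply: f_inj.
  apply: P_inj => r; rewrite -(phi_kernel d_ge2 (P_dyn i).1 ps) -(phi_kernel d_ge2 (P_dyn
    j).1 ps').
  by rewrite es.
exists (\max_(n < B) N n) => i le; rewrite leqNgt; apply/negP => lt.
have := leq_trans (NP (g i) i erefl) (leq_bigmax (F := fun n : 'I_B => N n) (Ordinal lt)).
by rewrite ltnNge le.
Qed.
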